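(* Let $\omega>0$, $l\ge0$, $\mu>0$ and $\lambda=\frac{1}{4\omega^2}-\mu^2$. The equation $z^2E''+((-l+1)z+\mu(1-z^2))E'+(\lambda+\mu(l-1)z)E=0$ has a nontrivial polynomial solution if and only if $l\in\mathbb N$, $c_1=0$ and $c_0\neq0$, where $c_0,c_1$ are the Stokes multipliers of system (L) with the same $\omega,l,\mu$.
   Context: System (L): $u'=z^{-2}\big(-(lz+\mu(1+z^2))u+\frac{z}{2i\omega}v\big)$, $v'=\frac{1}{2i\omega z}u$. $F(z)=\operatorname{diag}(z^{-l}e^{\mu(1/z-z)},1)$. $S_\pm$ are sectors with vertex $0$ containing the closed upper/lower half-plane minus $0$, closures avoiding $i\mathbb R_\mp$, with $S_-=\overline{S_+}$. $H_\pm$ are the unique invertible matrix functions holomorphic on $S_\pm$, $C^\infty$ on $\overline{S_\pm}\setminus\{\infty\}$, $H_\pm(0)=\mathrm{Id}$, transforming (L) via $w=H_\pm\tilde w$ into $\tilde u'=-z^{-2}(lz+\mu(1+z^2))\tilde u$, $\tilde v'=0$. $W_\pm=H_\pm F$ (branch on $S_-$ by counterclockwise continuation from $S_+$); $W_{+,1}=H_+F$ with branch on $S_+$ continued counterclockwise from $S_-$. With $\Sigma_0\ni\mathbb R_-$, $\Sigma_1\ni\mathbb R_+$ the components of $S_+\cap S_-$, the Stokes matrices are defined by $W_-=W_+C_0$ on $\Sigma_0$, $W_{+,1}=W_-C_1$ on $\Sigma_1$, and $C_0=\begin{pmatrix}1&c_0\\0&1\end{pmatrix}$, $C_1=\begin{pmatrix}1&0\\c_1&1\end{pmatrix}$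 (Stokes multipliers $c_0,c_1$). *)

(* Defs.v *)
From Stdlib Require Import Reals List.
Open Scope R_scope.

Definition Cplx : Type := (R * R)%type.
Definition RtoC (x : R) : Cplx := (x, 0).
Definition C0 : Cplx := (0, 0).
Definition C1 : Cplx := (1, 0).
Definition Ci : Cplx := (0, 1).
Definition Cadd (z w : Cplx) : Cplx := (fst z + fst w, snd z + snd w).
Definition Copp (z : Cplx) : Cplx := (- fst z, - snd z).
Definition Csub (z w : Cplx) : Cplx := Cadd z (Copp w).
Definition Cmul (z w : Cplx) : Cplx :=
  (fst z * fst w - snd z * snd w, fst z * snd w + snd z * fst w).
Definition Cinv (z : Cplx) : Cplx :=
  (fst z / (fst z ^ 2 + snd z ^ 2), - snd z / (fst z ^ 2 + snd z ^ 2)).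
Definition Cdiv (z w : Cplx) : Cplx := Cmul z (Cinv w).
Definition Cnorm (z : Cplx) : R := sqrt (fst z ^ 2 + snd z ^ 2).
Definition Cexp (z : Cplx) : Cplx := (exp (fst z) * cos (snd z), exp (fst z) * sin (snd z)).
Definition polar (r theta : R) : Cplx := (r * cos theta, r * sin theta).

Record M2 : Type := mkM2 { e11 : Cplx; e12 : Cplx; e21 : Cplx; e22 : Cplx }.
Definition Mmul (A B : M2) : M2 :=
  mkM2 (Cadd (Cmul (e11 A) (e11 B)) (Cmul (e12 A) (e21 B)))
       (Cadd (Cmul (e11 A) (e12 B)) (Cmul (e12 A) (e22 B)))
       (Cadd (Cmul (e21 A) (e11 B)) (Cmul (e22 A) (e21 B)))
       (Cadd (Cmul (e21 A) (e12 B)) (Cmul (e22 A) (e22 B))).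
Definition Msub (A B : M2) : M2 :=
  mkM2 (Csub (e11 A) (e11 B)) (Csub (e12 A) (e12 B))
       (Csub (e21 A) (e21 B)) (Csub (e22 A) (e22 B)).
Definition Mid : M2 := mkM2 C1 C0 C0 C1.
Definition Mdiag (a d : Cplx) : M2 := mkM2 a C0 C0 d.
Definition Mdet (A : M2) : Cplx := Csub (Cmul (e11 A) (e22 A)) (Cmul (e12 A) (e21 A)).

Definition Clim (f : Cplx -> Cplx) (S : Cplx -> Prop) (w L : Cplx) : Prop :=
  forall eps, 0 < eps -> exists delta, 0 < delta /\
    forall z, S z -> Cnorm (Csub z w) < delta -> Cnorm (Csub (f z) L) < eps.

Definition Cderiv_on (S : Cplx -> Prop) (f f' : Cplx -> Cplx) : Prop :=
  forall z, S z -> forall eps, 0 < eps -> exists delta, 0 < delta /\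
    forall h, h <> C0 -> S (Cadd z h) -> Cnorm h < delta ->
      Cnorm (Csub (Cdiv (Csub (f (Cadd z h)) (f z)) h) (f' z)) < eps.

Definition Mlim (F : Cplx -> M2) (S : Cplx -> Prop) (w : Cplx) (L : M2) : Prop :=
  Clim (fun z => e11 (F z)) S w (e11 L) /\ Clim (fun z => e12 (F z)) S w (e12 L) /\
  Clim (fun z => e21 (F z)) S w (e21 L) /\ Clim (fun z => e22 (F z)) S w (e22 L).

Definition MCderiv_on (S : Cplx -> Prop) (F F' : Cplx -> M2) : Prop :=
  Cderiv_on S (fun z => e11 (F z)) (fun z => e11 (F' z)) /\
  Cderiv_on S (fun z => e12 (F z)) (fun z => e12 (F' z)) /\
  Cderiv_on S (fun z => e21 (F z)) (fun z => e21 (F' z)) /\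
  Cderiv_on S (fun z => e22 (F z)) (fun z => e22 (F' z)).

Definition sector (a b : R) (z : Cplx) : Prop :=
  exists r theta, 0 < r /\ a < theta < b /\ z = polar r theta.
Definition sector_closure (a b : R) (z : Cplx) : Prop :=
  z = C0 \/ exists r theta, 0 < r /\ a <= theta <= b /\ z = polar r theta.

(** H is holomorphic on the open sector S and C^infinity on the closure of S in C
    (i.e. all its complex derivatives extend continuously to the closure,
    including the vertex 0), with value H0 at 0. *)
Definition holo_smooth_upto (a b : R) (H : Cplx -> M2) (H0 : M2) : Prop :=
  exists D : nat -> Cplx -> M2,
    (forall z, sector a b z -> D O z = H z) /\
    (forall n, MCderiv_on (sector a b) (D n) (D (S n))) /\
    (forall n w, sector_closure a b w -> exists L, Mlim (D n) (sector a b) w L) /\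
    Mlim H (sector a b) C0 H0.

(** coefficient matrix of (L): w' = A(z) w, w = (u,v) *)
Definition Amat (omega l mu : R) (z : Cplx) : M2 :=
  let zi := Cinv z in
  let k := Cinv (Cmul (RtoC (2 * omega)) Ci) in
  mkM2 (Copp (Cmul (Cmul zi zi)
                   (Cadd (Cmul (RtoC l) z)
                         (Cmul (RtoC mu) (Cadd C1 (Cmul z z))))))
       (Cmul (Cmul (Cmul zi zi) z) k)
       (Cmul k zi)
       C0.
Definition Bmat (l mu : R) (z : Cplx) : M2 :=
  let zi := Cinv z in
  Mdiag (Copp (Cmul (Cmul zi zi)
                    (Cadd (Cmul (RtoC l) z)
                          (Cmul (RtoC mu) (Cadd C1 (Cmul z z))))))
        C0.

(** w = H w~ transforms (L) into the diagonal system on S: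
    H' = A H - H B on S (gauge transformation equation). *)
Definition transforms_L (omega l mu a b : R) (H : Cplx -> M2) : Prop :=
  exists H', MCderiv_on (sector a b) H H' /\
    forall z, sector a b z ->
      H' z = Msub (Mmul (Amat omega l mu z) (H z)) (Mmul (H z) (Bmat l mu z)).

Definition is_H (omega l mu a b : R) (H : Cplx -> M2) : Prop :=
  (forall z, sector a b z -> Mdet (H z) <> C0) /\
  holo_smooth_upto a b H Mid /\
  transforms_L omega l mu a b H.

(** F(z) = diag(z^{-l} e^{mu(1/z - z)}, 1), evaluated at z = r e^{i theta}
    with the branch of z^{-l} determined by the argument theta. *)
Definition Fbr (l mu r theta : R) : M2 :=
  let z := polar r theta in
  Mdiag (Cmul (Cmul (RtoC (Rpower r (- l))) (Cexp (0, - l * theta)))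
              (Cexp (Cmul (RtoC mu) (Csub (Cinv z) z))))
        C1.

Definition Cmat0 (c0 : Cplx) : M2 := mkM2 C1 c0 C0 C1.
Definition Cmat1 (c1 : Cplx) : M2 := mkM2 C1 C0 c1 C1.

(** Stokes relations.  S_+ = sector a b, S_- = sector (-b) (-a).
    W_+ uses arguments in (a,b); W_- (continued counterclockwise from S_+)
    uses arguments in (2PI-b, 2PI-a); W_{+,1} uses arguments in (2PI+a, 2PI+b).
    Sigma_0 (containing R_-) = arguments (2PI-b, b);
    Sigma_1 (containing R_+) = arguments (2PI+a, 2PI-a). *)
Definition stokes_relations (l mu a b : R) (Hp Hm : Cplx -> M2) (c0 c1 : Cplx) : Prop :=
  (forall r theta, 0 < r -> 2 * PI - b < theta < b ->
     let z := polar r theta in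
     Mmul (Hm z) (Fbr l mu r theta) = Mmul (Mmul (Hp z) (Fbr l mu r theta)) (Cmat0 c0)) /\
  (forall r theta, 0 < r -> 2 * PI + a < theta < 2 * PI - a ->
     let z := polar r theta in
     Mmul (Hp z) (Fbr l mu r theta) = Mmul (Mmul (Hm z) (Fbr l mu r theta)) (Cmat1 c1)).

Fixpoint Peval (p : list Cplx) (z : Cplx) : Cplx :=
  match p with nil => C0 | c :: p' => Cadd c (Cmul z (Peval p' z)) end.
Fixpoint pd_aux (k : nat) (p : list Cplx) : list Cplx :=
  match p with nil => nil | c :: p' => Cmul (RtoC (INR k)) c :: pd_aux (S k) p' end.
Definition Pderiv (p : list Cplx) : list Cplx :=
  match p with nil => nil | _ :: p' => pd_aux 1 p' end.

Definition poly_solution (l mu lambda : R) (p : list Cplx) : Prop :=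
  (exists z, Peval p z <> C0) /\
  forall z,
    Cadd (Cadd (Cmul (Cmul z z) (Peval (Pderiv (Pderiv p)) z))
               (Cmul (Cadd (Cmul (RtoC (- l + 1)) z)
                           (Cmul (RtoC mu) (Csub C1 (Cmul z z))))
                     (Peval (Pderiv p) z)))
         (Cmul (Cadd (RtoC lambda) (Cmul (RtoC (mu * (l - 1))) z)) (Peval p z))
    = C0.

(* Main.v *)
(** A Stokes multiplier vanishes exactly when one column of [H] is single valued, hence given by an
    entire power series. The second column yields the equation with parameter [l] and [c0], the
    first one (after removing its exponential factor and replacing [z] by [-z]) the same equation
    with parameter [-l] and [c1]. Conversely an entire solution coincides with the corresponding
    columns of both [H_+] and [H_-]: on the half axis where the other solutions blow up, the
    difference of two solutions tending to 0 at 0 vanishes by an energy estimate.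

    For natural [l] the [l]-th derivative maps solutions of the given equation (parameter [-l]) to
    solutions of the one with parameter [l], and kills exactly the polynomials of degree [< l].
    Hence an entire solution for [-l] is a polynomial unless there is an entire solution for [l].
    Both cannot exist: integrating the latter [l] times would produce a generalized eigenvector over
    the polynomial solution, which is impossible because, after multiplication by [e^(-mu z)], the
    operator is symmetric for the definite pairing [sum_n n f_n g_n]. *)

From Stdlib Require Import Reals List Arith Factorial Lra Lia.
From Coquelicot Require Import Rcomplements Rbar Hierarchy Continuity Derive AutoDerive.
From Coquelicot Require Import RInt RInt_analysis Series PSeries.
From Coquelicot Require Complex.
Require Import Defs.
Open Scope R_scope.

(** * Formal power series *)

(** Since [mu <> 0], the point 0 is an irregular singularity: each equation has exactly one formal
    power series solution with constant term 1, and in general it diverges. Whether it is entire is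
    therefore a property of one explicit real sequence, and this is the hinge between analysis and
    algebra. With [kap = 1 / (4 omega^2)], [c0 = 0] amounts to [entire (lsol l mu kap)] and [c1 = 0]
    to [entire (lsol (- l) (- mu) kap)]; the rest is about recurrences. Single-valued columns become
    series through integrals over circles. The recurrence between their Fourier coefficients passes
    from negative to nonnegative indices only through index -1, so boundedness at 0 has to eliminate
    that single coefficient. In the converse direction the energy estimate yields uniqueness only
    near 0. This suffices, because a Stokes relation at one point together with the invertibility of
    [H] already forces the multiplier to vanish. *)

Definition entire (f : nat -> R) : Prop :=
  forall r, 0 < r -> exists K, forall n, Rabs (f n) * r ^ n <= K.

Definition Xs (f : nat -> R) (n : nat) : R :=
  match n with O => 0 | S m => f m end.
Definition Ds (f : nat -> R) (n : nat) : R := INR (S n) * f (S n).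

(** Coefficient of [z^n] in [z^2 f'' + (A z + M + B z^2) f' + (C + G z) f]; all the equations below
    belong to this family. *)
Definition heun (A M B C G : R) (f : nat -> R) (n : nat) : R :=
  Xs (Xs (Ds (Ds f))) n + A * Xs (Ds f) n + M * Ds f n
  + B * Xs (Xs (Ds f)) n + C * f n + G * Xs f n.

(** Coefficients of [e^(c z) f]. *)
Definition expmul (c : R) (f : nat -> R) (n : nat) : R :=
  sum_f_R0 (fun j => c ^ j / INR (fact j) * f (n - j)%nat) n.

Lemma heun_0 A M B C G f : heun A M B C G f 0 = M * f 1%nat + C * f 0%nat.
Proof. unfold heun, Xs, Ds. simpl. ring. Qed.

Lemma heun_S A M B C G f m :
  heun A M B C G f (S m) =
  (INR (S m) * INR m + A * INR (S m) + C) * f (S m)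
  + M * INR (S (S m)) * f (S (S m)) + (B * INR m + G) * f m.
Proof.
unfold heun, Xs, Ds. destruct m.
  simpl; ring.
rewrite !S_INR. ring.
Qed.

Lemma expmul_ext c f g : (forall n, f n = g n) -> forall n, expmul c f n = expmul c g n.
Proof. intros H n. unfold expmul. apply sum_eq. intros. rewrite H. reflexivity. Qed.

Lemma expmul_lin c a b f g n :
  expmul c (fun m => a * f m + b * g m) n = a * expmul c f n + b * expmul c g n.
Proof.
unfold expmul. rewrite !scal_sum, <- sum_plus. apply sum_eq. intros. ring.
Qed.

Lemma expmul_0 c f : expmul c f 0 = f 0%nat.
Proof. unfold expmul. simpl. field. Qed.

Lemma expmul_X c f n : expmul c (Xs f) n = Xs (expmul c f) n.
Proof.
destruct n as [|n].
  unfold expmul; simpl; ring.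
unfold expmul at 1. rewrite tech5.
replace (S n - S n)%nat with 0%nat by lia. simpl (Xs f 0). rewrite Rmult_0_r, Rplus_0_r.
change (Xs (expmul c f) (S n)) with (expmul c f n). unfold expmul. apply sum_eq. intros i Hi.
replace (S n - i)%nat with (S (n - i))%nat by lia. reflexivity.
Qed.

Lemma expmul_D c f n : Ds (expmul c f) n = expmul c (Ds f) n + c * expmul c f n.
Proof.
unfold Ds at 1, expmul at 1. rewrite scal_sum.
rewrite (sum_eq _ (fun j => c ^ j / INR (fact j) * (INR (S n - j) * f (S n - j)%nat)
   + INR j * (c ^ j / INR (fact j)) * f (S n - j)%nat)).
2:{ intros i Hi. rewrite minus_INR by lia. ring. }
rewrite sum_plus. f_equal.
- rewrite tech5. replace (S n - S n)%nat with 0%nat by lia. simpl (INR 0).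
  rewrite Rmult_0_l, Rmult_0_r, Rplus_0_r. unfold expmul, Ds. apply sum_eq. intros i Hi.
  replace (S n - i)%nat with (S (n - i))%nat by lia. reflexivity.
- rewrite decomp_sum by lia. simpl (INR 0). rewrite !Rmult_0_l, Rplus_0_l.
  unfold expmul. rewrite scal_sum. apply sum_eq. intros i Hi.
  replace (S n - S i)%nat with (n - i)%nat by lia.
  rewrite fact_simpl, mult_INR. simpl (c ^ S i). field.
  split; [apply INR_fact_neq_0 | apply not_0_INR; lia].
Qed.

(** Substituting [f = e^(-B z) g], the terms [B^2 z^2 g] coming from [z^2 f''] and from [B z^2 f']
    cancel; this is the exponent for which the family [heun] is preserved. *)
Lemma heun_expmul A M B C G f n :
  heun A M (- B) (C - B * M) (G - B * A) (expmul B f) n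
  = expmul B (heun A M B C G f) n.
Proof.
set (T := expmul B).
assert (HX : forall g m, T (Xs g) m = Xs (T g) m) by (intros; apply expmul_X).
assert (HD : forall g m, T (Ds g) m = Ds (T g) m - B * T g m)
  by (intros; unfold T; rewrite expmul_D; ring).
assert (Xe : forall g h, (forall m, g m = h m) -> forall m, Xs g m = Xs h m)
  by (intros g h H m; destruct m; simpl; auto).
assert (De : forall g h, (forall m, g m = h m) -> forall m, Ds g m = Ds h m)
  by (intros g h H m; unfold Ds; rewrite H; auto).
assert (L2 : forall a b g h m, T (fun m => a * g m + b * h m) m = a * T g m + b * T h m)
  by (intros; apply expmul_lin).
etransitivity; [| symmetry; apply (expmul_ext B _
  (fun m => 1 * (fun m => 1 * (fun m => 1 * (fun m => 1 * (fun m =>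
   1 * Xs (Xs (Ds (Ds f))) m + A * Xs (Ds f) m) m + M * Ds f m) m
  + B * Xs (Xs (Ds f)) m) m + C * f m) m + G * Xs f m)); intros; unfold heun; ring].
fold T. rewrite !L2.
rewrite !HX.
assert (E1 : forall m, T (Ds (Ds f)) m = Ds (Ds (T f)) m - 2 * B * Ds (T f) m + B * B * T f m).
{ intros m. rewrite HD, (De _ (fun m => Ds (T f) m - B * T f m)) by (intros; apply HD).
  rewrite HD. unfold Ds. ring. }
rewrite (Xe (T (Xs (Ds (Ds f)))) (Xs (T (Ds (Ds f))))) by (intros; apply HX).
rewrite (Xe (Xs (T (Ds (Ds f)))) (Xs (fun m => Ds (Ds (T f)) m - 2 * B * Ds (T f) m + B * B * T f m)))
  by (intros; apply Xe; apply E1).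
rewrite (Xe (T (Xs (Ds f))) (Xs (T (Ds f)))) by (intros; apply HX).
rewrite (Xe (Xs (T (Ds f))) (Xs (fun m => Ds (T f) m - B * T f m)))
  by (intros; apply Xe; intros; apply HD).
rewrite (Xe (T (Ds f)) (fun m => Ds (T f) m - B * T f m)) by (intros; apply HD).
rewrite HD. unfold heun.
destruct n as [|[|n]]; simpl; ring.
Qed.

(** Carrying two consecutive coefficients makes the three-term recurrence structural. *)
Fixpoint heun_pair (A M B C G : R) (n : nat) : R * R :=
  match n with
  | O => (1, - C / M)
  | S m => let (x, y) := heun_pair A M B C G m in
    (y, - ((INR (S m) * INR m + A * INR (S m) + C) * y + (B * INR m + G) * x)
        / (M * INR (S (S m))))
  end.
Definition heun_sol A M B C G n := fst (heun_pair A M B C G n).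

Lemma heun_sol_0 A M B C G : heun_sol A M B C G 0 = 1.
Proof. reflexivity. Qed.

Lemma heun_pair_snd A M B C G n :
  snd (heun_pair A M B C G n) = heun_sol A M B C G (S n).
Proof. unfold heun_sol. simpl. destruct (heun_pair A M B C G n). reflexivity. Qed.

Lemma heun_sol_eq A M B C G n : M <> 0 -> heun A M B C G (heun_sol A M B C G) n = 0.
Proof.
intros HM. destruct n as [|m].
  rewrite heun_0. unfold heun_sol; simpl. field; auto.
rewrite heun_S. rewrite <- (heun_pair_snd _ _ _ _ _ (S m)).
cbn [heun_pair].
rewrite <- (heun_pair_snd _ _ _ _ _ m). unfold heun_sol.
destruct (heun_pair A M B C G m) as [x y]. cbn [fst snd]. field.
split; [apply not_0_INR; lia | auto].
Qed.

(** The highest coefficient occurring in row [n] is multiplied by [M (n + 1)], which never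
    vanishes. *)
Lemma heun_unique A M B C G f : M <> 0 -> (forall n, heun A M B C G f n = 0) ->
  forall n, f n = f 0%nat * heun_sol A M B C G n.
Proof.
intros HM Hf.
set (s := heun_sol A M B C G).
assert (Hs : forall n, heun A M B C G s n = 0) by (intros; apply heun_sol_eq; auto).
assert (H : forall n, f n = f 0%nat * s n /\ f (S n) = f 0%nat * s (S n)).
{ induction n as [|n [IH1 IH2]].
  - split. unfold s; rewrite heun_sol_0; ring.
    apply Rmult_eq_reg_l with M; auto.
    generalize (Hf 0%nat) (Hs 0%nat). rewrite !heun_0.
    replace (s 0%nat) with 1 by reflexivity. intros E1 E2.
    replace (M * (f 0%nat * s 1%nat)) with (f 0%nat * (M * s 1%nat)) by ring.
    replace (M * s 1%nat) with (- C) by lra. lra.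
  - split; auto.
    assert (Hn : M * INR (S (S n)) <> 0)
      by (apply Rmult_integral_contrapositive; split; auto; apply not_0_INR; lia).
    apply Rmult_eq_reg_l with (M * INR (S (S n))); auto.
    generalize (Hf (S n)) (Hs (S n)). rewrite !heun_S. intros E1 E2.
    rewrite IH1, IH2 in E1.
    match type of E2 with ?a + ?b + ?c = 0 => assert (E3 : b = - a - c) by lra end.
    match type of E1 with ?a + ?b + ?c = 0 => assert (E4 : b = - a - c) by lra end.
    rewrite E4.
    replace (M * INR (S (S n)) * (f 0%nat * s (S (S n)))) with
      (f 0%nat * (M * INR (S (S n)) * s (S (S n)))) by ring. rewrite E3. ring. }
intros n. apply H.
Qed.

Lemma entire_D f : entire f -> entire (Ds f).
Proof.
intros Hf r Hr. destruct (Hf (2 * r)) as [K HK]. lra.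
exists (K / r). intros n. apply Rmult_le_reg_r with r; auto.
unfold Rdiv. rewrite (Rmult_assoc K), Rinv_l, Rmult_1_r by lra.
apply Rle_trans with (2 := HK (S n)). unfold Ds.
rewrite Rabs_mult, (Rabs_right (INR _)) by (apply Rle_ge, pos_INR).
rewrite Rpow_mult_distr.
(* Doubling the radius pays for the factor [n + 1] of the derivative. *)
assert (H2 : INR (S n) <= 2 ^ S n).
{ clear. induction n as [|n IH]. simpl; lra. rewrite S_INR.
  change (2 ^ S (S n)) with (2 * 2 ^ S n).
  assert (1 <= INR (S n)) by (rewrite S_INR; generalize (pos_INR n); lra). lra. }
replace (INR (S n) * Rabs (f (S n)) * r ^ n * r) with (INR (S n) * (Rabs (f (S n)) * r ^ S n))
  by (simpl; ring).
replace (Rabs (f (S n)) * (2 ^ S n * r ^ S n)) with (2 ^ S n * (Rabs (f (S n)) * r ^ S n)) by ring.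
apply Rmult_le_compat_r; auto.
apply Rmult_le_pos. apply Rabs_pos. apply pow_le; lra.
Qed.

Lemma exp_partial_sum x n : 0 <= x -> sum_f_R0 (fun j => x ^ j / INR (fact j)) n <= exp x.
Proof.
intros Hx. unfold exp. destruct (exist_exp x) as [y Hy]. simpl.
unfold exp_in, infinite_sum in Hy.
apply Rnot_lt_le. intros Hlt.
destruct (Hy (sum_f_R0 (fun j => x ^ j / INR (fact j)) n - y)) as [N HN]. lra.
assert (Hg : Un_growing (sum_f_R0 (fun j => x ^ j / INR (fact j)))).
{ intros m. rewrite tech5. 
  assert (0 <= x ^ S m / INR (fact (S m))).
  apply Rmult_le_pos. apply pow_le; auto. left. apply Rinv_0_lt_compat, INR_fact_lt_0. lra. }
specialize (HN (N + n)%nat ltac:(lia)).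
assert (sum_f_R0 (fun j => x ^ j / INR (fact j)) n <= sum_f_R0 (fun j => x ^ j / INR (fact j)) (N + n)).
{ apply Rge_le, growing_prop; auto. lia. }
unfold R_dist, Rdist in HN.
rewrite (sum_eq _ (fun j => x ^ j / INR (fact j))) in HN
  by (intros; unfold Rdiv; ring).
apply Rabs_def2 in HN. lra.
Qed.

Lemma entire_expmul c f : entire f -> entire (expmul c f).
Proof.
intros Hf r Hr. destruct (Hf r Hr) as [K HK].
assert (HK0 : 0 <= K).
{ apply Rle_trans with (2 := HK 0%nat). simpl. rewrite Rmult_1_r. apply Rabs_pos. }
exists (K * exp (Rabs c * r)). intros n.
apply Rle_trans with (K * sum_f_R0 (fun j => (Rabs c * r) ^ j / INR (fact j)) n).
2:{ apply Rmult_le_compat_l; auto. apply exp_partial_sum.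
    apply Rmult_le_pos. apply Rabs_pos. lra. }
unfold expmul.
apply Rle_trans with (sum_f_R0 (fun j => Rabs (c ^ j / INR (fact j) * f (n - j)%nat)) n * r ^ n).
  apply Rmult_le_compat_r. apply pow_le; lra. apply Rsum_abs.
rewrite Rmult_comm, !scal_sum. apply sum_Rle. intros j Hj.
rewrite Rabs_mult. unfold Rdiv. rewrite Rabs_mult, <- RPow_abs.
rewrite (Rabs_right (/ _)).
2:{ left. apply Rinv_0_lt_compat, INR_fact_lt_0. }
replace (r ^ n) with (r ^ (n - j) * r ^ j) by (rewrite <- pow_add; f_equal; lia).
rewrite Rpow_mult_distr.
replace (Rabs c ^ j * / INR (fact j) * Rabs (f (n - j)%nat) * (r ^ (n - j) * r ^ j)) with
  ((Rabs c ^ j * r ^ j * / INR (fact j)) * (Rabs (f (n - j)%nat) * r ^ (n - j))) by ring.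
apply Rmult_le_compat_l; auto.
apply Rmult_le_pos. apply Rmult_le_pos; apply pow_le. apply Rabs_pos. lra.
left. apply Rinv_0_lt_compat, INR_fact_lt_0.
Qed.

Lemma entire_ext f g : (forall n, f n = g n) -> entire f -> entire g.
Proof.
intros H Hf r Hr. destruct (Hf r Hr) as [K HK]. exists K. intros n. rewrite <- H. auto.
Qed.

Lemma entire_le f g : (forall n, Rabs (g n) <= Rabs (f n)) -> entire f -> entire g.
Proof.
intros H Hf r Hr. destruct (Hf r Hr) as [K HK]. exists K. intros n.
apply Rle_trans with (2 := HK n). apply Rmult_le_compat_r; auto. apply pow_le; lra.
Qed.

Lemma entire_scal c f : entire f -> entire (fun n => c * f n).
Proof.
intros Hf r Hr. destruct (Hf r Hr) as [K HK]. exists (Rabs c * K). intros n.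
rewrite Rabs_mult, Rmult_assoc. apply Rmult_le_compat_l; auto. apply Rabs_pos.
Qed.

Lemma entire_plus f g : entire f -> entire g -> entire (fun n => f n + g n).
Proof.
intros Hf Hg r Hr. destruct (Hf r Hr) as [K HK]. destruct (Hg r Hr) as [K' HK'].
exists (K + K'). intros n.
apply Rle_trans with ((Rabs (f n) + Rabs (g n)) * r ^ n).
apply Rmult_le_compat_r. apply pow_le; lra. apply Rabs_triang.
rewrite Rmult_plus_distr_r. apply Rplus_le_compat; auto.
Qed.

Lemma entire_finite f N : (forall n, (N <= n)%nat -> f n = 0) -> entire f.
Proof.
intros H r Hr.
exists (sum_f_R0 (fun n => Rabs (f n) * r ^ n) N). intros n.
assert (Hp : forall n, 0 <= Rabs (f n) * r ^ n).
{ intros. apply Rmult_le_pos. apply Rabs_pos. apply pow_le; lra. }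
destruct (le_lt_dec N n) as [Hn|Hn].
  rewrite H by auto. rewrite Rabs_R0, Rmult_0_l. apply cond_pos_sum; auto.
clear H. induction N as [|N IH]. lia.
rewrite tech5. specialize (Hp (S N)) as HpS.
destruct (Nat.eq_dec n N) as [->|Hne].
  apply Rle_trans with (sum_f_R0 (fun n => Rabs (f n) * r ^ n) N). 2: lra.
  destruct N. simpl; lra. rewrite tech5.
  assert (0 <= sum_f_R0 (fun n => Rabs (f n) * r ^ n) N) by (apply cond_pos_sum; auto). lra.
assert (Rabs (f n) * r ^ n <= sum_f_R0 (fun n => Rabs (f n) * r ^ n) N) by (apply IH; lia). lra.
Qed.

(** Eliminating [u] from [z v' = k u], [z u' = -(L + M (z + 1/z)) u + k v] with [k^2 = - kap] gives
    [z^2 v'' + ((L + 1) z + M (1 + z^2)) v' + kap v = 0]; this is its normalized formal solution.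
    Both columns of [H] lead to it, with [(L, M)] equal to [(l, mu)] and to [(- l, - mu)]. *)
Definition lsol (L M kap : R) : nat -> R := heun_sol (L + 1) M M kap 0.

(** Formal solution of the given equation, [kap] standing for [lambda + mu^2]. *)
Definition esol (l mu kap : R) : nat -> R :=
  heun_sol (1 - l) mu (- mu) (kap - mu ^ 2) (mu * (l - 1)).

Lemma heun_coef_ext A M B C G A' M' B' C' G' f g n :
  A = A' -> M = M' -> B = B' -> C = C' -> G = G' -> (forall n, f n = g n) ->
  heun A M B C G f n = heun A' M' B' C' G' g n.
Proof.
intros. subst. destruct n. rewrite !heun_0, !H4; auto. rewrite !heun_S, !H4; auto.
Qed.

Lemma lsol_eq L M kap n : M <> 0 -> heun (L + 1) M M kap 0 (lsol L M kap) n = 0.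
Proof. apply heun_sol_eq. Qed.

(** The substitution of [- z] for [z]. *)
Lemma lsol_opp L M kap n : M <> 0 -> lsol L (- M) kap n = (-1) ^ n * lsol L M kap n.
Proof.
intros HM. symmetry. 
rewrite (heun_unique (L + 1) (- M) (- M) kap 0 (fun n => (-1) ^ n * lsol L M kap n)).
- unfold lsol. rewrite heun_sol_0. simpl. ring.
- lra.
- intros m. generalize (lsol_eq L M kap m HM). destruct m.
  rewrite !heun_0. simpl. lra.
  rewrite !heun_S. intros E. 
  match type of E with ?X = _ => transitivity ((-1) ^ S m * X) end; [cbn [pow]; ring | rewrite E; ring].
Qed.

Lemma entire_lsol_opp L M kap : M <> 0 -> entire (lsol L (- M) kap) <-> entire (lsol L M kap).
Proof.
intros HM.
assert (H : forall n, Rabs (lsol L (- M) kap n) = Rabs (lsol L M kap n)).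
{ intros n. rewrite lsol_opp by auto. rewrite Rabs_mult, pow_1_abs. ring. }
split; apply entire_le; intros n; rewrite H; apply Rle_refl.
Qed.

(** Normal form after multiplication by [e^(M z)]; for [L = - l] and [M = mu] it is the given
    equation. *)
Lemma expmul_lsol L M kap n : M <> 0 ->
  heun (L + 1) M (- M) (kap - M ^ 2) (- M * (L + 1)) (expmul M (lsol L M kap)) n = 0.
Proof.
intros HM.
rewrite (heun_coef_ext _ _ _ _ _ (L + 1) M (- M) (kap - M * M) (0 - M * (L + 1)) _
  (expmul M (lsol L M kap))) by (auto; ring).
rewrite heun_expmul, (expmul_ext _ _ (fun _ => 0)) by (intros; apply lsol_eq; auto).
unfold expmul. rewrite (sum_eq _ (fun _ => 0)) by (intros; ring).
rewrite sum_cte. ring.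
Qed.

Lemma expmul_heun_v L M kap f n :
  heun (L + 1) M M kap 0 (expmul (- M) f) n
  = expmul (- M) (heun (L + 1) M (- M) (kap - M ^ 2) (- M * (L + 1)) f) n.
Proof.
rewrite <- heun_expmul. apply heun_coef_ext; auto; ring.
Qed.

Lemma expmul_lsol_inv L M kap f n : M <> 0 ->
  (forall n, heun (L + 1) M (- M) (kap - M ^ 2) (- M * (L + 1)) f n = 0) ->
  expmul (- M) f n = f 0%nat * lsol L M kap n.
Proof.
intros HM Hf. unfold lsol.
rewrite <- (expmul_0 (- M) f) at 1.
apply heun_unique; auto. intros m. rewrite expmul_heun_v, (expmul_ext _ _ (fun _ => 0)) by auto.
unfold expmul. rewrite (sum_eq _ (fun _ => 0)) by (intros; ring).
rewrite sum_cte. ring.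
Qed.

Lemma esol_eq l mu kap n : mu <> 0 ->
  heun (- l + 1) mu (- mu) (kap - mu ^ 2) (- mu * (- l + 1)) (esol l mu kap) n = 0.
Proof.
intros Hmu.
rewrite <- (heun_sol_eq (1 - l) mu (- mu) (kap - mu ^ 2) (mu * (l - 1)) n Hmu).
apply heun_coef_ext; auto; ring.
Qed.

Lemma esol_lsol l mu kap n : mu <> 0 ->
  expmul (- mu) (esol l mu kap) n = lsol (- l) mu kap n.
Proof.
intros Hmu. rewrite (expmul_lsol_inv (- l) mu kap); auto.
unfold esol; rewrite heun_sol_0; ring.
intros; apply esol_eq; auto.
Qed.

Lemma lsol_esol l mu kap n : mu <> 0 ->
  expmul mu (lsol (- l) mu kap) n = esol l mu kap n.
Proof.
intros Hmu. unfold esol.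
rewrite (heun_unique (1 - l) mu (- mu) (kap - mu ^ 2) (mu * (l - 1))
   (expmul mu (lsol (- l) mu kap))); auto.
rewrite expmul_0. unfold lsol; rewrite heun_sol_0. ring.
intros m. rewrite <- (expmul_lsol (- l) mu kap m Hmu). apply heun_coef_ext; auto; ring.
Qed.

(** On the left the sequence attached to the first column of [H], on the right the given equation.
    They differ by a reflection and a factor [e^(mu z)], neither of which affects convergence
    everywhere. *)
Lemma entire_esol l mu kap : mu <> 0 ->
  entire (lsol (- l) (- mu) kap) <-> entire (esol l mu kap).
Proof.
intros Hmu. rewrite entire_lsol_opp by auto. split; intros H.
apply entire_ext with (expmul mu (lsol (- l) mu kap)).
intros; apply lsol_esol; auto. apply entire_expmul; auto.
apply entire_ext with (expmul (- mu) (esol l mu kap)).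
intros; apply esol_lsol; auto. apply entire_expmul; auto.
Qed.

(** * The intertwining [l]-th derivative and the exclusion of two entire solutions *)

Fixpoint Diter (j : nat) (f : nat -> R) : nat -> R :=
  match j with O => f | S j => Ds (Diter j f) end.

Lemma Diter_val j f n : INR (fact n) * Diter j f n = INR (fact (n + j)) * f (n + j)%nat.
Proof.
revert n. induction j as [|j IH]; intros n; simpl Diter.
  rewrite Nat.add_0_r; auto.
unfold Ds. replace (n + S j)%nat with (S n + j)%nat by lia. rewrite <- IH.
rewrite fact_simpl, mult_INR. ring.
Qed.

Lemma entire_Diter j f : entire f -> entire (Diter j f).
Proof. intros H. induction j; simpl; auto. apply entire_D; auto. Qed.

(** In the Leibniz rule [l (l - 1) + l (1 - l)] cancels in front of the [l]-th derivative, and so do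
    the two terms with the derivative of order [l - 1], which carry the factors [- mu l (l - 1)] and
    [mu (l - 1) l]. *)
Lemma heun_Diter l mu lam f n :
  INR (fact n) * heun (INR l + 1) mu (- mu) lam (- mu * (INR l + 1)) (Diter l f) n
  = INR (fact (n + l)) * heun (- INR l + 1) mu (- mu) lam (- mu * (- INR l + 1)) f (n + l).
Proof.
assert (V := Diter_val l f).
assert (V2 : forall n, Diter l f n = INR (fact (n + l)) / INR (fact n) * f (n + l)%nat).
{ intros m. apply Rmult_eq_reg_l with (INR (fact m)). 2: apply INR_fact_neq_0.
  rewrite V. field. apply INR_fact_neq_0. }
destruct n as [|m].
- destruct l as [|l].
  + simpl (0 + 0)%nat. simpl Diter. simpl (fact 0). f_equal. apply heun_coef_ext; auto; simpl; ring.
  + simpl (0 + S l)%nat. rewrite heun_0, heun_S, !V2.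
    change (1 + S l)%nat with (S (S l)). change (0 + S l)%nat with (S l).
    rewrite (fact_simpl (S l)), mult_INR.
    simpl (fact 0). simpl (fact 1). rewrite !S_INR. simpl (INR 0). simpl (INR 1). field.
- change (S m + l)%nat with (S (m + l)).
  rewrite heun_S. rewrite heun_S, !V2.
  change (S (S m) + l)%nat with (S (S (m + l))). change (S m + l)%nat with (S (m + l)).
  rewrite (fact_simpl (S (m + l))), (fact_simpl (S m)), (fact_simpl m), (fact_simpl (m + l)).
  rewrite !mult_INR, !S_INR, !plus_INR.
  assert (0 <= INR m) by apply pos_INR.
  field. repeat split; try apply INR_fact_neq_0; try lra.
Qed.

Lemma esol_polynomial (l : nat) mu kap : mu <> 0 ->
  entire (lsol (- INR l) (- mu) kap) -> ~ entire (lsol (INR l) mu kap) ->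
  forall n, (l <= n)%nat -> esol (INR l) mu kap n = 0.
Proof.
intros Hmu He Hne.
set (e := esol (INR l) mu kap). set (Y := Diter l e).
assert (HY : forall n, heun (INR l + 1) mu (- mu) (kap - mu ^ 2) (- mu * (INR l + 1)) Y n = 0).
{ intros n. apply Rmult_eq_reg_l with (INR (fact n)). 2: apply INR_fact_neq_0.
  unfold Y; rewrite heun_Diter. unfold e; rewrite esol_eq by auto. ring. }
assert (HYe : entire Y).
{ apply entire_Diter. apply entire_esol; auto. }
(* Otherwise a multiple of [e^(-mu z) Y] would be the excluded entire solution. *)
assert (HY0 : Y 0%nat = 0).
{ destruct (Req_dec (Y 0%nat) 0) as [H|H]; auto. exfalso. apply Hne.
  apply entire_ext with (fun n => / Y 0%nat * expmul (- mu) Y n).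
  intros n. rewrite (expmul_lsol_inv (INR l) mu kap) by auto. field; auto.
  apply entire_scal, entire_expmul; auto. }
intros n Hn.
assert (HYn : Y (n - l)%nat = 0).
{ rewrite (heun_unique _ _ _ _ _ Y Hmu HY), HY0. ring. }
generalize (Diter_val l e (n - l)). fold Y. rewrite HYn.
replace (n - l + l)%nat with n by lia. intros E.
apply Rmult_eq_reg_l with (INR (fact n)). lra. apply INR_fact_neq_0.
Qed.

(* The operator is formally symmetric for the pairing [sum_n n f_n g_n], which is definite. *)
Lemma lsol_no_generalized_eigenvector L M kap s g :
  M <> 0 -> kap <> 0 -> s <> 0 -> entire (lsol L M kap) -> entire g ->
  (forall n, heun (L + 1) M M kap 0 g n = s * lsol L M kap n) -> False.
Proof.
intros HM Hk Hs Hh Hg E.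
set (h := lsol L M kap) in *.
assert (Eh : forall n, heun (L + 1) M M kap 0 h n = 0) by (intros; apply lsol_eq; auto).
(* Discrete Wronskian of [g] and [h]. Row [n] of the operator, multiplied by the weight [n], belongs
   to a Jacobi matrix with off-diagonal entries [M n (n + 1)]; summation by parts telescopes and
   leaves only the contribution of [s h]. *)
set (tau := fun n => INR n * g n * (INR (S n) * h (S n)) - INR n * h n * (INR (S n) * g (S n))).
assert (T : forall N, M * tau N = - s * sum_f_R0 (fun n => INR n * (h n * h n)) N).
{ induction N as [|N IH].
  - unfold tau; simpl; ring.
  - rewrite tech5, Rmult_plus_distr_l, <- IH. unfold tau.
    generalize (E (S N)) (Eh (S N)). rewrite !heun_S. intros E1 E2.
    rewrite !S_INR in *.
    set (a := h N) in *. set (b := h (S N)) in *. set (c := h (S (S N))) in *.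
    set (a' := g N) in *. set (b' := g (S N)) in *. set (c' := g (S (S N))) in *.
    assert (F1 : M * (INR N + 1 + 1) * c' = s * b - ((INR N + 1) * INR N + (L + 1) * (INR N + 1) + kap) * b' - (M * INR N + 0) * a') by lra.
    assert (F2 : M * (INR N + 1 + 1) * c = - ((INR N + 1) * INR N + (L + 1) * (INR N + 1) + kap) * b - (M * INR N + 0) * a) by lra.
    replace (M * ((INR N + 1) * b' * ((INR N + 1 + 1) * c) - (INR N + 1) * b * ((INR N + 1 + 1) * c')))
      with ((INR N + 1) * b' * (M * (INR N + 1 + 1) * c) - (INR N + 1) * b * (M * (INR N + 1 + 1) * c')) by ring.
    rewrite F1, F2. ring. }
(* The weight kills index 0, so definiteness needs another nonzero coefficient; [h 1 = - kap / M]
   supplies it. *)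
assert (H1 : h 1%nat <> 0).
{ generalize (Eh 0%nat). rewrite heun_0. replace (h 0%nat) with 1 by reflexivity.
  intros E0 F. rewrite F in E0. lra. }
destruct (entire_D g Hg 2) as [K HK]. lra.
destruct (entire_D h Hh 2) as [K' HK']. lra.
assert (HK0 : 0 <= K).
{ apply Rle_trans with (2 := HK 0%nat). simpl pow. rewrite Rmult_1_r. apply Rabs_pos. }
assert (HK0' : 0 <= K').
{ apply Rle_trans with (2 := HK' 0%nat). simpl pow. rewrite Rmult_1_r. apply Rabs_pos. }
assert (Pw : forall n, INR n <= 2 ^ n /\ 1 <= 2 ^ n).
{ induction n as [|n [I1 I2]]. simpl; lra. rewrite S_INR. simpl. lra. }
(* Entireness makes [tau] decay like [2^(-N)], whereas the weighted sum stays above [h 1 ^ 2]. *)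
assert (Bt : forall N, Rabs (tau (S N)) * 2 ^ N <= 2 * (K * K')).
{ intros N.
  assert (Ba : forall a b, Rabs a * 2 ^ N <= K -> Rabs b * 2 ^ S N <= K' -> Rabs (a * b) * 2 ^ N <= K * K').
  { intros a b Ha Hb. rewrite Rabs_mult.
    replace (Rabs a * Rabs b * 2 ^ N) with ((Rabs a * 2 ^ N) * Rabs b) by ring.
    apply Rmult_le_compat; auto. apply Rmult_le_pos. apply Rabs_pos. generalize (Pw N); lra.
    apply Rabs_pos. apply Rle_trans with (2 := Hb).
    rewrite <- (Rmult_1_r (Rabs b)) at 1. apply Rmult_le_compat_l. apply Rabs_pos. apply Pw. }
  assert (Bb : forall a b, Rabs a * 2 ^ N <= K' -> Rabs b * 2 ^ S N <= K -> Rabs (a * b) * 2 ^ N <= K * K').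
  { intros a b Ha Hb. rewrite Rabs_mult, (Rmult_comm K).
    replace (Rabs a * Rabs b * 2 ^ N) with ((Rabs a * 2 ^ N) * Rabs b) by ring.
    apply Rmult_le_compat; auto. apply Rmult_le_pos. apply Rabs_pos. generalize (Pw N); lra.
    apply Rabs_pos. apply Rle_trans with (2 := Hb).
    rewrite <- (Rmult_1_r (Rabs b)) at 1. apply Rmult_le_compat_l. apply Rabs_pos. apply Pw. }
  generalize (Ba _ _ (HK N) (HK' (S N))) (Bb _ _ (HK' N) (HK (S N))).
  change (tau (S N)) with (Ds g N * Ds h (S N) - Ds h N * Ds g (S N)).
  intros I1 I2.
  apply Rle_trans with ((Rabs (Ds g N * Ds h (S N)) + Rabs (Ds h N * Ds g (S N))) * 2 ^ N).
  apply Rmult_le_compat_r. generalize (Pw N); lra.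
  unfold Rminus. rewrite <- (Rabs_Ropp (Ds h N * Ds g (S N))). apply Rabs_triang.
  lra. }
set (S1 := fun N => sum_f_R0 (fun n => INR n * (h n * h n)) N) in *.
assert (Sp : forall N, h 1%nat * h 1%nat <= S1 (S N)).
{ induction N as [|N IH]. unfold S1; simpl. lra.
  unfold S1 in *. rewrite tech5.
  assert (0 <= INR (S (S N)) * (h (S (S N)) * h (S (S N)))).
  { apply Rmult_le_pos. apply pos_INR. apply Rle_0_sqr. } lra. }
assert (Hp : 0 < Rabs s * (h 1%nat * h 1%nat)).
{ apply Rmult_lt_0_compat. apply Rabs_pos_lt; auto.
  assert (H := Rsqr_pos_lt _ H1). exact H. }
destruct (INR_unbounded (Rabs M * (2 * (K * K')) / (Rabs s * (h 1%nat * h 1%nat)))) as [N HN].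
assert (Hf : Rabs s * (h 1%nat * h 1%nat) * 2 ^ N <= Rabs M * (2 * (K * K'))).
{ apply Rle_trans with (Rabs M * (Rabs (tau (S N)) * 2 ^ N)).
  2: apply Rmult_le_compat_l; auto; apply Rabs_pos.
  rewrite <- (Rmult_assoc (Rabs M)). apply Rmult_le_compat_r. generalize (Pw N); lra.
  rewrite <- Rabs_mult, T, Rabs_mult, Rabs_Ropp.
  apply Rmult_le_compat_l. apply Rabs_pos.
  apply Rle_trans with (2 := Rle_abs _). apply Sp. }
apply Rmult_lt_compat_r with (r := Rabs s * (h 1%nat * h 1%nat)) in HN; auto.
unfold Rdiv in HN. rewrite Rmult_assoc, Rinv_l, Rmult_1_r in HN by lra.
generalize (Pw N). intros [P1 _].
apply Rmult_le_compat_r with (r := Rabs s * (h 1%nat * h 1%nat)) in P1; lra.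
Qed.

Fixpoint inhom_pair (A M B C G : R) (b : nat -> R) (n : nat) : R * R :=
  match n with
  | O => (0, b 0%nat / M)
  | S m => let (x, y) := inhom_pair A M B C G b m in
    (y, (b (S m) - (INR (S m) * INR m + A * INR (S m) + C) * y - (B * INR m + G) * x)
        / (M * INR (S (S m))))
  end.

Lemma inhom_exists A M B C G b : M <> 0 ->
  exists f, forall n, heun A M B C G f n = b n.
Proof.
intros HM. set (f := fun n => fst (inhom_pair A M B C G b n)).
assert (Hs : forall n, snd (inhom_pair A M B C G b n) = f (S n)).
{ intros n. unfold f. simpl. destruct (inhom_pair A M B C G b n). reflexivity. }
exists f. intros [|m].
- rewrite heun_0. unfold f. simpl. field; auto.
- rewrite heun_S, <- (Hs (S m)). cbn [inhom_pair]. rewrite <- (Hs m). unfold f.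
  destruct (inhom_pair A M B C G b m) as [x y]. cbn [fst snd]. field.
  split; [apply not_0_INR; lia | auto].
Qed.

(** The last hypothesis keeps the coefficient of [f (n - 1)] because it may vanish. For the given
    equation this happens in row [l] and decouples the indices from [l] on from those below. *)
Lemma heun_ext A M B C G f g n :
  f n = g n -> f (S n) = g (S n) -> (n = 0%nat \/ (B * (INR n - 1) + G) * f (n - 1)%nat = (B * (INR n - 1) + G) * g (n - 1)%nat) ->
  heun A M B C G f n = heun A M B C G g n.
Proof.
intros H1 H2 H3. destruct n as [|n].
  rewrite !heun_0, H1, H2; auto.
destruct H3 as [H3|H3]; [lia|].
replace (S n - 1)%nat with n in H3 by lia. rewrite S_INR in H3.
rewrite !heun_S, H1, H2.
replace (INR n + 1 - 1) with (INR n) in H3 by ring. rewrite H3. reflexivity.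
Qed.

Lemma heun_scal A M B C G a f n :
  heun A M B C G (fun n => a * f n) n = a * heun A M B C G f n.
Proof. destruct n. rewrite !heun_0; ring. rewrite !heun_S; ring. Qed.

Lemma entire_shift l f g : entire f -> (forall n, Rabs (g (n + l)%nat) <= Rabs (f n)) -> entire g.
Proof.
intros Hf H.
apply entire_ext with (fun n => (if le_lt_dec l n then 0 else g n) + (if le_lt_dec l n then g n else 0)).
{ intros n. destruct (le_lt_dec l n); ring. }
apply entire_plus.
  apply entire_finite with l. intros n Hn. destruct (le_lt_dec l n); auto. lia.
intros r Hr. destruct (Hf r Hr) as [K HK].
assert (HK0 : 0 <= K).
{ apply Rle_trans with (2 := HK 0%nat). simpl. rewrite Rmult_1_r. apply Rabs_pos. }
exists (K * r ^ l). intros n.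
destruct (le_lt_dec l n) as [Hn|Hn].
2:{ rewrite Rabs_R0, Rmult_0_l. apply Rmult_le_pos; auto. apply pow_le; lra. }
replace n with ((n - l) + l)%nat by lia. rewrite pow_add, <- Rmult_assoc.
apply Rmult_le_compat_r. apply pow_le; lra.
apply Rle_trans with (2 := HK (n - l)%nat).
apply Rmult_le_compat_r. apply pow_le; lra. apply H.
Qed.

(* If the equation with parameter [l] also had an entire solution, integrating it [l] times and
   correcting by a polynomial would give a generalized eigenvector over the polynomial solution. *)
Lemma esol_polynomial_not_entire (l : nat) mu kap : mu <> 0 -> kap <> 0 ->
  (forall n, (l <= n)%nat -> esol (INR l) mu kap n = 0) ->
  ~ entire (lsol (INR l) mu kap).
Proof.
intros Hmu Hk Hfin Hent.
set (e := esol (INR l) mu kap) in *.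
set (Y := expmul mu (lsol (INR l) mu kap)).
assert (HY : forall n, heun (INR l + 1) mu (- mu) (kap - mu ^ 2) (- mu * (INR l + 1)) Y n = 0).
{ intros n. apply expmul_lsol; auto. }
assert (HYe : entire Y) by (apply entire_expmul; auto).
(* The [l]-fold antiderivative of [Y] that vanishes to order [l] at 0; it solves the given equation
   up to a polynomial of degree less than [l]. *)
set (y1 := fun n => if le_lt_dec l n then INR (fact (n - l)) / INR (fact n) * Y (n - l)%nat else 0).
assert (Hy1 : forall n, y1 (n + l)%nat = INR (fact n) / INR (fact (n + l)) * Y n).
{ intros n. unfold y1. destruct (le_lt_dec l (n + l)); [|lia].
  replace (n + l - l)%nat with n by lia. reflexivity. }
set (Op := heun (- INR l + 1) mu (- mu) (kap - mu ^ 2) (- mu * (- INR l + 1))).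
assert (HD : forall n, Diter l y1 n = Y n).
{ intros n. apply Rmult_eq_reg_l with (INR (fact n)). 2: apply INR_fact_neq_0.
  rewrite Diter_val, Hy1. field. apply INR_fact_neq_0. }
assert (Hy1k : forall k, (l <= k)%nat -> Op y1 k = 0).
{ intros k Hkl. replace k with ((k - l) + l)%nat by lia.
  apply Rmult_eq_reg_l with (INR (fact (k - l + l))). 2: apply INR_fact_neq_0.
  unfold Op. rewrite <- heun_Diter.
  rewrite (heun_coef_ext _ _ _ _ _ (INR l + 1) mu (- mu) (kap - mu ^ 2) (- mu * (INR l + 1)) _ Y) by auto.
  rewrite HY. ring. }
(* A formal solution of [Op p = e], possibly divergent; only its coefficients up to index [l]
   enter. *)
destruct (inhom_exists (- INR l + 1) mu (- mu) (kap - mu ^ 2) (- mu * (- INR l + 1)) e Hmu) as [p Hp].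
fold Op in Hp.
assert (Hs : y1 l <> 0).
{ rewrite <- (Nat.add_0_l l), Hy1. unfold Y. rewrite expmul_0. unfold lsol. rewrite heun_sol_0.
  assert (H := INR_fact_neq_0 (0 + l)). simpl (INR (fact 0)).
  unfold Rdiv. rewrite Rmult_1_l, Rmult_1_r. apply Rinv_neq_0_compat; auto. }
(* The factors make both halves agree at index [l]: rows below [l] see only [y1 l * p], rows from
   [l] on effectively only [p l * y1]. *)
set (y := fun n => if le_lt_dec l n then p l * y1 n else y1 l * p n).
assert (Hye : entire y).
{ apply entire_shift with l (fun n => p l * Y n). apply entire_scal; auto.
  intros n. unfold y. destruct (le_lt_dec l (n + l)); [|lia].
  rewrite Hy1, !Rabs_mult. apply Rmult_le_compat_l. apply Rabs_pos.
  rewrite <- (Rmult_1_l (Rabs (Y n))) at 2. apply Rmult_le_compat_r. apply Rabs_pos.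
  assert (F := INR_fact_lt_0 n). assert (F' := INR_fact_lt_0 (n + l)).
  rewrite Rabs_right. 2: apply Rle_ge, Rlt_le, Rdiv_lt_0_compat; auto.
  apply Rmult_le_reg_r with (INR (fact (n + l))); auto.
  unfold Rdiv. rewrite Rmult_assoc, Rinv_l, Rmult_1_r, Rmult_1_l by lra.
  apply le_INR, fact_le. lia. }
assert (Hy : forall n, Op y n = y1 l * e n).
{ intros n. destruct (le_lt_dec l n) as [Hn|Hn].
  - rewrite Hfin by auto. rewrite Rmult_0_r.
    rewrite <- (Rmult_0_r (p l)), <- (Hy1k n Hn). unfold Op. rewrite <- heun_scal.
    apply heun_ext.
    + unfold y. destruct (le_lt_dec l n); [auto|lia].
    + unfold y. destruct (le_lt_dec l (S n)); [auto|lia].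
    + destruct n as [|n]; [auto|right].
      replace (S n - 1)%nat with n by lia.
      destruct (le_lt_dec l n) as [Hn'|Hn'].
        unfold y. destruct (le_lt_dec l n); [auto|lia].
      (* Row [l] is the only one that reaches back across the cut, and its coefficient there is
         zero. *)
      assert (El : INR l = INR (S n)) by (f_equal; lia).
      replace (- mu * (INR (S n) - 1) + - mu * (- INR l + 1)) with 0 by (rewrite El; ring). ring.
  - rewrite <- Hp. unfold Op. rewrite <- heun_scal.
    assert (Hyle : forall m, (m <= l)%nat -> y m = y1 l * p m).
    { intros m Hm. unfold y. destruct (le_lt_dec l m); auto.
      replace m with l by lia. ring. }
    apply heun_ext. apply Hyle; lia. apply Hyle; lia.
    destruct n; [auto|right]. rewrite Hyle by lia. auto. }
apply (lsol_no_generalized_eigenvector (- INR l) mu kap (y1 l) (expmul (- mu) y)); auto.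
- apply entire_ext with (expmul (- mu) e). intros; apply esol_lsol; auto.
  apply entire_expmul. apply entire_finite with l; auto.
- apply entire_expmul; auto.
- intros n. rewrite expmul_heun_v. fold Op.
  rewrite (expmul_ext _ _ (fun n => y1 l * e n + 0 * e n)) by (intros; rewrite Hy; ring).
  rewrite expmul_lin. unfold e. rewrite esol_lsol by auto. ring.
Qed.

(** * Polynomial solutions in terms of coefficients *)

Fixpoint padd (p q : list Cplx) : list Cplx :=
  match p, q with
  | nil, _ => q
  | _, nil => p
  | a :: p', b :: q' => Cadd a b :: padd p' q'
  end.
Definition pscal (x : R) (p : list Cplx) : list Cplx := map (Cmul (RtoC x)) p.

Lemma Cplx_ext (z w : Cplx) : fst z = fst w -> snd z = snd w -> z = w.
Proof. destruct z, w; simpl; intros; subst; auto. Qed.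

Ltac Cring := apply Cplx_ext; simpl; ring.

Lemma Peval_padd p q z : Peval (padd p q) z = Cadd (Peval p z) (Peval q z).
Proof.
revert q. induction p as [|a p IH]; intros [|b q]; simpl padd; simpl Peval; try Cring.
rewrite IH. Cring.
Qed.

Lemma Peval_pscal x p z : Peval (pscal x p) z = Cmul (RtoC x) (Peval p z).
Proof. induction p as [|a p IH]; simpl. Cring. rewrite IH. Cring. Qed.

Lemma nth_padd p q n : nth n (padd p q) C0 = Cadd (nth n p C0) (nth n q C0).
Proof.
revert q n. induction p as [|a p IH]; intros [|b q] [|n]; simpl padd; simpl nth; try Cring.
apply IH.
Qed.

Lemma nth_pscal x p n : nth n (pscal x p) C0 = Cmul (RtoC x) (nth n p C0).
Proof.
revert n. induction p as [|a p IH]; intros [|n]; simpl; try Cring. apply IH.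
Qed.

Lemma nth_pd_aux k p n : nth n (pd_aux k p) C0 = Cmul (RtoC (INR (k + n))) (nth n p C0).
Proof.
revert k n. induction p as [|a p IH]; intros k [|n]; simpl pd_aux; simpl nth.
Cring. Cring. rewrite Nat.add_0_r; auto.
rewrite IH. replace (S k + n)%nat with (k + S n)%nat by lia. auto.
Qed.

Lemma nth_Pderiv p n : nth n (Pderiv p) C0 = Cmul (RtoC (INR (S n))) (nth (S n) p C0).
Proof.
destruct p as [|a p]. destruct n; Cring.
simpl Pderiv. rewrite nth_pd_aux. reflexivity.
Qed.

Definition heun_list (A M B C G : R) (p : list Cplx) : list Cplx :=
  padd (C0 :: C0 :: Pderiv (Pderiv p))
   (padd (pscal A (C0 :: Pderiv p))
    (padd (pscal M (Pderiv p))
     (padd (pscal B (C0 :: C0 :: Pderiv p))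
      (padd (pscal C p) (pscal G (C0 :: p)))))).

Lemma Peval_heun_list A M B C G p z :
  Peval (heun_list A M B C G p) z =
  Cadd (Cadd (Cmul (Cmul z z) (Peval (Pderiv (Pderiv p)) z))
     (Cmul (Cadd (Cmul (RtoC A) z) (Cadd (RtoC M) (Cmul (RtoC B) (Cmul z z)))) (Peval (Pderiv p) z)))
     (Cmul (Cadd (RtoC C) (Cmul (RtoC G) z)) (Peval p z)).
Proof.
unfold heun_list. rewrite !Peval_padd, !Peval_pscal. cbn [Peval]. Cring.
Qed.

(** The coefficients of the equation are real, so the real and the imaginary parts of the
    polynomial's coefficients obey the recurrence separately. *)
Lemma nth_heun_list A M B C G p n (pr : Cplx -> R) : pr = fst \/ pr = snd ->
  pr (nth n (heun_list A M B C G p) C0) = heun A M B C G (fun n => pr (nth n p C0)) n.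
Proof.
intros Hpr. unfold heun_list. rewrite !nth_padd, !nth_pscal.
assert (H0 : pr C0 = 0) by (destruct Hpr; subst; auto).
assert (Ha : forall a b, pr (Cadd a b) = pr a + pr b) by (destruct Hpr; subst; auto).
assert (Hm : forall x a, pr (Cmul (RtoC x) a) = x * pr a)
  by (destruct Hpr; subst; intros; simpl; ring).
rewrite !Ha, !Hm.
unfold heun, Ds.
destruct n as [|[|n]]; cbn [nth Xs]; rewrite ?H0, ?nth_Pderiv, ?Hm; ring.
Qed.

Lemma Peval_zero q : (forall n, nth n q C0 = C0) -> forall z, Peval q z = C0.
Proof.
induction q as [|a q IH]; intros H z; simpl. auto.
rewrite (IH (fun n => H (S n))). specialize (H 0%nat). simpl in H. subst a. Cring.
Qed.

Lemma Peval_bounded q : exists B, 0 <= B /\ forall t, 0 < t <= 1 ->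
  Rabs (fst (Peval q (t, 0))) <= B /\ Rabs (snd (Peval q (t, 0))) <= B.
Proof.
induction q as [|[x y] q [B [HB IH]]].
  exists 0. simpl. rewrite Rabs_R0. split; [lra|intros; lra].
exists (Rabs x + Rabs y + B). split.
  generalize (Rabs_pos x) (Rabs_pos y); lra.
intros t Ht. destruct (IH t Ht) as [I1 I2]. cbn [Peval].
destruct (Peval q (t, 0)) as [u v]. simpl in *.
assert (Hb : forall w, Rabs w <= B -> Rabs (t * w) <= B).
{ intros w Hw. rewrite Rabs_mult, (Rabs_right t) by lra.
  generalize (Rabs_pos w). nra. }
split.
- replace (x + (t * u - 0 * v)) with (x + t * u) by ring.
  generalize (Rabs_triang x (t * u)) (Hb u I1) (Rabs_pos y). lra.
- replace (y + (t * v + 0 * u)) with (y + t * v) by ring.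
  generalize (Rabs_triang y (t * v)) (Hb v I2) (Rabs_pos x). lra.
Qed.

Lemma Rabs_small_eq_0 x B : 0 <= B -> (forall t, 0 < t <= 1 -> Rabs x <= t * B) -> x = 0.
Proof.
intros HB H. destruct (Req_dec x 0) as [|Hx]; auto. exfalso.
apply Rabs_pos_lt in Hx. set (t := Rmin 1 (Rabs x / (2 * (B + 1)))).
assert (Hp : 0 < Rabs x / (2 * (B + 1))) by (apply Rdiv_lt_0_compat; lra).
assert (Ht : 0 < t <= 1).
{ unfold t. split. apply Rmin_pos; lra. apply Rmin_l. }
specialize (H t Ht).
assert (t * (2 * (B + 1)) <= Rabs x).
{ apply Rmult_le_reg_r with (/ (2 * (B + 1))). apply Rinv_0_lt_compat; lra.
  rewrite Rmult_assoc, Rinv_r, Rmult_1_r by lra. apply Rmin_r. }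
nra.
Qed.

(** The constant coefficient is at most a constant times [t] for all small [t], hence zero; dividing
    by [t] then reduces the degree. *)
Lemma Peval_zero_inv q : (forall t, 0 < t -> Peval q (t, 0) = C0) -> forall n, nth n q C0 = C0.
Proof.
induction q as [|[x y] q IH]; intros H n.
  destruct n; auto.
destruct (Peval_bounded q) as [B [HB HB']].
assert (Hxy : x = 0 /\ y = 0).
{ split; apply Rabs_small_eq_0 with B; auto; intros t Ht;
  generalize (H t (proj1 Ht)); cbn [Peval]; destruct (HB' t Ht) as [I1 I2];
  destruct (Peval q (t, 0)) as [u v]; simpl in *; intros E; injection E; intros E1 E2.
  replace x with (- (t * u)) by lra. rewrite Rabs_Ropp, Rabs_mult, (Rabs_right t) by lra. nra.
  replace y with (- (t * v)) by lra. rewrite Rabs_Ropp, Rabs_mult, (Rabs_right t) by lra. nra. }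
destruct Hxy; subst.
destruct n as [|n]. reflexivity. simpl. apply IH.
intros t Ht. generalize (H t Ht). cbn [Peval]. destruct (Peval q (t, 0)) as [u v].
unfold Cadd, Cmul, C0; simpl. intros E; injection E; intros E1 E2.
f_equal; apply Rmult_eq_reg_l with t; lra.
Qed.

Lemma poly_solution_heun_list l mu lam p :
  poly_solution l mu lam p <->
  (exists z, Peval p z <> C0) /\
  forall z, Peval (heun_list (1 - l) mu (- mu) lam (mu * (l - 1)) p) z = C0.
Proof.
unfold poly_solution. split; intros [H1 H2]; split; auto; intros z; rewrite <- (H2 z).
  rewrite Peval_heun_list; Cring.
symmetry. rewrite Peval_heun_list; Cring.
Qed.

Lemma last_nonzero (e : nat -> R) N : e 0%nat <> 0 -> (forall n, (N <= n)%nat -> e n = 0) ->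
  exists m, e m <> 0 /\ forall n, (S m <= n)%nat -> e n = 0.
Proof.
intros H0. induction N as [|N IH]; intros H.
  exfalso. apply H0, H. lia.
destruct (Req_dec (e N) 0) as [HN|HN].
  apply IH. intros n Hn. destruct (Nat.eq_dec n N) as [->|]; auto. apply H. lia.
exists N; split; auto.
Qed.

(** That [l] is natural comes from the top row: if [e m] is the last nonzero coefficient, row
    [m + 1] reads [mu (l - 1 - m) e m = 0], whence [l = m + 1]. *)
Lemma poly_solution_iff l mu kap : mu <> 0 ->
  (exists p, poly_solution l mu (kap - mu ^ 2) p) <->
  exists n : nat, l = INR n /\ forall m, (n <= m)%nat -> esol l mu kap m = 0.
Proof.
intros Hmu. split.
- intros [p Hp]. apply poly_solution_heun_list in Hp. destruct Hp as [[z0 Hz] Hp].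
  assert (Hc := Peval_zero_inv _ (fun t _ => Hp (t, 0))).
  assert (Hpr : forall pr, pr = fst \/ pr = snd -> forall n,
     pr (nth n p C0) = pr (nth 0 p C0) * esol l mu kap n).
  { intros pr Hpr. apply heun_unique; auto. intros n. 
    rewrite <- nth_heun_list by auto. rewrite Hc. destruct Hpr; subst; auto. }
  assert (Hz0 : nth 0 p C0 <> C0).
  { intros E. apply Hz. apply Peval_zero. intros n. apply Cplx_ext.
    rewrite (Hpr fst), E by auto. simpl; ring.
    rewrite (Hpr snd), E by auto. simpl; ring. }
  assert (He : forall n, (length p <= n)%nat -> esol l mu kap n = 0).
  { intros n Hn. destruct (Req_dec (esol l mu kap n) 0) as [|Hne]; auto.
    exfalso. apply Hz0. generalize (Hpr fst (or_introl eq_refl) n) (Hpr snd (or_intror eq_refl) n).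
    rewrite (nth_overflow p C0 Hn). simpl. intros E1 E2. apply Cplx_ext; simpl.
    apply Rmult_eq_reg_r with (esol l mu kap n); auto. lra.
    apply Rmult_eq_reg_r with (esol l mu kap n); auto. lra. }
  destruct (last_nonzero (esol l mu kap) (length p)) as [m [Hm1 Hm2]]; auto.
  { unfold esol; rewrite heun_sol_0. lra. }
  exists (S m). split; auto.
  generalize (heun_sol_eq (1 - l) mu (- mu) (kap - mu ^ 2) (mu * (l - 1)) (S m) Hmu).
  fold (esol l mu kap). rewrite heun_S, !Hm2 by lia. intros E.
  assert (E' : mu * esol l mu kap m * (l - INR m - 1) = 0) by lra.
  apply Rmult_integral in E'. destruct E' as [E'|E'].
    apply Rmult_integral in E'. tauto.
  rewrite S_INR. lra.
- intros [n [Hl He]].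
  exists (map (fun k => RtoC (esol l mu kap k)) (seq 0 n)).
  set (p := map _ _).
  assert (Hn : forall k, nth k p C0 = RtoC (esol l mu kap k)).
  { intros k. destruct (le_lt_dec n k) as [Hk|Hk].
    - rewrite He, nth_overflow; auto. unfold p. rewrite length_map, length_seq. auto.
    - unfold p. rewrite nth_indep with (d' := RtoC (esol l mu kap 0)).
      2: rewrite length_map, length_seq; auto.
      rewrite (map_nth (fun k => RtoC (esol l mu kap k))), seq_nth by auto. reflexivity. }
  apply poly_solution_heun_list. split.
  + exists C0. generalize (Hn 0%nat). unfold esol; rewrite heun_sol_0.
    destruct p as [|a p]; simpl; intros E.
      injection E; intros; lra.
    subst a. intros E. injection E. intros. lra.
  + apply Peval_zero. intros k. apply Cplx_ext.
    * rewrite (nth_heun_list _ _ _ _ _ _ _ fst) by auto.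
      rewrite (heun_coef_ext _ _ _ _ _ (1 - l) mu (- mu) (kap - mu ^ 2) (mu * (l - 1)) _
         (esol l mu kap)); auto. apply heun_sol_eq; auto.
      intros; rewrite Hn; auto.
    * rewrite (nth_heun_list _ _ _ _ _ _ _ snd) by auto.
      rewrite (heun_coef_ext _ _ _ _ _ (1 - l) mu (- mu) (kap - mu ^ 2) (mu * (l - 1)) _
         (fun n => 0 * esol l mu kap n)); auto. rewrite heun_scal. simpl; ring.
      intros; rewrite Hn; simpl; ring.
Qed.

(** * Solutions in polar coordinates *)

Lemma Cplx_field_theory :
  field_theory C0 C1 Cadd Cmul Csub Copp Cdiv Cinv (@eq Cplx).
Proof. exact Complex.C_field_theory. Qed.
Add Field Cplx_field : Cplx_field_theory.

Lemma Cnorm_triang z w : Cnorm (Cadd z w) <= Cnorm z + Cnorm w.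
Proof. exact (Complex.Cmod_triangle z w). Qed.
Lemma Cnorm_mul z w : Cnorm (Cmul z w) = Cnorm z * Cnorm w.
Proof. exact (Complex.Cmod_mult z w). Qed.
Lemma Cnorm_pos z : 0 <= Cnorm z.
Proof. exact (Complex.Cmod_ge_0 z). Qed.
Lemma Cnorm_fst z : Rabs (fst z) <= Cnorm z.
Proof. exact (Rle_trans _ _ _ (Rmax_l _ _) (Complex.Rmax_Cmod z)). Qed.
Lemma Cnorm_snd z : Rabs (snd z) <= Cnorm z.
Proof. exact (Rle_trans _ _ _ (Rmax_r _ _) (Complex.Rmax_Cmod z)). Qed.
Lemma Cnorm_R x : Cnorm (RtoC x) = Rabs x.
Proof. exact (Complex.Cmod_R x). Qed.
Lemma Cnorm_0 : Cnorm C0 = 0.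
Proof. unfold C0. change (Cnorm (RtoC 0) = 0). rewrite Cnorm_R. apply Rabs_R0. Qed.
Lemma Cnorm_le z : Cnorm z <= Rabs (fst z) + Rabs (snd z).
Proof.
unfold Cnorm. apply Rsqr_incr_0_var.
2: generalize (Rabs_pos (fst z)) (Rabs_pos (snd z)); lra.
rewrite Rsqr_sqrt.
2: generalize (pow2_ge_0 (fst z)) (pow2_ge_0 (snd z)); lra.
rewrite <- (pow2_abs (fst z)), <- (pow2_abs (snd z)). unfold Rsqr.
generalize (Rabs_pos (fst z)) (Rabs_pos (snd z)). nra.
Qed.

(** Solutions are only differentiated along rays and circles, hence in one real variable. *)
Definition CD (f : R -> Cplx) (x : R) (d : Cplx) : Prop :=
  is_derive (fun t => fst (f t)) x (fst d) /\ is_derive (fun t => snd (f t)) x (snd d).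

Lemma is_derive_eps g x l : is_derive g x l <->
  forall eps, 0 < eps -> exists delta, 0 < delta /\
    forall h, Rabs h < delta -> Rabs (g (x + h) - g x - h * l) <= eps * Rabs h.
Proof.
rewrite is_derive_Reals. split.
- intros H eps He. destruct (H eps He) as [d Hd]. exists d. split. apply cond_pos.
  intros h Hh. destruct (Req_dec h 0) as [->|Hne].
    rewrite Rplus_0_r. replace (g x - g x - 0 * l) with 0 by ring. rewrite Rabs_R0. lra.
  replace (g (x + h) - g x - h * l) with (((g (x + h) - g x) / h - l) * h) by (field; auto).
  rewrite Rabs_mult. apply Rmult_le_compat_r. apply Rabs_pos. left; auto.
- intros H eps He. destruct (H (eps / 2)) as [d [Hd Hd']]. lra.
  exists (mkposreal d Hd). simpl. intros h Hne Hh.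
  specialize (Hd' h Hh). assert (Hp := Rabs_pos_lt h Hne).
  replace ((g (x + h) - g x) / h - l) with ((g (x + h) - g x - h * l) / h) by (field; auto).
  unfold Rdiv. rewrite Rabs_mult, Rabs_inv.
  apply Rmult_lt_reg_r with (Rabs h); auto. rewrite Rmult_assoc, Rinv_l, Rmult_1_r by lra. nra.
Qed.

Lemma CD_eps f x d : CD f x d <->
  forall eps, 0 < eps -> exists delta, 0 < delta /\
    forall h, Rabs h < delta ->
      Cnorm (Csub (Csub (f (x + h)) (f x)) (Cmul (RtoC h) d)) <= eps * Rabs h.
Proof.
unfold CD. rewrite !is_derive_eps. split.
- intros [H1 H2] eps He.
  destruct (H1 (eps / 2)) as [d1 [P1 Q1]]. lra.
  destruct (H2 (eps / 2)) as [d2 [P2 Q2]]. lra.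
  exists (Rmin d1 d2). split. apply Rmin_pos; auto.
  intros h Hh. apply Rle_trans with (1 := Cnorm_le _).
  assert (h1 : Rabs h < d1) by (apply Rlt_le_trans with (1 := Hh); apply Rmin_l).
  assert (h2 : Rabs h < d2) by (apply Rlt_le_trans with (1 := Hh); apply Rmin_r).
  specialize (Q1 h h1). specialize (Q2 h h2). simpl.
  match goal with |- Rabs ?a + Rabs ?b <= _ =>
   replace a with (fst (f (x + h)) - fst (f x) - h * fst d) by ring;
   replace b with (snd (f (x + h)) - snd (f x) - h * snd d) by ring end. lra.
- intros H. split; intros eps He; destruct (H eps He) as [d1 [P1 Q1]]; exists d1; split; auto;
  intros h Hh; apply Rle_trans with (2 := Q1 h Hh).
  eapply Rle_trans. 2: apply Cnorm_fst. simpl. right; f_equal; ring.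
  eapply Rle_trans. 2: apply Cnorm_snd. simpl. right; f_equal; ring.
Qed.

(** Division-free form that also admits [w = z], a value that a path may take again. *)
Lemma Cderiv_on_eps S f f' z : Cderiv_on S f f' -> S z ->
  forall eps, 0 < eps -> exists delta, 0 < delta /\
    forall w, S w -> Cnorm (Csub w z) < delta ->
      Cnorm (Csub (Csub (f w) (f z)) (Cmul (f' z) (Csub w z))) <= eps * Cnorm (Csub w z).
Proof.
intros H Sz eps He. destruct (H z Sz eps He) as [d [Hd Hd']]. exists d; split; auto.
intros w Sw. generalize (eq_refl (Csub w z)). generalize (Csub w z) at 2 3 4 5.
intros h Eh Hw.
assert (Ew : w = Cadd z h) by (rewrite <- Eh; ring). clear Eh.
destruct (Req_dec (fst h) 0) as [E1|E1]; [destruct (Req_dec (snd h) 0) as [E2|E2]|].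
1:{ assert (E : h = C0) by (apply Cplx_ext; auto).
    assert (Ez : w = z) by (rewrite Ew, E; ring). rewrite Ez, E. replace (Csub (Csub (f z) (f z)) (Cmul (f' z) C0)) with C0 by ring.
    rewrite Cnorm_0. lra. }
all: assert (Hh : h <> C0) by (intros E; rewrite E in *; simpl in *; auto).
all: rewrite Ew in Sw |- *; specialize (Hd' h Hh Sw Hw);
  replace (Csub (Csub (f (Cadd z h)) (f z)) (Cmul (f' z) h)) with
   (Cmul (Csub (Cdiv (Csub (f (Cadd z h)) (f z)) h) (f' z)) h) by (field; auto);
  rewrite Cnorm_mul; apply Rmult_le_compat_r; [apply Cnorm_pos | left; auto].
Qed.

Lemma Cderiv_on_continuous S f f' z : Cderiv_on S f f' -> S z ->
  forall eps, 0 < eps -> exists delta, 0 < delta /\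
    forall w, S w -> Cnorm (Csub w z) < delta -> Cnorm (Csub (f w) (f z)) < eps.
Proof.
intros H Sz eps He. destruct (Cderiv_on_eps S f f' z H Sz 1) as [d [Hd Hd']]. lra.
set (K := 1 + Cnorm (f' z)).
assert (HK : 0 < K) by (unfold K; generalize (Cnorm_pos (f' z)); lra).
exists (Rmin d (eps / K)). split.
  apply Rmin_pos; auto. apply Rdiv_lt_0_compat; auto.
intros w Sw Hw.
assert (H1 : Cnorm (Csub w z) < d) by (apply Rlt_le_trans with (1 := Hw); apply Rmin_l).
assert (H2 : Cnorm (Csub w z) < eps / K) by (apply Rlt_le_trans with (1 := Hw); apply Rmin_r).
specialize (Hd' w Sw H1).
replace (Csub (f w) (f z)) with
  (Cadd (Csub (Csub (f w) (f z)) (Cmul (f' z) (Csub w z))) (Cmul (f' z) (Csub w z))) by ring.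
apply Rle_lt_trans with (1 := Cnorm_triang _ _). rewrite Cnorm_mul.
apply Rle_lt_trans with (K * Cnorm (Csub w z)). unfold K; lra.
apply Rmult_lt_compat_l with (r := K) in H2; auto.
unfold Rdiv in H2. rewrite (Rmult_comm eps), <- Rmult_assoc, Rinv_r, Rmult_1_l in H2 by lra. auto.
Qed.

Lemma CD_comp S f f' c s c' : Cderiv_on S f f' -> CD c s c' -> locally s (fun t => S (c t)) ->
  CD (fun t => f (c t)) s (Cmul (f' (c s)) c').
Proof.
intros Hf Hc [d0 Hl].
assert (Ss : S (c s)) by (apply Hl, ball_center).
apply CD_eps. intros eps He. rewrite CD_eps in Hc.
set (K := 1 + Cnorm c'). set (K' := 1 + Cnorm (f' (c s))).
assert (HK : 0 < K) by (unfold K; generalize (Cnorm_pos c'); lra).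
assert (HK' : 0 < K') by (unfold K'; generalize (Cnorm_pos (f' (c s))); lra).
destruct (Cderiv_on_eps S f f' (c s) Hf Ss (eps / (2 * K))) as [d1 [P1 Q1]].
  apply Rdiv_lt_0_compat; lra.
(* The bound 1 gives [|D| <= K |h|]; the other one makes the linearization error of the path
   small. *)
destruct (Hc (Rmin 1 (eps / (2 * K')))) as [d2 [P2 Q2]].
  apply Rmin_pos. lra. apply Rdiv_lt_0_compat; lra.
exists (Rmin d0 (Rmin d2 (d1 / K))). split.
  apply Rmin_pos. apply cond_pos. apply Rmin_pos; auto. apply Rdiv_lt_0_compat; auto.
intros h Hh.
assert (h0 : Rabs h < d0) by (apply Rlt_le_trans with (1 := Hh); apply Rmin_l).
assert (h12 : Rabs h < Rmin d2 (d1 / K)) by (apply Rlt_le_trans with (1 := Hh); apply Rmin_r).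
assert (h2 : Rabs h < d2) by (apply Rlt_le_trans with (1 := h12); apply Rmin_l).
assert (h1 : Rabs h < d1 / K) by (apply Rlt_le_trans with (1 := h12); apply Rmin_r).
assert (Sh : S (c (s + h))).
{ apply Hl. unfold ball; simpl. unfold AbsRing_ball, abs, minus, plus, opp; simpl.
  replace (s + h + - s) with h by ring. auto. }
specialize (Q2 h h2).
set (D := Csub (c (s + h)) (c s)) in *.
assert (Q2' : Cnorm (Csub D (Cmul (RtoC h) c')) <= Rabs h).
{ apply Rle_trans with (1 := Q2). rewrite <- (Rmult_1_l (Rabs h)) at 2.
  apply Rmult_le_compat_r. apply Rabs_pos. apply Rmin_l. }
assert (Q2'' : Cnorm (Csub D (Cmul (RtoC h) c')) <= eps / (2 * K') * Rabs h).
{ apply Rle_trans with (1 := Q2). 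
  apply Rmult_le_compat_r. apply Rabs_pos. apply Rmin_r. }
assert (HD : Cnorm D <= K * Rabs h).
{ replace D with (Cadd (Csub D (Cmul (RtoC h) c')) (Cmul (RtoC h) c')) by ring.
  apply Rle_trans with (1 := Cnorm_triang _ _). rewrite Cnorm_mul, Cnorm_R. unfold K. lra. }
assert (HD1 : Cnorm D < d1).
{ apply Rle_lt_trans with (1 := HD). rewrite Rmult_comm. apply Rlt_div_r; auto. }
specialize (Q1 (c (s + h)) Sh HD1). fold D in Q1.
replace (Csub (Csub (f (c (s + h))) (f (c s))) (Cmul (RtoC h) (Cmul (f' (c s)) c')))
  with (Cadd (Csub (Csub (f (c (s + h))) (f (c s))) (Cmul (f' (c s)) D))
             (Cmul (f' (c s)) (Csub D (Cmul (RtoC h) c')))) by ring.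
apply Rle_trans with (1 := Cnorm_triang _ _). rewrite Cnorm_mul.
assert (E1 : eps / (2 * K) * Cnorm D <= eps / 2 * Rabs h).
{ apply Rle_trans with (eps / (2 * K) * (K * Rabs h)).
  apply Rmult_le_compat_l; auto. left; apply Rdiv_lt_0_compat; lra.
  right. field. lra. }
assert (E2 : Cnorm (f' (c s)) * Cnorm (Csub D (Cmul (RtoC h) c')) <= eps / 2 * Rabs h).
{ apply Rle_trans with (K' * (eps / (2 * K') * Rabs h)).
  apply Rmult_le_compat; auto using Cnorm_pos. unfold K'; lra.
  right. field. lra. }
lra.
Qed.

Lemma CD_ext f x d d' : CD f x d -> d = d' -> CD f x d'.
Proof. intros H ->. auto. Qed.

Lemma CD_ext_loc f g x d : locally x (fun t => f t = g t) -> CD f x d -> CD g x d.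
Proof.
intros He [H1 H2]. split.
- apply is_derive_ext_loc with (2 := H1). apply filter_imp with (2 := He). intros t ->; auto.
- apply is_derive_ext_loc with (2 := H2). apply filter_imp with (2 := He). intros t ->; auto.
Qed.

Lemma CD_sub f g x d d' : CD f x d -> CD g x d' -> CD (fun t => Csub (f t) (g t)) x (Csub d d').
Proof.
intros [H1 H2] [H3 H4]. split; simpl.
- exact (is_derive_minus _ _ _ _ _ H1 H3).
- exact (is_derive_minus _ _ _ _ _ H2 H4).
Qed.

Lemma CD_mul f g x d d' : CD f x d -> CD g x d' ->
  CD (fun t => Cmul (f t) (g t)) x (Cadd (Cmul d (g x)) (Cmul (f x) d')).
Proof.
intros [H1 H2] [H3 H4].
assert (M : forall (p q : R -> R) a b, is_derive p x a -> is_derive q x b ->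
  is_derive (fun t => p t * q t) x (a * q x + p x * b)).
{ intros p q a b Hp Hq. exact (is_derive_mult p q x a b Hp Hq). }
split; simpl.
- generalize (is_derive_minus _ _ _ _ _ (M _ _ _ _ H1 H3) (M _ _ _ _ H2 H4)).
  unfold minus, plus, opp; simpl. intros H. eapply is_derive_ext; [|evar_last; [exact H|]].
  intros t; simpl; ring. simpl. ring.
- generalize (is_derive_plus _ _ _ _ _ (M _ _ _ _ H1 H4) (M _ _ _ _ H2 H3)).
  unfold plus; simpl. intros H. eapply is_derive_ext; [|evar_last; [exact H|]].
  intros t; simpl; ring. simpl. ring.
Qed.

Lemma CD_sqnorm f x d : CD f x d ->
  is_derive (fun t => fst (f t) ^ 2 + snd (f t) ^ 2) x (2 * (fst (f x) * fst d + snd (f x) * snd d)).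
Proof.
intros [H1 H2].
assert (M : forall (p : R -> R) a, is_derive p x a ->
  is_derive (fun t => p t ^ 2) x (2 * (p x * a))).
{ intros p a Hp. generalize (is_derive_mult p p x a a Hp Hp).
  unfold plus, mult; simpl. intros H. eapply is_derive_ext; [|evar_last; [exact H|]].
  intros t; simpl. unfold mult; simpl; ring. simpl. ring. }
evar_last. exact (is_derive_plus _ _ _ _ _ (M _ _ H1) (M _ _ H2)).
unfold plus; simpl; ring.
Qed.

Lemma CD_polar_arg r phi : CD (fun t => polar r t) phi (Cmul Ci (polar r phi)).
Proof.
split; simpl.
- auto_derive; auto. ring.
- auto_derive; auto. ring.
Qed.

Lemma CD_polar_mod r phi : 0 < r -> CD (fun t => polar t phi) r (Cmul (RtoC (/ r)) (polar r phi)).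
Proof.
intros Hr. split; simpl; auto_derive; auto; field; lra.
Qed.

Lemma polar_neq_0 r phi : 0 < r -> polar r phi <> C0.
Proof.
intros Hr E. injection E. intros E2 E1.
apply Rmult_integral in E1. apply Rmult_integral in E2.
generalize (sin2_cos2 phi). unfold Rsqr.
destruct E1 as [E1|E1]; [lra|]. destruct E2 as [E2|E2]; [lra|]. rewrite E1, E2. lra.
Qed.

Lemma locally_interval a b x : a < x < b -> locally x (fun t => a < t < b).
Proof.
intros H. apply filter_and. apply (open_gt a); lra. apply (open_lt b); lra.
Qed.

(* [z d/dz u] for a system [z v' = k u], [z u' = -(L + M (z + 1/z)) u + k v], where
   [k = - i q]; both columns of [H] satisfy such a system. *)
Definition theta_u (q L M : R) (z v u : Cplx) : Cplx :=
  Csub (Cmul (0, - q) v) (Cmul (Cadd (RtoC L) (Cmul (RtoC M) (Cadd z (Cinv z)))) u).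

(** Arguments are real numbers in [(a, b)] rather than points of the plane, so that a solution may
    extend over more than a full turn before it is known to be single valued. First the angular,
    then the radial derivatives. *)
Definition polsol (q L M a b : R) (v u : R -> R -> Cplx) : Prop :=
  forall r phi, 0 < r -> a < phi < b ->
    (CD (fun t => v r t) phi (Cmul (RtoC q) (u r phi)) /\
     CD (fun t => u r t) phi (Cmul Ci (theta_u q L M (polar r phi) (v r phi) (u r phi)))) /\
    (CD (fun t => v t phi) r (Cmul (RtoC (/ r)) (Cmul (0, - q) (u r phi))) /\
     CD (fun t => u t phi) r
       (Cmul (RtoC (/ r)) (theta_u q L M (polar r phi) (v r phi) (u r phi)))).

Lemma Ci_q q w : Cmul Ci (Cmul (0, - q) w) = Cmul (RtoC q) w.
Proof. Cring. Qed.

Definition polar_incl (a b : R) (S : Cplx -> Prop) : Prop :=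
  forall r phi, 0 < r -> a < phi < b -> S (polar r phi).

Lemma polsol_of_Cderiv q L M a b S v u v' u' : polar_incl a b S ->
  Cderiv_on S v v' -> Cderiv_on S u u' ->
  (forall z, S z -> z <> C0 -> Cmul z (v' z) = Cmul (0, - q) (u z)) ->
  (forall z, S z -> z <> C0 -> Cmul z (u' z) = theta_u q L M z (v z) (u z)) ->
  polsol q L M a b (fun r phi => v (polar r phi)) (fun r phi => u (polar r phi)).
Proof.
intros HS Hv Hu Ev Eu r phi Hr Hphi.
assert (Hz := polar_neq_0 r phi Hr).
assert (Sz := HS r phi Hr Hphi).
assert (L1 : locally phi (fun t => S (polar r t))).
{ apply filter_imp with (2 := locally_interval _ _ _ Hphi). auto. }
assert (L2 : locally r (fun t => S (polar t phi))).
{ assert (L2 : locally r (fun t => 0 < t)) by (apply (open_gt 0); auto).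
  apply filter_imp with (2 := L2). auto. }
rewrite <- (Eu _ Sz Hz), <- (Ev _ Sz Hz), <- (Ci_q q), <- (Ev _ Sz Hz).
split; split; eapply CD_ext.
1: apply (CD_comp _ _ _ _ _ _ Hv (CD_polar_arg r phi) L1). ring.
1: apply (CD_comp _ _ _ _ _ _ Hu (CD_polar_arg r phi) L1). ring.
1: apply (CD_comp _ _ _ _ _ _ Hv (CD_polar_mod r phi Hr) L2). ring.
1: apply (CD_comp _ _ _ _ _ _ Hu (CD_polar_mod r phi Hr) L2). ring.
Qed.

Lemma k_eq omega : 0 < omega -> Cinv (Cmul (RtoC (2 * omega)) Ci) = (0, - (1 / (2 * omega))).
Proof. intros H. apply Cplx_ext; simpl; field; lra. Qed.

Lemma RtoC_opp x : RtoC (- x) = Copp (RtoC x).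
Proof. Cring. Qed.

(** The second column of [H B] vanishes, so this column solves (L) itself. *)
Lemma polsol_col2 omega l mu a b a' b' H : 0 < omega -> transforms_L omega l mu a b H ->
  polar_incl a' b' (sector a b) -> polsol (1 / (2 * omega)) l mu a' b'
    (fun r phi => e22 (H (polar r phi))) (fun r phi => e12 (H (polar r phi))).
Proof.
intros Ho [H' [[_ [D12 [_ D22]]] E]] HS.
apply polsol_of_Cderiv with (1 := HS) (2 := D22) (3 := D12).
- intros z Sz Hz. rewrite (E z Sz). unfold Amat, Bmat. rewrite k_eq by auto. simpl.
  field; auto.
- intros z Sz Hz. rewrite (E z Sz). unfold Amat, Bmat, theta_u. rewrite k_eq by auto. simpl.
  field; auto.
Qed.

(** Subtracting [H B] cancels the diagonal term in the first row and creates it with opposite sign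
    in the second: the two entries exchange roles and [(l, mu)] changes sign. *)
Lemma polsol_col1 omega l mu a b a' b' H : 0 < omega -> transforms_L omega l mu a b H ->
  polar_incl a' b' (sector a b) -> polsol (1 / (2 * omega)) (- l) (- mu) a' b'
    (fun r phi => e11 (H (polar r phi))) (fun r phi => e21 (H (polar r phi))).
Proof.
intros Ho [H' [[D11 [_ [D21 _]]] E]] HS.
apply polsol_of_Cderiv with (1 := HS) (2 := D11) (3 := D21).
- intros z Sz Hz. rewrite (E z Sz). unfold Amat, Bmat. rewrite k_eq by auto. simpl.
  field; auto.
- intros z Sz Hz. rewrite (E z Sz). unfold Amat, Bmat, theta_u. rewrite k_eq by auto. simpl.
  rewrite !RtoC_opp. field; auto.
Qed.

Lemma polsol_sub q L M a b v u v' u' : polsol q L M a b v u -> polsol q L M a b v' u' ->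
  polsol q L M a b (fun r p => Csub (v r p) (v' r p)) (fun r p => Csub (u r p) (u' r p)).
Proof.
intros H H' r phi Hr Hphi.
destruct (H r phi Hr Hphi) as [[A1 A2] [A3 A4]].
destruct (H' r phi Hr Hphi) as [[B1 B2] [B3 B4]].
split; split; eapply CD_ext.
1: apply (CD_sub _ _ _ _ _ A1 B1). ring.
1: apply (CD_sub _ _ _ _ _ A2 B2). unfold theta_u; ring.
1: apply (CD_sub _ _ _ _ _ A3 B3). ring.
1: apply (CD_sub _ _ _ _ _ A4 B4). unfold theta_u; ring.
Qed.

(** * Uniqueness of solutions by an energy estimate *)

Definition lim0 (f : R -> Cplx) (w : Cplx) : Prop :=
  forall eps, 0 < eps -> exists delta, 0 < delta /\
    forall r, 0 < r < delta -> Cnorm (Csub (f r) w) < eps.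

Lemma derive_nonpos_decr f f' a b : a <= b -> (forall x, a <= x <= b -> is_derive f x (f' x)) ->
  (forall x, a <= x <= b -> f' x <= 0) -> f b <= f a.
Proof.
intros Hab Hd Hn. destruct (MVT_gen f a b f') as [c [Hc E]].
- intros x Hx. rewrite Rmin_left, Rmax_right in Hx by lra. apply Hd; lra.
- intros x Hx. rewrite Rmin_left, Rmax_right in Hx by lra.
  apply continuity_pt_filterlim. apply @ex_derive_continuous. exists (f' x). apply Hd; lra.
- rewrite Rmin_left, Rmax_right in Hc by lra. specialize (Hn c Hc). nra.
Qed.

(** [f e^(-C x)] is nonincreasing and settles the right of [x0]; [f e^(C x)] is nondecreasing and
    settles the left. *)
Lemma gronwall_zero f f' C a b x0 : a < x0 < b -> 
  (forall x, a < x < b -> is_derive f x (f' x)) ->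
  (forall x, a < x < b -> Rabs (f' x) <= C * f x) -> (forall x, 0 <= f x) -> f x0 = 0 ->
  forall x, a < x < b -> f x = 0.
Proof.
intros Hx0 Hd HC Hp H0 x Hx.
assert (De : forall c t, a < t < b -> is_derive (fun t => f t * exp (c * t)) t ((f' t + c * f t) * exp (c * t))).
{ intros c t Ht. evar_last.
  apply (is_derive_mult f (fun t => exp (c * t)) t (f' t) (c * exp (c * t)) (Hd t Ht)).
  auto_derive; auto. ring.
  unfold plus, mult; simpl. ring. }
assert (Z : f x * exp (- C * x) <= 0 \/ f x * exp (C * x) <= 0).
{ destruct (Rle_lt_dec x0 x) as [Hle|Hlt].
  - left. rewrite <- (Rmult_0_l (exp (- C * x0))), <- H0.
    apply (derive_nonpos_decr (fun t => f t * exp (- C * t)) (fun t => (f' t + - C * f t) * exp (- C * t))); auto.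
    intros t Ht. apply De. lra.
    intros t Ht. assert (T := HC t ltac:(lra)). apply Rabs_le_between in T.
    generalize (exp_pos (- C * t)). nra.
  - right. apply Ropp_le_cancel. rewrite Ropp_0.
    replace 0 with (- (f x0 * exp (C * x0))) by (rewrite H0; ring).
    apply (derive_nonpos_decr (fun t => - (f t * exp (C * t))) (fun t => - ((f' t + C * f t) * exp (C * t)))); [lra| |].
    intros t Ht. apply @is_derive_opp. apply De. lra.
    intros t Ht. assert (T := HC t ltac:(lra)). apply Rabs_le_between in T.
    generalize (exp_pos (C * t)). nra. }
destruct Z as [Z|Z].
- generalize (exp_pos (- C * x)) (Hp x). nra.
- generalize (exp_pos (C * x)) (Hp x). nra.
Qed.

(* [k] being imaginary, the coupling terms cancel in the derivative of [|v|^2 + |u|^2] along the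
   real axis, which is therefore nonincreasing near 0 on the half axis where [M z > 0]. *)
Lemma polsol_zero q L M a b v u phi0 :
  polsol q L M a b v u -> a < phi0 < b -> sin phi0 = 0 -> 0 < M * cos phi0 ->
  lim0 (fun r => v r phi0) C0 -> lim0 (fun r => u r phi0) C0 ->
  exists r0, 0 < r0 /\ forall r phi, 0 < r < r0 -> a < phi < b -> v r phi = C0 /\ u r phi = C0.
Proof.
intros Hs Hphi0 Hsin Hcos Lv Lu.
set (c := cos phi0) in *.
assert (Hc2 : c * c = 1).
{ generalize (sin2_cos2 phi0). unfold Rsqr. rewrite Hsin. fold c. lra. }
set (N := fun r phi => (fst (v r phi) ^ 2 + snd (v r phi) ^ 2) + (fst (u r phi) ^ 2 + snd (u r phi) ^ 2)).
assert (Npos : forall r phi, 0 <= N r phi).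
{ intros r phi. unfold N. generalize (pow2_ge_0 (fst (v r phi))) (pow2_ge_0 (snd (v r phi)))
  (pow2_ge_0 (fst (u r phi))) (pow2_ge_0 (snd (u r phi))). lra. }
assert (N0 : forall r phi, N r phi = 0 -> v r phi = C0 /\ u r phi = C0).
{ intros r phi. unfold N. generalize (pow2_ge_0 (fst (v r phi))) (pow2_ge_0 (snd (v r phi)))
  (pow2_ge_0 (fst (u r phi))) (pow2_ge_0 (snd (u r phi))). intros.
  split; apply Cplx_ext; simpl; nra. }
(* Below [r0] the singular term [M c / r] exceeds [|L| + 1], so [L + M (z + 1/z)] is positive on the
   half axis. *)
set (r0 := M * c / (Rabs L + 1)).
assert (Hr0 : 0 < r0) by (apply Rdiv_lt_0_compat; auto; generalize (Rabs_pos L); lra).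
exists r0. split; auto.
assert (Cn : forall r, 0 < r -> c <> 0 -> fst (Cadd (polar r phi0) (Cinv (polar r phi0))) = c * (r + / r)).
{ intros r Hr Hc. simpl. rewrite Hsin. fold c. 
  replace (c * (r + / r)) with (r * c + (c * c) * (/ r) / c) by (field; lra). rewrite Hc2.
  field. lra. }
assert (Hc : c <> 0) by (intros E; rewrite E in Hc2; lra).
assert (Cs : forall r, 0 < r -> snd (Cadd (polar r phi0) (Cinv (polar r phi0))) = 0).
{ intros r Hr. simpl. rewrite Hsin. fold c. field. lra. }
assert (Ray : forall r, 0 < r < r0 -> N r phi0 = 0).
{ intros r Hr.
  assert (Dec : forall s, 0 < s < r -> N r phi0 <= N s phi0).
  { intros s Hs'.
    apply (derive_nonpos_decr (fun t => N t phi0) (fun t => - 2 * (/ t * ((L + M * (c * (t + / t)))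
       * (fst (u t phi0) ^ 2 + snd (u t phi0) ^ 2))))). lra.
    - intros t Ht. destruct (Hs t phi0 ltac:(lra) Hphi0) as [_ [A1 A2]].
      apply CD_sqnorm in A1. apply CD_sqnorm in A2.
      evar_last. exact (is_derive_plus _ _ _ _ _ A1 A2).
      unfold plus, theta_u.
      generalize (Cn t ltac:(lra) Hc) (Cs t ltac:(lra)).
      generalize (Cadd (polar t phi0) (Cinv (polar t phi0))). intros z z1 z2.
      simpl. rewrite z1, z2. ring.
    - intros t Ht.
      assert (0 < / t) by (apply Rinv_0_lt_compat; lra).
      assert (0 <= L + M * (c * (t + / t))).
      { assert (Rabs L + 1 <= M * c * / t).
        { apply Rmult_le_reg_r with t. lra. rewrite Rmult_assoc, Rinv_l, Rmult_1_r by lra.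
          assert (Ht' : t < r0) by lra. unfold r0 in Ht'.
          apply Rlt_div_r in Ht'. 2: generalize (Rabs_pos L); lra. lra. }
        generalize (Rle_abs (- L)). rewrite Rabs_Ropp. intros.
        assert (0 <= M * c * t) by (apply Rmult_le_pos; lra).
        replace (L + M * (c * (t + / t))) with (L + M * c * t + M * c * / t) by ring. lra. }
      assert (0 <= / t * ((L + M * (c * (t + / t))) * (fst (u t phi0) ^ 2 + snd (u t phi0) ^ 2))).
      { apply Rmult_le_pos. lra. apply Rmult_le_pos; auto.
        generalize (pow2_ge_0 (fst (u t phi0))) (pow2_ge_0 (snd (u t phi0))). lra. }
      lra. }
  apply Rle_antisym; auto. apply Rnot_lt_le. intros Hpos.
  (* Because of the cap 1, a bound on a modulus is also a bound on its square. *)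
  assert (He : 0 < Rmin 1 (N r phi0 / 4)) by (apply Rmin_pos; lra).
  destruct (Lv _ He) as [d1 [P1 Q1]]. destruct (Lu _ He) as [d2 [P2 Q2]].
  set (s := Rmin (r / 2) (Rmin (d1 / 2) (d2 / 2))).
  assert (s1 : s <= r / 2) by apply Rmin_l.
  assert (s2 : s <= d1 / 2) by (eapply Rle_trans; [apply Rmin_r|apply Rmin_l]).
  assert (s3 : s <= d2 / 2) by (eapply Rle_trans; [apply Rmin_r|apply Rmin_r]).
  assert (s0 : 0 < s) by (repeat apply Rmin_pos; lra).
  specialize (Dec s ltac:(lra)). specialize (Q1 s ltac:(lra)). specialize (Q2 s ltac:(lra)).
  assert (Sm : forall w, Cnorm (Csub w C0) < Rmin 1 (N r phi0 / 4) -> fst w ^ 2 + snd w ^ 2 < N r phi0 / 4).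
  { intros w Hw. replace (Csub w C0) with w in Hw by ring.
    assert (E : fst w ^ 2 + snd w ^ 2 = Cnorm w * Cnorm w).
    { unfold Cnorm. rewrite sqrt_sqrt; auto.
      generalize (pow2_ge_0 (fst w)) (pow2_ge_0 (snd w)). lra. }
    rewrite E. generalize (Cnorm_pos w) (Rmin_l 1 (N r phi0 / 4)) (Rmin_r 1 (N r phi0 / 4)). nra. }
  apply Sm in Q1. apply Sm in Q2. unfold N at 2 in Dec. lra. }
(* From the ray to the sector: on each circle the energy obeys a linear differential inequality in
   the argument. *)
intros r phi Hr Hphi. apply N0.
apply (gronwall_zero (N r) (fun t => 2 * (2 * q * (fst (v r t) * fst (u r t) + snd (v r t) * snd (u r t))
   + M * (r - / r) * sin t * (fst (u r t) ^ 2 + snd (u r t) ^ 2)))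
   (2 * Rabs q + 2 * Rabs (M * (r - / r))) a b phi0); auto.
- intros t Ht. destruct (Hs r t ltac:(lra) Ht) as [[A1 A2] _].
  apply CD_sqnorm in A1. apply CD_sqnorm in A2.
  evar_last. exact (is_derive_plus _ _ _ _ _ A1 A2).
  unfold plus, theta_u.
  assert (Ez : snd (Cadd (polar r t) (Cinv (polar r t))) = (r - / r) * sin t).
  2:{ revert Ez. generalize (Cadd (polar r t) (Cinv (polar r t))). intros z z1.
      simpl. rewrite z1. ring. }
  simpl.
  replace (r * cos t * (r * cos t * 1) + r * sin t * (r * sin t * 1)) with (r * r).
  field. lra.
  transitivity (r * r * (Rsqr (sin t) + Rsqr (cos t))). rewrite sin2_cos2; ring. unfold Rsqr; ring.
- intros t Ht. rewrite Rabs_mult, (Rabs_right 2) by lra.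
  set (v1 := fst (v r t)). set (v2 := snd (v r t)). set (u1 := fst (u r t)). set (u2 := snd (u r t)).
  assert (EN : N r t = v1 ^ 2 + v2 ^ 2 + (u1 ^ 2 + u2 ^ 2)) by reflexivity. rewrite EN.
  set (m := M * (r - / r)).
  assert (B1 : Rabs (2 * q * (v1 * u1 + v2 * u2)) <= Rabs q * (v1 ^ 2 + v2 ^ 2 + (u1 ^ 2 + u2 ^ 2))).
  { replace (2 * q * (v1 * u1 + v2 * u2)) with (q * (2 * (v1 * u1 + v2 * u2))) by ring.
    rewrite Rabs_mult. apply Rmult_le_compat_l. apply Rabs_pos.
    apply Rabs_le. generalize (pow2_ge_0 (v1 + u1)) (pow2_ge_0 (v2 + u2)) (pow2_ge_0 (v1 - u1)) (pow2_ge_0 (v2 - u2)).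
    simpl. lra. }
  assert (B2 : Rabs (m * sin t * (u1 ^ 2 + u2 ^ 2)) <= Rabs m * (v1 ^ 2 + v2 ^ 2 + (u1 ^ 2 + u2 ^ 2))).
  { rewrite !Rabs_mult, Rmult_assoc. apply Rmult_le_compat_l. apply Rabs_pos.
    generalize (pow2_ge_0 u1) (pow2_ge_0 u2) (pow2_ge_0 v1) (pow2_ge_0 v2). intros.
    rewrite (Rabs_right (u1 ^ 2 + u2 ^ 2)) by lra.
    assert (Rabs (sin t) <= 1) by (apply Rabs_le, SIN_bound).
    generalize (Rabs_pos (sin t)). nra. }
  generalize (Rabs_triang (2 * q * (v1 * u1 + v2 * u2)) (m * sin t * (u1 ^ 2 + u2 ^ 2))). lra.
Qed.

Lemma lim0_sub f g w w' : lim0 f w -> lim0 g w' -> lim0 (fun r => Csub (f r) (g r)) (Csub w w').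
Proof.
intros Hf Hg eps He.
destruct (Hf (eps / 2)) as [d1 [P1 Q1]]. lra.
destruct (Hg (eps / 2)) as [d2 [P2 Q2]]. lra.
exists (Rmin d1 d2). split. apply Rmin_pos; auto.
intros r Hr. generalize (Rmin_l d1 d2) (Rmin_r d1 d2). intros.
specialize (Q1 r ltac:(lra)). specialize (Q2 r ltac:(lra)).
replace (Csub (Csub (f r) (g r)) (Csub w w')) with
  (Cadd (Csub (f r) w) (Cmul (RtoC (-1)) (Csub (g r) w'))).
2:{ replace (RtoC (-1)) with (Copp C1) by Cring. ring. }
apply Rle_lt_trans with (1 := Cnorm_triang _ _). rewrite Cnorm_mul, Cnorm_R.
replace (Rabs (-1)) with 1 by (rewrite Rabs_left; lra). lra.
Qed.

Lemma polsol_unique q L M a b v u v' u' phi0 w w' :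
  polsol q L M a b v u -> polsol q L M a b v' u' ->
  a < phi0 < b -> sin phi0 = 0 -> 0 < M * cos phi0 ->
  lim0 (fun r => v r phi0) w -> lim0 (fun r => u r phi0) w' ->
  lim0 (fun r => v' r phi0) w -> lim0 (fun r => u' r phi0) w' ->
  exists r0, 0 < r0 /\
    forall r phi, 0 < r < r0 -> a < phi < b -> v r phi = v' r phi /\ u r phi = u' r phi.
Proof.
intros Hs Hs' Hphi Hsin Hcos L1 L2 L3 L4.
destruct (polsol_zero q L M a b _ _ phi0 (polsol_sub _ _ _ _ _ _ _ _ _ Hs Hs') Hphi Hsin Hcos)
  as [r0 [Hr0 H]].
- replace C0 with (Csub w w) by ring. apply lim0_sub; auto.
- replace C0 with (Csub w' w') by ring. apply lim0_sub; auto.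
- exists r0; split; auto. intros r phi Hr Hp. destruct (H r phi Hr Hp) as [E1 E2].
  split.
  + replace (v r phi) with (Cadd (Csub (v r phi) (v' r phi)) (v' r phi)) by ring. rewrite E1; ring.
  + replace (u r phi) with (Cadd (Csub (u r phi) (u' r phi)) (u' r phi)) by ring. rewrite E2; ring.
Qed.

(** * Fourier coefficients of single-valued solutions *)

Definition circ_int (f : R -> Cplx) : Cplx :=
  (RInt (fun t => fst (f t)) 0 (2 * PI), RInt (fun t => snd (f t)) 0 (2 * PI)).

Definition circ_cont (f : R -> Cplx) : Prop := forall t, 0 <= t <= 2 * PI ->
  continuous (fun t => fst (f t)) t /\ continuous (fun t => snd (f t)) t.

Lemma two_PI_pos : 0 < 2 * PI.
Proof. generalize PI_RGT_0. lra. Qed.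

Lemma circ_cont_int f : circ_cont f ->
  ex_RInt (fun t => fst (f t)) 0 (2 * PI) /\ ex_RInt (fun t => snd (f t)) 0 (2 * PI).
Proof.
intros H. generalize two_PI_pos. intros.
split; apply @ex_RInt_continuous; intros t; rewrite Rmin_left, Rmax_right by lra;
 intros Ht; apply (H t); auto.
Qed.

Lemma circ_cont_CD f d : (forall t, 0 <= t <= 2 * PI -> CD f t (d t)) -> circ_cont f.
Proof.
intros H t Ht. destruct (H t Ht) as [H1 H2]. split.
- apply @ex_derive_continuous. eexists; exact H1.
- apply @ex_derive_continuous. eexists; exact H2.
Qed.

Lemma circ_cont_add f g : circ_cont f -> circ_cont g -> circ_cont (fun t => Cadd (f t) (g t)).
Proof.
intros Hf Hg t Ht. destruct (Hf t Ht), (Hg t Ht). split; simpl.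
- apply @continuous_plus; auto.
- apply @continuous_plus; auto.
Qed.

Lemma circ_cont_mul f g : circ_cont f -> circ_cont g -> circ_cont (fun t => Cmul (f t) (g t)).
Proof.
intros Hf Hg t Ht. destruct (Hf t Ht), (Hg t Ht). split; simpl.
- apply @continuous_minus; apply @continuous_mult; auto.
- apply @continuous_plus; apply @continuous_mult; auto.
Qed.

Lemma circ_cont_const c : circ_cont (fun _ => c).
Proof. intros t Ht. split; apply continuous_const. Qed.

Lemma circ_int_add f g : circ_cont f -> circ_cont g ->
  circ_int (fun t => Cadd (f t) (g t)) = Cadd (circ_int f) (circ_int g).
Proof.
intros Hf Hg. apply circ_cont_int in Hf. apply circ_cont_int in Hg.
destruct Hf, Hg. unfold circ_int. apply Cplx_ext; simpl; apply @RInt_plus; auto.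
Qed.

Lemma circ_int_scal c f : circ_cont f ->
  circ_int (fun t => Cmul c (f t)) = Cmul c (circ_int f).
Proof.
intros Hf. apply circ_cont_int in Hf. destruct Hf as [H1 H2].
apply Cplx_ext; simpl; apply is_RInt_unique.
- apply (is_RInt_minus (V := R_NormedModule)); apply (is_RInt_scal (V := R_NormedModule));
    apply (RInt_correct (V := R_CompleteNormedModule)); auto.
- apply (is_RInt_plus (V := R_NormedModule)); apply (is_RInt_scal (V := R_NormedModule));
    apply (RInt_correct (V := R_CompleteNormedModule)); auto.
Qed.

Lemma circ_int_ext f g : (forall t, f t = g t) -> circ_int f = circ_int g.
Proof.
intros H. unfold circ_int. f_equal; apply RInt_ext; intros; rewrite H; auto.
Qed.

Lemma circ_int_derive F F' : (forall t, 0 <= t <= 2 * PI -> CD F t (F' t)) -> circ_cont F' ->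
  F 0 = F (2 * PI) -> circ_int F' = C0.
Proof.
intros Hd Hc E. generalize two_PI_pos; intros HP.
apply Cplx_ext; simpl; apply is_RInt_unique.
- replace 0 with (minus (fst (F (2 * PI))) (fst (F 0))) at 2.
  2:{ rewrite E. unfold minus, plus, opp; simpl. ring. }
  apply (is_RInt_derive (fun t => fst (F t)) (fun t => fst (F' t)));
   intros t; rewrite Rmin_left, Rmax_right by lra; intros Ht.
  apply (Hd t Ht). apply (Hc t Ht).
- replace 0 with (minus (snd (F (2 * PI))) (snd (F 0))) at 2.
  2:{ rewrite E. unfold minus, plus, opp; simpl. ring. }
  apply (is_RInt_derive (fun t => snd (F t)) (fun t => snd (F' t)));
   intros t; rewrite Rmin_left, Rmax_right by lra; intros Ht.
  apply (Hd t Ht). apply (Hc t Ht).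
Qed.

Lemma circ_int_bound f B : circ_cont f -> (forall t, 0 <= t <= 2 * PI -> Cnorm (f t) <= B) ->
  Rabs (fst (circ_int f)) <= 2 * PI * B /\ Rabs (snd (circ_int f)) <= 2 * PI * B.
Proof.
intros Hc HB. apply circ_cont_int in Hc. destruct Hc. generalize two_PI_pos; intros.
simpl. split.
- replace (2 * PI * B) with ((2 * PI - 0) * B) by ring. apply abs_RInt_le_const; auto. lra.
  intros t Ht. apply Rle_trans with (1 := Cnorm_fst _). auto.
- replace (2 * PI * B) with ((2 * PI - 0) * B) by ring. apply abs_RInt_le_const; auto. lra.
  intros t Ht. apply Rle_trans with (1 := Cnorm_snd _). auto.
Qed.

(** [e^(- i nu t)] for real [nu]; integrality of the index is expressed by [periodic_char]. *)
Definition char (nu t : R) : Cplx := (cos (nu * t), - sin (nu * t)).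

Lemma CD_char nu t : CD (char nu) t (Cmul (0, - nu) (char nu t)).
Proof. split; simpl; auto_derive; auto; ring. Qed.

Lemma Cnorm_char nu t : Cnorm (char nu t) = 1.
Proof.
unfold Cnorm, char. simpl.
replace (_ + _) with (Rsqr (sin (nu * t)) + Rsqr (cos (nu * t))) by (unfold Rsqr; ring).
rewrite sin2_cos2. apply sqrt_1.
Qed.

Lemma polar_char r nu t : Cmul (polar r t) (char nu t) = Cmul (RtoC r) (char (nu - 1) t).
Proof.
unfold char. replace ((nu - 1) * t) with (nu * t - t) by ring. rewrite cos_minus, sin_minus. Cring.
Qed.

Lemma polar_inv_char r nu t : 0 < r ->
  Cmul (Cinv (polar r t)) (char nu t) = Cmul (RtoC (/ r)) (char (nu + 1) t).
Proof.
intros Hr.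
replace (Cinv (polar r t)) with (Cmul (RtoC (/ r)) (cos t, - sin t)).
2:{ apply Cplx_ext; simpl;
    replace (r * cos t * (r * cos t * 1) + r * sin t * (r * sin t * 1)) with (r * r)
    by (transitivity (r * r * (Rsqr (sin t) + Rsqr (cos t)));
        [rewrite sin2_cos2; ring | unfold Rsqr; ring]); field; lra. }
unfold char. replace ((nu + 1) * t) with (nu * t + t) by ring. rewrite cos_plus, sin_plus. Cring.
Qed.

(** Not divided by [2 PI]. *)
Definition fourier (f : R -> Cplx) (nu : R) : Cplx := circ_int (fun t => Cmul (f t) (char nu t)).

Lemma circ_cont_char nu : circ_cont (char nu).
Proof. apply circ_cont_CD with (fun t => Cmul (0, - nu) (char nu t)). intros; apply CD_char. Qed.

Ltac circ_cont_tac := repeat match goal with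
  | |- circ_cont (fun t => Cadd (@?f t) (@?g t)) => apply (circ_cont_add f g)
  | |- circ_cont (fun t => Cmul (@?f t) (@?g t)) => apply (circ_cont_mul f g)
  | |- circ_cont (fun _ => ?c) => exact (circ_cont_const c)
  | |- circ_cont (char ?nu) => exact (circ_cont_char nu)
  | |- circ_cont (fun t => char ?nu t) => exact (circ_cont_char nu)
  | |- circ_cont _ => assumption
  end.

Definition periodic_char nu := char nu (2 * PI) = C1.

Lemma periodic_char_INR n : periodic_char (INR n).
Proof.
unfold periodic_char, char.
replace (INR n * (2 * PI)) with (0 + 2 * INR n * PI) by ring.
rewrite cos_period, sin_period, cos_0, sin_0. unfold C1. f_equal; ring.
Qed.

Lemma periodic_char_m1 : periodic_char (-1).
Proof.
unfold periodic_char, char.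
replace (-1 * (2 * PI)) with (- (2 * PI)) by ring.
rewrite cos_neg, sin_neg, cos_2PI, sin_2PI. unfold C1. f_equal; ring.
Qed.

Lemma char_0 nu : char nu 0 = C1.
Proof. unfold char. rewrite Rmult_0_r, cos_0, sin_0. unfold C1; f_equal; ring. Qed.

Lemma polsol_cont q L M a b v u r : polsol q L M a b v u -> a < 0 -> 2 * PI < b -> 0 < r ->
  circ_cont (v r) /\ circ_cont (u r).
Proof.
intros Hs Ha Hb Hr. split.
- eapply circ_cont_CD. intros t Ht. exact (proj1 (proj1 (Hs r t Hr ltac:(lra)))).
- eapply circ_cont_CD. intros t Ht. exact (proj2 (proj1 (Hs r t Hr ltac:(lra)))).
Qed.

(** Integration by parts over the circle, with boundary terms cancelling by single-valuedness. *)
Lemma fourier_v q L M a b v u r nu : polsol q L M a b v u -> a < 0 -> 2 * PI < b -> 0 < r ->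
  v r 0 = v r (2 * PI) -> periodic_char nu ->
  Cmul (RtoC nu) (fourier (v r) nu) = Cmul (0, - q) (fourier (u r) nu).
Proof.
intros Hs Ha Hb Hr Hp Hnu. destruct (polsol_cont _ _ _ _ _ _ _ r Hs Ha Hb Hr) as [Cv Cu].
assert (E : circ_int (fun t => Cadd (Cmul (RtoC q) (Cmul (u r t) (char nu t)))
                 (Cmul (0, - nu) (Cmul (v r t) (char nu t)))) = C0).
{ apply circ_int_derive with (fun t => Cmul (v r t) (char nu t)).
  - intros t Ht. eapply CD_ext. eapply CD_mul. exact (proj1 (proj1 (Hs r t Hr ltac:(lra)))). apply CD_char. ring.
  - circ_cont_tac.
  - rewrite Hnu, char_0, Hp. auto. }
rewrite circ_int_add, !circ_int_scal in E
  by circ_cont_tac.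
fold (fourier (u r) nu) (fourier (v r) nu) in E.
replace (0, - nu) with (Cmul (Copp Ci) (RtoC nu)) in E by Cring.
replace (0, - q) with (Cmul (Copp Ci) (RtoC q)) by Cring.
assert (Ci2 : Cmul Ci Ci = Copp C1) by Cring.
transitivity (Cadd (Cmul Ci (Cadd (Cmul (RtoC q) (fourier (u r) nu)) (Cmul (Cmul (Copp Ci) (RtoC nu)) (fourier (v r) nu)))) (Cmul (Cmul (Copp Ci) (RtoC q)) (fourier (u r) nu))).
2: rewrite E; ring.
transitivity (Cmul (Copp (Cmul Ci Ci)) (Cmul (RtoC nu) (fourier (v r) nu))). rewrite Ci2; ring.
ring.
Qed.

(** Again by parts; the factors [z] and [1/z] of the coefficient shift the index by one. *)
Lemma fourier_u q L M a b v u r nu : polsol q L M a b v u -> a < 0 -> 2 * PI < b -> 0 < r ->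
  u r 0 = u r (2 * PI) -> periodic_char nu ->
  Cmul (0, - q) (fourier (v r) nu) =
  Cadd (Cmul (RtoC (L + nu)) (fourier (u r) nu))
   (Cmul (RtoC M) (Cadd (Cmul (RtoC r) (fourier (u r) (nu - 1)))
                        (Cmul (RtoC (/ r)) (fourier (u r) (nu + 1))))).
Proof.
intros Hs Ha Hb Hr Hp Hnu. destruct (polsol_cont _ _ _ _ _ _ _ r Hs Ha Hb Hr) as [Cv Cu].
set (g := fun t => Cmul Ci (Cadd (Cmul (0, - q) (Cmul (v r t) (char nu t)))
   (Cadd (Cmul (RtoC (- (L + nu))) (Cmul (u r t) (char nu t)))
   (Cadd (Cmul (RtoC (- (M * r))) (Cmul (u r t) (char (nu - 1) t)))
         (Cmul (RtoC (- (M * / r))) (Cmul (u r t) (char (nu + 1) t))))))).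
assert (E : circ_int g = C0).
{ apply circ_int_derive with (fun t => Cmul (u r t) (char nu t)).
  - intros t Ht. eapply CD_ext. eapply CD_mul. exact (proj2 (proj1 (Hs r t Hr ltac:(lra)))). apply CD_char.
    unfold g, theta_u.
    generalize (polar_char r nu t) (polar_inv_char r nu t Hr).
    generalize (polar r t). intros z E1 E2.
    replace (RtoC (- (M * r))) with (Copp (Cmul (RtoC M) (RtoC r))) by Cring.
    replace (RtoC (- (M * / r))) with (Copp (Cmul (RtoC M) (RtoC (/ r)))) by Cring.
    replace (RtoC (- (L + nu))) with (Copp (Cadd (RtoC L) (RtoC nu))) by Cring.
    replace (0, - nu) with (Copp (Cmul Ci (RtoC nu))) by Cring.
    transitivity (Cmul Ci (Cadd (Cmul (0, - q) (Cmul (v r t) (char nu t)))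
   (Cadd (Cmul (Copp (Cadd (RtoC L) (RtoC nu))) (Cmul (u r t) (char nu t)))
   (Cmul (Copp (RtoC M)) (Cmul (u r t) (Cadd (Cmul z (char nu t)) (Cmul (Cinv z) (char nu t)))))))).
    ring. rewrite E1, E2. ring.
  - unfold g. circ_cont_tac.
  - rewrite Hnu, char_0, Hp. auto. }
unfold g in E.
rewrite circ_int_scal, !circ_int_add, !circ_int_scal in E
  by circ_cont_tac.
fold (fourier (u r) nu) (fourier (v r) nu) (fourier (u r) (nu - 1)) (fourier (u r) (nu + 1)) in E.
revert E. generalize (fourier (u r) nu) (fourier (v r) nu) (fourier (u r) (nu - 1)) (fourier (u r) (nu + 1)).
intros [a1 a2] [b1 b2] [c1 c2] [d1 d2] E. injection E. intros E1 E2.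
apply Cplx_ext; simpl in *; lra.
Qed.

(** [fourier_v] eliminates [u]. Its imaginary factor pairs real parts for [v] with imaginary parts
    for [u], so the real parts for [v] close up by themselves. *)
Lemma fourier_rec q L M a b v u r nu : q <> 0 -> polsol q L M a b v u -> a < 0 -> 2 * PI < b -> 0 < r ->
  v r 0 = v r (2 * PI) -> u r 0 = u r (2 * PI) ->
  periodic_char nu -> periodic_char (nu - 1) -> periodic_char (nu + 1) ->
  (nu * nu + L * nu + q ^ 2) * fst (fourier (v r) nu)
  + M * (r * (nu - 1) * fst (fourier (v r) (nu - 1))
         + / r * (nu + 1) * fst (fourier (v r) (nu + 1))) = 0.
Proof.
intros Hq Hs Ha Hb Hr Hp Hp' N0 N1 N2.
generalize (fourier_u _ _ _ _ _ _ _ r nu Hs Ha Hb Hr Hp' N0).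
generalize (fourier_v _ _ _ _ _ _ _ r nu Hs Ha Hb Hr Hp N0).
generalize (fourier_v _ _ _ _ _ _ _ r (nu - 1) Hs Ha Hb Hr Hp N1).
generalize (fourier_v _ _ _ _ _ _ _ r (nu + 1) Hs Ha Hb Hr Hp N2).
destruct (fourier (u r) nu) as [x1 x2], (fourier (v r) nu) as [y1 y2],
 (fourier (u r) (nu - 1)) as [x3 x4], (fourier (u r) (nu + 1)) as [x5 x6],
 (fourier (v r) (nu - 1)) as [y3 y4], (fourier (v r) (nu + 1)) as [y5 y6].
intros E1 E2 E3 E4.
apply (f_equal fst) in E1. apply (f_equal fst) in E2. apply (f_equal fst) in E3.
apply (f_equal snd) in E4. simpl in *.
assert (F1 : (nu + 1) * y5 = q * x6) by lra. assert (F2 : (nu - 1) * y3 = q * x4) by lra.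
assert (F3 : nu * y1 = q * x2) by lra.
assert (F4 : (L + nu) * x2 + M * (r * x4 + / r * x6) = - q * y1) by lra.
transitivity ((L + nu) * (nu * y1) + q * q * y1 + M * (r * ((nu - 1) * y3) + / r * ((nu + 1) * y5))).
ring. rewrite F1, F2, F3.
transitivity (q * ((L + nu) * x2 + M * (r * x4 + / r * x6)) + q * q * y1). ring.
rewrite F4. ring.
Qed.

(** The continuity that differentiation under the integral sign requires. *)
Definition jcont (a b : R) (f : R -> R -> Cplx) : Prop := forall r t, 0 < r -> a < t < b ->
  continuity_2d_pt (fun r t => fst (f r t)) r t /\ continuity_2d_pt (fun r t => snd (f r t)) r t.

(** The radial derivative brings in the coefficient of [u], which [fourier_v] turns back into [nu]
    times that of [v]. Hence the coefficient of index [nu] is a constant times [r^nu]. *)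
Lemma fourier_mod_derive q L M a b v u r nu : polsol q L M a b v u -> jcont a b u ->
  a < 0 -> 2 * PI < b -> 0 < r -> v r 0 = v r (2 * PI) -> periodic_char nu ->
  CD (fun s => fourier (v s) nu) r (Cmul (RtoC (nu / r)) (fourier (v r) nu)).
Proof.
intros Hs Hj Ha Hb Hr Hp Hnu.
destruct (polsol_cont _ _ _ _ _ _ _ r Hs Ha Hb Hr) as [Cv Cu].
generalize two_PI_pos; intros HP.
assert (Loc : locally r (fun s => 0 < s)) by (apply (open_gt 0); auto).
set (d := fun s t => Cmul (RtoC (/ s)) (Cmul (0, - q) (Cmul (u s t) (char nu t)))).
assert (Hd : forall s t, 0 < s -> a < t < b ->
  CD (fun s => Cmul (v s t) (char nu t)) s (d s t)).
{ intros s t H0 Ht. eapply CD_ext. eapply (CD_mul (fun s => v s t) (fun _ => char nu t) s _ C0).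
  exact (proj1 (proj2 (Hs s t H0 Ht))).
  split; apply @is_derive_const. unfold d. ring. }
assert (Hint : forall s, 0 < s -> circ_cont (fun t => Cmul (v s t) (char nu t))).
{ intros s H0. apply circ_cont_mul. apply (polsol_cont _ _ _ _ _ _ _ s Hs Ha Hb H0).
  apply circ_cont_char. }
assert (Hc : forall t, 0 <= t <= 2 * PI ->
  continuity_2d_pt (fun s t => fst (d s t)) r t /\ continuity_2d_pt (fun s t => snd (d s t)) r t).
{ intros t Ht. destruct (Hj r t Hr ltac:(lra)) as [J1 J2].
  assert (Ci' : continuity_2d_pt (fun s _ => / s) r t).
  { apply continuity_2d_pt_inv. apply continuity_2d_pt_id1. lra. }
  assert (Cc : continuity_2d_pt (fun _ t => cos (nu * t)) r t).
  { apply (continuity_1d_2d_pt_comp cos (fun _ t => nu * t)).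
    apply continuity_cos.
    apply continuity_2d_pt_mult. apply continuity_2d_pt_const. apply continuity_2d_pt_id2. }
  assert (Cs : continuity_2d_pt (fun _ t => sin (nu * t)) r t).
  { apply (continuity_1d_2d_pt_comp sin (fun _ t => nu * t)).
    apply continuity_sin.
    apply continuity_2d_pt_mult. apply continuity_2d_pt_const. apply continuity_2d_pt_id2. }
  split.
  - apply continuity_2d_pt_ext with (fun s t => / s * (q * (snd (u s t) * cos (nu * t) - fst (u s t) * sin (nu * t)))).
    intros; simpl; ring.
    repeat first [assumption | apply continuity_2d_pt_mult | apply continuity_2d_pt_minus | apply continuity_2d_pt_const].
  - apply continuity_2d_pt_ext with (fun s t => / s * (- q * (snd (u s t) * sin (nu * t) + fst (u s t) * cos (nu * t)))).
    intros; simpl; ring.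
    repeat first [assumption | apply continuity_2d_pt_mult | apply continuity_2d_pt_plus | apply continuity_2d_pt_const]. }
assert (Key : forall pr : Cplx -> R, pr = fst \/ pr = snd ->
  is_derive (fun s => RInt (fun t => pr (Cmul (v s t) (char nu t))) 0 (2 * PI)) r
   (RInt (fun t => pr (d r t)) 0 (2 * PI))).
{ intros pr Hpr.
  assert (Hd' : forall s t, 0 < s -> a < t < b -> is_derive (fun s => pr (Cmul (v s t) (char nu t))) s (pr (d s t))).
  { intros s t H0 Ht. destruct (Hd s t H0 Ht), Hpr; subst; auto. }
  evar_last.
  apply (is_derive_RInt_param (fun s t => pr (Cmul (v s t) (char nu t)))).
  - apply filter_imp with (2 := Loc). intros s H0 t. rewrite Rmin_left, Rmax_right by lra. intros Ht.
    eexists; apply Hd'; auto. lra.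
  - intros t. rewrite Rmin_left, Rmax_right by lra. intros Ht.
    apply continuity_2d_pt_ext_loc with (fun s t => pr (d s t)).
    + assert (Hdel : 0 < Rmin r (Rmin (t - a) (b - t))) by (repeat apply Rmin_pos; lra).
      exists (mkposreal _ Hdel). simpl. intros s t' H1 H2.
      generalize (Rmin_l r (Rmin (t - a) (b - t))) (Rmin_r r (Rmin (t - a) (b - t)))
        (Rmin_l (t - a) (b - t)) (Rmin_r (t - a) (b - t)). intros.
      apply Rabs_lt_between in H1. apply Rabs_lt_between in H2.
      symmetry. apply is_derive_unique. apply Hd'; lra.
    + destruct (Hc t Ht), Hpr; subst; auto.
  - apply filter_imp with (2 := Loc). intros s H0. specialize (Hint s H0).
    apply circ_cont_int in Hint. destruct Hpr; subst; apply Hint.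
  - apply RInt_ext. intros t. rewrite Rmin_left, Rmax_right by lra. intros Ht.
    apply is_derive_unique. apply Hd'; auto. lra. }
apply CD_ext with (circ_int (d r)).
- split; apply Key; auto.
- unfold d. rewrite circ_int_scal, circ_int_scal
    by circ_cont_tac.
  fold (fourier (u r) nu). rewrite <- (fourier_v _ _ _ _ _ _ _ r nu Hs Ha Hb Hr Hp Hnu).
  replace (RtoC (nu / r)) with (Cmul (RtoC (/ r)) (RtoC nu))
    by (apply Cplx_ext; simpl; unfold Rdiv; ring). ring.
Qed.

Lemma derive_zero_const f x y : 0 < x -> 0 < y -> (forall t, 0 < t -> is_derive f t 0) -> f x = f y.
Proof.
intros Hx Hy H. destruct (MVT_gen f x y (fun _ => 0)) as [c [_ E]].
- intros t Ht. apply H. apply Rlt_trans with (2 := proj1 Ht). apply Rmin_pos; auto.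
- intros t Ht. apply continuity_pt_filterlim, (@ex_derive_continuous R_AbsRing R_NormedModule). exists 0. apply H.
  apply Rlt_le_trans with (2 := proj1 Ht). apply Rmin_pos; auto.
- lra.
Qed.

Definition ulim0 (f : R -> R -> Cplx) (w : Cplx) : Prop :=
  forall eps, 0 < eps -> exists delta, 0 < delta /\ forall r t, 0 < r < delta -> 0 <= t <= 2 * PI -> Cnorm (Csub (f r t) w) < eps.

Lemma Cnorm_C1 : Cnorm C1 = 1.
Proof. change (Cnorm (RtoC 1) = 1). rewrite Cnorm_R, Rabs_R1. auto. Qed.

(** At index 0 the coefficient does not depend on [r], so it equals its limit at 0. *)
Lemma fourier_mean q L M a b v u r : polsol q L M a b v u -> jcont a b u ->
  a < 0 -> 2 * PI < b -> (forall r, 0 < r -> v r 0 = v r (2 * PI)) ->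
  ulim0 v C1 -> 0 < r -> fst (fourier (v r) 0) = 2 * PI.
Proof.
intros Hs Hj Ha Hb Hp Hl Hr. generalize two_PI_pos; intros HP.
assert (Hconst : forall s, 0 < s -> fst (fourier (v s) 0) = fst (fourier (v r) 0)).
{ intros s H0. apply (derive_zero_const (fun s => fst (fourier (v s) 0))); auto. intros t Ht.
  evar_last. exact (proj1 (fourier_mod_derive _ _ _ _ _ _ _ t 0 Hs Hj Ha Hb Ht (Hp t Ht) (periodic_char_INR 0))).
  simpl. field. lra. }
assert (Hm : Rabs (fst (fourier (v r) 0) - 2 * PI) <= 0).
2:{ apply Rabs_le_between in Hm. lra. }
apply Rnot_lt_le. intros Hlt.
destruct (Hl (Rabs (fst (fourier (v r) 0) - 2 * PI) / (2 * (2 * PI)))) as [d [Hd Hd']].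
  apply Rdiv_lt_0_compat; lra.
assert (Hd2 : 0 < d / 2) by lra.
destruct (polsol_cont _ _ _ _ _ _ _ (d / 2) Hs Ha Hb Hd2) as [Cv Cu].
assert (B := circ_int_bound (fun t => Cmul (Cadd (v (d / 2) t) (Copp C1)) (char 0 t))
  (Rabs (fst (fourier (v r) 0) - 2 * PI) / (2 * (2 * PI)))).
destruct B as [B _].
- circ_cont_tac.
- intros t Ht. rewrite Cnorm_mul, Cnorm_char, Rmult_1_r. left. apply Hd'; auto. lra.
- revert B.
  rewrite (circ_int_ext _ (fun t => Cadd (Cmul (v (d / 2) t) (char 0 t)) (Cmul (Copp C1) (char 0 t)))) by (intros; ring).
  rewrite circ_int_add by circ_cont_tac.
  rewrite circ_int_scal by apply circ_cont_char.
  fold (fourier (v (d / 2)) 0).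
  replace (circ_int (char 0)) with (RtoC (2 * PI)).
  2:{ apply Cplx_ext; unfold circ_int, char, RtoC; cbn [fst snd]; symmetry.
      - rewrite (RInt_ext _ (fun _ => 1)). rewrite RInt_const. unfold scal; simpl; unfold mult; simpl; ring.
        intros; simpl. rewrite Rmult_0_l. apply cos_0.
      - rewrite (RInt_ext _ (fun _ => 0)). rewrite RInt_const. unfold scal; simpl; unfold mult; simpl; ring.
        intros; simpl. rewrite Rmult_0_l, sin_0. ring. }
  cbn [fst snd Cadd Cmul Copp C1 RtoC]. rewrite (Hconst (d / 2)) by auto.
  replace (fst (fourier (v r) 0) + (- (1) * (2 * PI) - - 0 * 0)) with (fst (fourier (v r) 0) - 2 * PI) by ring.
  replace (2 * PI * (Rabs (fst (fourier (v r) 0) - 2 * PI) / (2 * (2 * PI)))) with (Rabs (fst (fourier (v r) 0) - 2 * PI) / 2) by (field; lra).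
  lra.
Qed.

(** A nonzero multiple of [1 / r] would be unbounded at 0. Row 0 of the recurrence reaches this
    negative index and no other. *)
Lemma fourier_m1 q L M a b v u r : polsol q L M a b v u -> jcont a b u ->
  a < 0 -> 2 * PI < b -> (forall r, 0 < r -> v r 0 = v r (2 * PI)) ->
  ulim0 v C1 -> 0 < r -> fst (fourier (v r) (-1)) = 0.
Proof.
intros Hs Hj Ha Hb Hp Hl Hr. generalize two_PI_pos; intros HP.
assert (Hconst : forall s, 0 < s -> s * fst (fourier (v s) (-1)) = r * fst (fourier (v r) (-1))).
{ intros s H0. apply (derive_zero_const (fun s => s * fst (fourier (v s) (-1)))); auto. intros t Ht.
  evar_last. apply (is_derive_mult (fun s => s) (fun s => fst (fourier (v s) (-1)))).
  apply @is_derive_id.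
  exact (proj1 (fourier_mod_derive _ _ _ _ _ _ _ t (-1) Hs Hj Ha Hb Ht (Hp t Ht) periodic_char_m1)).
  unfold one; simpl. field. lra. }
destruct (Hl 1) as [d [Hd Hd']]. lra.
destruct (Req_dec (fst (fourier (v r) (-1))) 0) as [|Hne]; auto. exfalso.
apply Rabs_pos_lt in Hne.
set (X := r * Rabs (fst (fourier (v r) (-1)))).
assert (HX : 0 < X) by (apply Rmult_lt_0_compat; auto).
(* Here [|v| <= 2], so [s] times the coefficient has modulus at most [4 PI s <= X / 2], although it
   should equal [X]. *)
set (s := Rmin (d / 2) (X / (8 * PI))).
assert (Hs0 : 0 < s) by (apply Rmin_pos; [lra | apply Rdiv_lt_0_compat; lra]).
assert (s1 : s <= d / 2) by apply Rmin_l.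
assert (s2 : s <= X / (8 * PI)) by apply Rmin_r.
destruct (polsol_cont _ _ _ _ _ _ _ s Hs Ha Hb Hs0) as [Cv Cu].
destruct (circ_int_bound (fun t => Cmul (v s t) (char (-1) t)) 2) as [B _].
- circ_cont_tac.
- intros t Ht. rewrite Cnorm_mul, Cnorm_char, Rmult_1_r.
  specialize (Hd' s t ltac:(lra) Ht).
  replace (v s t) with (Cadd (Csub (v s t) C1) C1) by ring.
  apply Rle_trans with (1 := Cnorm_triang _ _). rewrite Cnorm_C1. lra.
- fold (fourier (v s) (-1)) in B.
  assert (E : s * Rabs (fst (fourier (v s) (-1))) = X).
  { unfold X. rewrite <- (Rabs_right s) at 1 by lra. rewrite <- (Rabs_right r) at 1 by lra.
    rewrite <- !Rabs_mult. f_equal. auto. }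
  assert (s * (8 * PI) <= X).
  { apply Rmult_le_compat_r with (r := 8 * PI) in s2. 2: lra. unfold Rdiv in s2.
    rewrite Rmult_assoc, Rinv_l, Rmult_1_r in s2; lra. }
  nra.
Qed.

(** On a fixed circle the coefficients divided by [r^n] satisfy the recurrence of [lsol]. Bounding
    them by the maximum on that circle is Cauchy's estimate, and [r] is arbitrary. *)
Lemma entire_of_polsol q L M a b v u : q <> 0 -> M <> 0 -> polsol q L M a b v u -> jcont a b u ->
  a < 0 -> 2 * PI < b ->
  (forall r, 0 < r -> v r 0 = v r (2 * PI)) -> (forall r, 0 < r -> u r 0 = u r (2 * PI)) ->
  ulim0 v C1 -> entire (lsol L M (q ^ 2)).
Proof.
intros Hq HM Hs Hj Ha Hb Hp Hp' Hl r Hr. generalize two_PI_pos; intros HP.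
set (f := fun n => fst (fourier (v r) (INR n)) / r ^ n).
assert (Hrn : forall n, r ^ n <> 0) by (intros; apply pow_nonzero; lra).
assert (F : forall n, fst (fourier (v r) (INR n)) = f n * r ^ n).
{ intros n. unfold f. field. auto. }
assert (Hf : forall n, f n = 2 * PI * lsol L M (q ^ 2) n).
{ assert (f0 : f 0%nat = 2 * PI).
  { unfold f. change (INR 0) with 0. rewrite pow_O. rewrite (fourier_mean q L M a b v u r); auto. field. }
  rewrite <- f0. unfold lsol. apply heun_unique; auto. intros [|m].
  - assert (E := fourier_rec q L M a b v u r 0 Hq Hs Ha Hb Hr (Hp r Hr) (Hp' r Hr)
      (periodic_char_INR 0)).
    replace (0 - 1) with (-1) in E by ring. replace (0 + 1) with (INR 1) in E by (simpl; ring).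
    specialize (E periodic_char_m1 (periodic_char_INR 1)).
    rewrite (fourier_m1 q L M a b v u r) in E by auto.
    change 0 with (INR 0) in E at 4. rewrite !F in E. rewrite heun_0.
    simpl in E. rewrite <- E. field. lra.
  - assert (E := fourier_rec q L M a b v u r (INR (S m)) Hq Hs Ha Hb Hr (Hp r Hr) (Hp' r Hr)
      (periodic_char_INR (S m))).
    replace (INR (S m) - 1) with (INR m) in E by (rewrite S_INR; ring).
    replace (INR (S m) + 1) with (INR (S (S m))) in E by (rewrite (S_INR (S m)); ring).
    specialize (E (periodic_char_INR m) (periodic_char_INR (S (S m)))).
    rewrite !F in E. rewrite heun_S.
    apply Rmult_eq_reg_r with (r ^ S m); auto. rewrite Rmult_0_l.
    transitivity ((INR (S m) * INR (S m) + L * INR (S m) + q ^ 2) * (f (S m) * r ^ S m) +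
     M * (r * INR m * (f m * r ^ m) + / r * INR (S (S m)) * (f (S (S m)) * r ^ S (S m)))); auto.
    rewrite !S_INR. simpl (r ^ S _). field. lra. }
destruct (polsol_cont _ _ _ _ _ _ _ r Hs Ha Hb Hr) as [Cv Cu].
destruct (continuity_ab_maj (fun t => Rabs (fst (v r t)) + Rabs (snd (v r t))) 0 (2 * PI)) as [tm [Htm _]].
  lra.
{ intros t Ht. destruct (Cv t Ht) as [c1 c2]. apply continuity_pt_filterlim.
  apply (continuous_plus (V := R_NormedModule) (fun t => Rabs (fst (v r t))) (fun t => Rabs (snd (v r t)))).
  exact (continuous_comp (fun t => fst (v r t)) Rabs t c1 (proj1 (continuity_pt_filterlim _ _) (Rcontinuity_abs _))).
  exact (continuous_comp (fun t => snd (v r t)) Rabs t c2 (proj1 (continuity_pt_filterlim _ _) (Rcontinuity_abs _))). }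
set (B := Rabs (fst (v r tm)) + Rabs (snd (v r tm))) in *.
exists B. intros n.
destruct (circ_int_bound (fun t => Cmul (v r t) (char (INR n) t)) B) as [Bn _].
- circ_cont_tac.
- intros t Ht. rewrite Cnorm_mul, Cnorm_char, Rmult_1_r.
  apply Rle_trans with (1 := Cnorm_le _). apply (Htm t Ht).
- fold (fourier (v r) (INR n)) in Bn. rewrite F, Hf, !Rabs_mult in Bn.
  rewrite (Rabs_right PI), (Rabs_right 2), (Rabs_right (r ^ n)) in Bn
   by (try lra; apply Rle_ge, pow_le; lra).
  apply Rmult_le_reg_l with (2 * PI); lra.
Qed.

(** * Convergent series solutions *)

Lemma entire_ex_series a c r : entire a -> 0 < r -> (forall n, Rabs (c n) <= 1) ->
  ex_series (fun n => a n * r ^ n * c n).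
Proof.
intros Ha Hr Hc. destruct (Ha (2 * r)) as [K HK]. lra.
apply (ex_series_le (K := R_AbsRing) (V := R_CompleteNormedModule) _ (fun n => K * (/ 2) ^ n)).
- intros n. unfold norm; simpl. unfold abs; simpl. rewrite !Rabs_mult.
  rewrite (Rabs_right (r ^ n)) by (apply Rle_ge, pow_le; lra).
  apply Rle_trans with (Rabs (a n) * r ^ n * 1).
  apply Rmult_le_compat_l; auto. apply Rmult_le_pos. apply Rabs_pos. apply pow_le; lra.
  rewrite Rmult_1_r, pow_inv. specialize (HK n). rewrite Rpow_mult_distr in HK.
  assert (0 < 2 ^ n) by (apply pow_lt; lra).
  apply Rmult_le_reg_r with (2 ^ n); auto. rewrite (Rmult_assoc K), Rinv_l by lra. lra.
- apply (ex_series_scal (V := R_NormedModule)). apply ex_series_geom. rewrite Rabs_right; lra.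
Qed.

(** Quadratic remainders whose constants [B n] are summable reduce termwise differentiation to a
    single estimate. *)
Lemma is_derive_Series f f' B x :
  (forall n h, Rabs (f n (x + h) - f n x - h * f' n) <= B n * h ^ 2) -> ex_series B ->
  (forall t, ex_series (fun n => f n t)) -> ex_series f' ->
  is_derive (fun t => Series (fun n => f n t)) x (Series f').
Proof.
intros HB Be Hf Hf'. apply is_derive_eps. intros eps He.
set (S := Rabs (Series B) + 1).
assert (HS : 0 < S) by (unfold S; generalize (Rabs_pos (Series B)); lra).
exists (eps / S). split. apply Rdiv_lt_0_compat; auto.
intros h Hh.
rewrite <- Series_scal_l, <- !Series_minus; auto.
2:{ apply (ex_series_minus (V := R_NormedModule)); auto. }
2:{ apply (ex_series_scal (V := R_NormedModule)); auto. }
assert (Ex : ex_series (fun n => B n * h ^ 2)).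
{ apply ex_series_ext with (fun n => h ^ 2 * B n). intros; apply Rmult_comm.
  apply (ex_series_scal (V := R_NormedModule)); auto. }
apply Rle_trans with (Series (fun n => B n * h ^ 2)).
- apply Rle_trans with (Series (fun n => Rabs (f n (x + h) - f n x - h * f' n))).
  apply Series_Rabs.
  apply (ex_series_le (K := R_AbsRing) (V := R_CompleteNormedModule)) with (2 := Ex).
  intros n. unfold norm; simpl; unfold abs; simpl. rewrite Rabs_Rabsolu. auto.
  apply Series_le; auto. intros n; split. apply Rabs_pos. auto.
- rewrite Series_scal_r, <- (pow2_abs h).
  apply Rle_trans with (S * (Rabs h * Rabs h)).
  replace (Rabs h ^ 2) with (Rabs h * Rabs h) by ring.
  apply Rmult_le_compat_r. apply Rmult_le_pos; apply Rabs_pos.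
  unfold S. generalize (Rle_abs (Series B)). lra.
  rewrite <- Rmult_assoc. apply Rmult_le_compat_r. apply Rabs_pos.
  rewrite Rmult_comm. left. apply Rlt_div_r; auto.
Qed.

Lemma taylor2_bound f f' f'' : (forall x, is_derive f x (f' x)) -> (forall x, is_derive f' x (f'' x)) ->
  (forall x, Rabs (f'' x) <= 1) -> forall x h, Rabs (f (x + h) - f x - h * f' x) <= h ^ 2.
Proof.
intros H H' B x h.
assert (C : forall g g', (forall x, is_derive g x (g' x)) -> forall x, continuity_pt g x).
{ intros g g' Hg t. apply continuity_pt_filterlim, (@ex_derive_continuous R_AbsRing R_NormedModule).
  eexists; apply Hg. }
destruct (MVT_gen f x (x + h) f') as [c [Hc E]].
  intros; apply H. intros; apply (C f f'); auto.
replace (f (x + h) - f x - h * f' x) with (h * (f' c - f' x)).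
2:{ rewrite E. ring. }
destruct (MVT_gen f' x c f'') as [d [_ E']].
  intros; apply H'. intros; apply (C f' f''); auto.
rewrite E', !Rabs_mult, <- (pow2_abs h).
assert (Hcx : Rabs (c - x) <= Rabs h).
{ unfold Rmin, Rmax in Hc. destruct (Rle_dec x (x + h)).
  rewrite !Rabs_right; lra. rewrite !Rabs_left1; lra. }
replace (Rabs h ^ 2) with (Rabs h * Rabs h) by ring.
apply Rmult_le_compat_l. apply Rabs_pos.
rewrite <- (Rmult_1_l (Rabs h)). apply Rmult_le_compat; auto using Rabs_pos.
Qed.

Lemma cos_taylor2 x h : Rabs (cos (x + h) - cos x - h * - sin x) <= h ^ 2.
Proof.
apply (taylor2_bound cos (fun x => - sin x) (fun x => - cos x)).
- intros; auto_derive; auto; ring.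
- intros; auto_derive; auto; ring.
- intros t. rewrite Rabs_Ropp. apply Rabs_le, COS_bound.
Qed.

Lemma sin_taylor2 x h : Rabs (sin (x + h) - sin x - h * cos x) <= h ^ 2.
Proof.
apply (taylor2_bound sin cos (fun x => - sin x)).
- intros; auto_derive; auto; ring.
- intros; auto_derive; auto; ring.
- intros t. rewrite Rabs_Ropp. apply Rabs_le, SIN_bound.
Qed.

(* [sum_n a_n z^n] at [z = r e^(i phi)] *)
Definition cser (a : nat -> R) (r phi : R) : Cplx :=
  (Series (fun n => a n * r ^ n * cos (INR n * phi)),
   Series (fun n => a n * r ^ n * sin (INR n * phi))).

(** The Euler operator [z d/dz]; up to the factors [i] and [1/r] it yields both the angular and the
    radial derivative. *)
Definition nmul (a : nat -> R) (n : nat) : R := INR n * a n.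

Lemma Rabs_cos_le x : Rabs (cos x) <= 1.
Proof. apply Rabs_le, COS_bound. Qed.
Lemma Rabs_sin_le x : Rabs (sin x) <= 1.
Proof. apply Rabs_le, SIN_bound. Qed.

Lemma cser_ex a r phi : entire a -> 0 < r ->
  ex_series (fun n => a n * r ^ n * cos (INR n * phi)) /\
  ex_series (fun n => a n * r ^ n * sin (INR n * phi)).
Proof.
intros Ha Hr. split; apply (entire_ex_series a (fun n => _)); auto; intros; auto using Rabs_cos_le, Rabs_sin_le.
Qed.

Lemma cser_ext f g r phi : (forall n, f n = g n) -> cser f r phi = cser g r phi.
Proof. intros H. unfold cser. f_equal; apply Series_ext; intros; rewrite H; auto. Qed.

Lemma entire_X f : entire f -> entire (Xs f).
Proof.
intros H. apply entire_shift with 1%nat f; auto. intros n. rewrite Nat.add_1_r. simpl. lra.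
Qed.

Lemma nmul_X a n : nmul a n = Xs (Ds a) n.
Proof. destruct n; unfold nmul, Ds; simpl Xs. simpl; ring. auto. Qed.

Lemma entire_nmul a : entire a -> entire (nmul a).
Proof.
intros H. apply entire_ext with (Xs (Ds a)). intros; symmetry; apply nmul_X.
apply entire_X, entire_D; auto.
Qed.

Lemma cser_lin x y f g r phi : entire f -> entire g -> 0 < r ->
  cser (fun n => x * f n + y * g n) r phi =
  Cadd (Cmul (RtoC x) (cser f r phi)) (Cmul (RtoC y) (cser g r phi)).
Proof.
intros Hf Hg Hr. destruct (cser_ex f r phi Hf Hr) as [F1 F2], (cser_ex g r phi Hg Hr) as [G1 G2].
apply Cplx_ext; simpl; rewrite !Rmult_0_l, ?Rplus_0_r, ?Rminus_0_r, <- !Series_scal_l, <- Series_plus;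
 try (apply (ex_series_scal (V := R_NormedModule)); auto); apply Series_ext; intros; ring.
Qed.

Lemma cser_Xs f r phi : entire f -> 0 < r ->
  cser (Xs f) r phi = Cmul (polar r phi) (cser f r phi).
Proof.
intros Hf Hr. destruct (cser_ex f r phi Hf Hr) as [F1 F2].
destruct (cser_ex (Xs f) r phi (entire_X f Hf) Hr) as [G1 G2].
apply Cplx_ext; simpl; rewrite (Series_incr_1 _) by auto; simpl (Xs f 0);
 rewrite !Rmult_0_l, Rplus_0_l, <- !Series_scal_l, <- ?Series_minus, <- ?Series_plus;
 try (apply (ex_series_scal (V := R_NormedModule)); auto); apply Series_ext; intros n;
 rewrite S_INR, Rmult_plus_distr_r, Rmult_1_l; simpl (Xs f (S n)); rewrite <- tech_pow_Rmult.
rewrite cos_plus; ring.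
rewrite sin_plus; ring.
Qed.

Lemma cser_CD_arg a r phi : entire a -> 0 < r ->
  CD (fun t => cser a r t) phi (Cmul Ci (cser (nmul a) r phi)).
Proof.
intros Ha Hr.
assert (Ea1 := entire_nmul a Ha). assert (Ea2 := entire_nmul _ Ea1).
(* The remainder of term [n] is bounded by [|a n| r^n (n h)^2], whence the majorant built from
   [n^2 |a n|]. *)
assert (EB : ex_series (fun n => Rabs (nmul (nmul a) n) * r ^ n)).
{ apply ex_series_ext with (fun n => (fun n => Rabs (nmul (nmul a) n)) n * r ^ n * 1).
  intros; simpl; ring.
  apply (entire_ex_series (fun n => Rabs (nmul (nmul a) n)) (fun _ => 1)); auto.
  apply entire_le with (2 := Ea2). intros; rewrite Rabs_Rabsolu; lra.
  intros; rewrite Rabs_R1; lra. }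
assert (Bd : forall n h y, Rabs y <= (INR n * h) ^ 2 ->
  Rabs (a n * r ^ n * y) <= Rabs (nmul (nmul a) n) * r ^ n * h ^ 2).
{ intros n h y Hy. unfold nmul. rewrite !Rabs_mult, (Rabs_right (r ^ n)), (Rabs_right (INR n)).
  2: apply Rle_ge, pos_INR. 2: apply Rle_ge, pow_le; lra.
  replace (INR n * (INR n * Rabs (a n)) * r ^ n * h ^ 2) with (Rabs (a n) * r ^ n * (INR n * h) ^ 2) by ring.
  apply Rmult_le_compat_l; auto. apply Rmult_le_pos. apply Rabs_pos. apply pow_le; lra. }
destruct (cser_ex (nmul a) r phi Ea1 Hr) as [N1 N2].
split.
- evar_last. apply (is_derive_Series (fun n t => a n * r ^ n * cos (INR n * t))
    (fun n => - 1 * (nmul a n * r ^ n * sin (INR n * phi))) (fun n => Rabs (nmul (nmul a) n) * r ^ n)); auto.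
  + intros n h. rewrite Rmult_plus_distr_l.
    assert (T := cos_taylor2 (INR n * phi) (INR n * h)).
    replace (a n * r ^ n * cos (INR n * phi + INR n * h) - a n * r ^ n * cos (INR n * phi)
      - h * (-1 * (nmul a n * r ^ n * sin (INR n * phi)))) with
      (a n * r ^ n * (cos (INR n * phi + INR n * h) - cos (INR n * phi) - INR n * h * - sin (INR n * phi)))
      by (unfold nmul; ring).
    apply Bd. auto.
  + intros t. apply (cser_ex a r t Ha Hr).
  + apply (ex_series_scal (V := R_NormedModule)); auto.
  + rewrite Series_scal_l. simpl. ring.
- evar_last. apply (is_derive_Series (fun n t => a n * r ^ n * sin (INR n * t))
    (fun n => nmul a n * r ^ n * cos (INR n * phi)) (fun n => Rabs (nmul (nmul a) n) * r ^ n)); auto.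
  + intros n h. rewrite Rmult_plus_distr_l.
    assert (T := sin_taylor2 (INR n * phi) (INR n * h)).
    replace (a n * r ^ n * sin (INR n * phi + INR n * h) - a n * r ^ n * sin (INR n * phi)
      - h * (nmul a n * r ^ n * cos (INR n * phi))) with
      (a n * r ^ n * (sin (INR n * phi + INR n * h) - sin (INR n * phi) - INR n * h * cos (INR n * phi)))
      by (unfold nmul; ring).
    apply Bd. auto.
  + intros t. apply (cser_ex a r t Ha Hr).
  + simpl. ring.
Qed.

Lemma entire_CV_radius a : entire a -> CV_radius a = p_infty.
Proof.
intros Ha. destruct (CV_radius_bounded a) as [U _].
destruct (CV_radius a) as [x| |]; auto; exfalso.
- assert (H : Rbar_le (Rabs x + 1) x).
  { apply U. destruct (Ha (Rabs x + 1)) as [K HK]. generalize (Rabs_pos x); lra.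
    exists K. intros n. rewrite Rabs_mult, (Rabs_right (_ ^ n)); auto.
    apply Rle_ge, pow_le. generalize (Rabs_pos x); lra. }
  simpl in H. generalize (Rle_abs x). lra.
- assert (H : Rbar_le 1 m_infty).
  { apply U. destruct (Ha 1) as [K HK]. lra. exists K. intros n.
    rewrite Rabs_mult, (Rabs_right (_ ^ n)); auto. apply Rle_ge, pow_le; lra. }
  exact H.
Qed.

Lemma entire_bounded_mul a c : entire a -> (forall n, Rabs (c n) <= 1) -> entire (fun n => a n * c n).
Proof.
intros Ha Hc. apply entire_le with (2 := Ha). intros n. rewrite Rabs_mult.
rewrite <- (Rmult_1_r (Rabs (a n))) at 2. apply Rmult_le_compat_l; auto. apply Rabs_pos.
Qed.

Lemma PSeries_mod_derive b r : entire b -> 0 < r ->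
  is_derive (PSeries b) r (/ r * Series (fun n => nmul b n * r ^ n)).
Proof.
intros Hb Hr. evar_last. apply is_derive_PSeries. rewrite entire_CV_radius; simpl; auto.
replace (Series (fun n => nmul b n * r ^ n)) with (PSeries (PS_incr_1 (PS_derive b)) r).
rewrite PSeries_incr_1. field. lra.
unfold PSeries. apply Series_ext. intros [|n]; unfold nmul, PS_derive; simpl PS_incr_1.
unfold zero; simpl; ring. auto.
Qed.

(** For a fixed argument the real and imaginary parts are real power series in the modulus. *)
Lemma cser_CD_mod a r phi : entire a -> 0 < r ->
  CD (fun s => cser a s phi) r (Cmul (RtoC (/ r)) (cser (nmul a) r phi)).
Proof.
intros Ha Hr. split; simpl.
- apply is_derive_ext with (PSeries (fun n => a n * cos (INR n * phi))).
  { intros t. unfold PSeries. apply Series_ext. intros; ring. }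
  evar_last. apply PSeries_mod_derive; auto. apply entire_bounded_mul; auto using Rabs_cos_le.
  rewrite Rmult_0_l, Rminus_0_r. f_equal. apply Series_ext. intros; unfold nmul; ring.
- apply is_derive_ext with (PSeries (fun n => a n * sin (INR n * phi))).
  { intros t. unfold PSeries. apply Series_ext. intros; ring. }
  evar_last. apply PSeries_mod_derive; auto. apply entire_bounded_mul; auto using Rabs_sin_le.
  rewrite Rmult_0_l, Rplus_0_r. f_equal. apply Series_ext. intros; unfold nmul; ring.
Qed.

Lemma PSeries_lim0 b : entire b -> forall eps, 0 < eps -> exists delta, 0 < delta /\
  forall r, 0 < r < delta -> Rabs (PSeries b r - b 0%nat) < eps.
Proof.
intros Hb eps He.
assert (Hc : continuity_pt (PSeries b) 0).
{ apply PSeries_continuity. rewrite entire_CV_radius; simpl; auto. }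
destruct (Hc eps He) as [d [Hd H]]. exists d. split; auto. intros r Hr.
rewrite <- (PSeries_0 b). apply H. split. split; [exact I|]. lra.
unfold dist; simpl. unfold Rdist, R_dist. rewrite Rminus_0_r, Rabs_right; lra.
Qed.

Lemma cser_lim0 a phi : entire a -> lim0 (fun r => cser a r phi) (RtoC (a 0%nat)).
Proof.
intros Ha eps He.
destruct (PSeries_lim0 (fun n => a n * cos (INR n * phi))) with (eps / 2) as [d1 [P1 Q1]].
 apply entire_bounded_mul; auto using Rabs_cos_le. lra.
destruct (PSeries_lim0 (fun n => a n * sin (INR n * phi))) with (eps / 2) as [d2 [P2 Q2]].
 apply entire_bounded_mul; auto using Rabs_sin_le. lra.
exists (Rmin d1 d2). split. apply Rmin_pos; auto. intros r Hr.
generalize (Rmin_l d1 d2) (Rmin_r d1 d2). intros.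
specialize (Q1 r ltac:(lra)). specialize (Q2 r ltac:(lra)).
apply Rle_lt_trans with (1 := Cnorm_le _). 
simpl INR in Q1, Q2. rewrite Rmult_0_l, cos_0, Rmult_1_r in Q1. rewrite Rmult_0_l, sin_0, Rmult_0_r in Q2.
simpl. 
replace (Series (fun n => a n * r ^ n * cos (INR n * phi))) with (PSeries (fun n => a n * cos (INR n * phi)) r)
 by (unfold PSeries; apply Series_ext; intros; ring).
replace (Series (fun n => a n * r ^ n * sin (INR n * phi))) with (PSeries (fun n => a n * sin (INR n * phi)) r)
 by (unfold PSeries; apply Series_ext; intros; ring).
fold (PSeries (fun n => a n * cos (INR n * phi)) r - a 0%nat).
rewrite Ropp_0, Rplus_0_r. rewrite Rminus_0_r in Q2. lra.
Qed.

Lemma cser_periodic a r phi : cser a r (phi + 2 * PI) = cser a r phi.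
Proof.
unfold cser. f_equal; apply Series_ext; intros n; f_equal;
replace (INR n * (phi + 2 * PI)) with (INR n * phi + 2 * INR n * PI) by ring.
apply cos_period. apply sin_period.
Qed.

Lemma CD_scal c f x d : CD f x d -> CD (fun t => Cmul c (f t)) x (Cmul c d).
Proof.
intros H. eapply CD_ext. eapply (CD_mul (fun _ => c) f x C0). split; apply @is_derive_const.
exact H. ring.
Qed.

(** [z v' = - i q u] forces [u = (i / q) z v']; the second equation of the system is then the one
    that [lsol] solves. *)
Lemma cser_theta q L M r phi : q <> 0 -> M <> 0 -> 0 < r -> entire (lsol L M (q ^ 2)) ->
  theta_u q L M (polar r phi) (cser (lsol L M (q ^ 2)) r phi)
    (Cmul (0, / q) (cser (nmul (lsol L M (q ^ 2))) r phi))
  = Cmul (0, / q) (cser (nmul (nmul (lsol L M (q ^ 2)))) r phi).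
Proof.
intros Hq HM Hr Ha. set (a := lsol L M (q ^ 2)) in *.
assert (E1 := entire_nmul _ Ha). assert (E2 := entire_nmul _ E1).
assert (ED := entire_D _ Ha).
set (z := polar r phi). assert (Hz : z <> C0) by (apply polar_neq_0; auto).
assert (Z1 : Cmul (Cinv z) (cser (nmul a) r phi) = cser (Ds a) r phi).
{ rewrite (cser_ext _ _ r phi (nmul_X a)), cser_Xs by auto. fold z. field. auto. }
assert (Z2 : Cmul z (cser (nmul a) r phi) = cser (Xs (nmul a)) r phi).
{ rewrite cser_Xs by auto. auto. }
(* The equation of [lsol] in terms of [D = z d/dz]: [D^2 a + L D a + q^2 a + M (a' + z D a) = 0]. *)
assert (R0 : Cadd (Cmul (RtoC 1) (Cadd (Cmul (RtoC 1) (cser (nmul (nmul a)) r phi)) (Cmul (RtoC L) (cser (nmul a) r phi))))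
  (Cmul (RtoC 1) (Cadd (Cmul (RtoC (q ^ 2)) (cser a r phi)) (Cmul (RtoC M) (Cadd (Cmul (RtoC 1) (cser (Ds a) r phi)) (Cmul (RtoC 1) (cser (Xs (nmul a)) r phi)))))) = C0).
{ assert (EX := entire_X _ E1).
  rewrite <- (cser_lin 1 1 (Ds a)), <- (cser_lin 1 L) by auto.
  assert (EF : entire (fun n => 1 * Ds a n + 1 * Xs (nmul a) n)).
  { apply entire_plus; apply entire_scal; auto. }
  assert (EG : entire (fun n => 1 * nmul (nmul a) n + L * nmul a n)).
  { apply entire_plus; apply entire_scal; auto. }
  rewrite <- (cser_lin (q ^ 2) M) by auto.
  rewrite <- (cser_lin 1 1) by (auto; apply entire_plus; apply entire_scal; auto).
  rewrite (cser_ext _ (fun n => 0 * a n + 0 * a n)).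
  rewrite cser_lin by auto. Cring.
  intros n. transitivity 0; [|ring].
  generalize (lsol_eq L M (q ^ 2) n HM). fold a. intros Eh.
  transitivity (heun (L + 1) M M (q ^ 2) 0 a n). 2: exact Eh.
  destruct n as [|n].
    rewrite heun_0. unfold nmul, Ds; simpl. ring.
  rewrite heun_S. unfold nmul, Ds. simpl Xs. rewrite !S_INR. ring. }
revert R0 Z1 Z2. unfold theta_u.
generalize (cser (nmul (nmul a)) r phi) (cser (nmul a) r phi) (cser a r phi) (cser (Ds a) r phi)
 (cser (Xs (nmul a)) r phi). intros nn n1 n0 d x R0 Z1 Z2.
transitivity (Csub (Cmul (0, - q) n0) (Cmul (0, / q) (Cadd (Cmul (RtoC L) n1) (Cmul (RtoC M) (Cadd (Cmul z n1) (Cmul (Cinv z) n1)))))).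
ring. rewrite Z1, Z2. clear Z1 Z2.
destruct nn, n1, n0, d, x. injection R0; intros R1 R2. simpl in R1, R2.
apply Cplx_ext; simpl.
- apply Rmult_eq_reg_l with q; auto. field_simplify; auto. simpl. lra.
- apply Rmult_eq_reg_l with q; auto. field_simplify; auto. simpl. lra.
Qed.

Lemma polsol_of_entire q L M a b : q <> 0 -> M <> 0 -> entire (lsol L M (q ^ 2)) ->
  polsol q L M a b (cser (lsol L M (q ^ 2)))
   (fun r phi => Cmul (0, / q) (cser (nmul (lsol L M (q ^ 2))) r phi)).
Proof.
intros Hq HM He r phi Hr _.
assert (E1 := entire_nmul _ He).
rewrite cser_theta by auto.
split; split.
- eapply CD_ext. apply cser_CD_arg; auto.
  apply Cplx_ext; simpl; field; auto.
- eapply CD_ext. apply CD_scal. apply cser_CD_arg; auto. ring.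
- eapply CD_ext. apply cser_CD_mod; auto.
  apply Cplx_ext; simpl; field; lra.
- eapply CD_ext. apply CD_scal. apply cser_CD_mod; auto. ring.
Qed.

(** * Stokes multipliers *)

Lemma Cnorm_polar r phi : 0 < r -> Cnorm (polar r phi) = r.
Proof.
intros Hr. unfold Cnorm, polar. simpl.
replace (_ + _) with (r * r).
rewrite sqrt_square; lra.
transitivity (r * r * (Rsqr (sin phi) + Rsqr (cos phi))). rewrite sin2_cos2; ring. unfold Rsqr; ring.
Qed.

Lemma polar_2PI r phi : polar r (phi + 2 * PI) = polar r phi.
Proof.
unfold polar. replace (phi + 2 * PI) with (phi + 2 * INR 1 * PI) by (simpl; ring).
rewrite cos_period, sin_period. auto.
Qed.

Lemma polar_incl_self a b : polar_incl a b (sector a b).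
Proof. intros r phi Hr Hphi. exists r, phi; auto. Qed.

Lemma polar_incl_2PI a b : polar_incl (2 * PI + a) (2 * PI + b) (sector a b).
Proof.
intros r phi Hr Hphi. exists r, (phi - 2 * PI). split; auto. split. lra.
rewrite <- (polar_2PI r (phi - 2 * PI)). f_equal. ring.
Qed.

Lemma Clim_polar S f w a b : Clim f S C0 w -> polar_incl a b S ->
  forall eps, 0 < eps -> exists delta, 0 < delta /\
    forall r phi, 0 < r < delta -> a < phi < b -> Cnorm (Csub (f (polar r phi)) w) < eps.
Proof.
intros H HS eps He. destruct (H eps He) as [d [Hd Hd']]. exists d; split; auto.
intros r phi Hr Hphi. apply Hd'. apply HS; auto; lra.
replace (Csub (polar r phi) C0) with (polar r phi) by ring. rewrite Cnorm_polar; lra.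
Qed.

Lemma Clim_lim0 S f w a b phi : Clim f S C0 w -> polar_incl a b S -> a < phi < b ->
  lim0 (fun r => f (polar r phi)) w.
Proof.
intros H HS Hphi eps He. destruct (Clim_polar S f w a b H HS eps He) as [d [Hd Hd']].
exists d; split; auto.
Qed.

Lemma jcont_of_Cderiv S f f' a b : Cderiv_on S f f' -> polar_incl a b S ->
  jcont a b (fun r phi => f (polar r phi)).
Proof.
intros Hf HS r t Hr Ht.
assert (P1 : continuity_2d_pt (fun r t => r * cos t) r t).
{ apply continuity_2d_pt_mult. apply continuity_2d_pt_id1.
  apply (continuity_1d_2d_pt_comp cos (fun _ t => t)). apply continuity_cos. apply continuity_2d_pt_id2. }
assert (P2 : continuity_2d_pt (fun r t => r * sin t) r t).
{ apply continuity_2d_pt_mult. apply continuity_2d_pt_id1.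
  apply (continuity_1d_2d_pt_comp sin (fun _ t => t)). apply continuity_sin. apply continuity_2d_pt_id2. }
assert (K : forall eps : posreal, exists delta : posreal, forall s x, Rabs (s - r) < delta -> Rabs (x - t) < delta ->
   Cnorm (Csub (f (polar s x)) (f (polar r t))) < eps).
{ intros eps. destruct (Cderiv_on_continuous S f f' _ Hf (HS r t Hr Ht) eps (cond_pos eps)) as [d [Hd Hd']].
  assert (Hd2 : 0 < d / 2) by lra.
  destruct (P1 (mkposreal _ Hd2)) as [e1 E1]. destruct (P2 (mkposreal _ Hd2)) as [e2 E2]. simpl in *.
  assert (He : 0 < Rmin (Rmin e1 e2) (Rmin r (Rmin (t - a) (b - t)))).
  { repeat apply Rmin_pos; try apply cond_pos; lra. }
  exists (mkposreal _ He). simpl. intros s x Hs Hx.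
  generalize (Rmin_l (Rmin e1 e2) (Rmin r (Rmin (t - a) (b - t))))
   (Rmin_r (Rmin e1 e2) (Rmin r (Rmin (t - a) (b - t)))) (Rmin_l e1 e2) (Rmin_r e1 e2)
   (Rmin_l r (Rmin (t - a) (b - t))) (Rmin_r r (Rmin (t - a) (b - t)))
   (Rmin_l (t - a) (b - t)) (Rmin_r (t - a) (b - t)). intros.
  assert (F1 := E1 s x ltac:(lra) ltac:(lra)). assert (F2 := E2 s x ltac:(lra) ltac:(lra)).
  apply Rabs_lt_between in Hs. apply Rabs_lt_between in Hx.
  apply Hd'. apply HS; lra.
  apply Rle_lt_trans with (1 := Cnorm_le _). simpl. unfold Rminus in *. lra. }
split; intros eps; destruct (K eps) as [d Hd]; exists d; intros s x Hs Hx;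
 apply Rle_lt_trans with (2 := Hd s x Hs Hx).
exact (Cnorm_fst (Csub (f (polar s x)) (f (polar r t)))).
exact (Cnorm_snd (Csub (f (polar s x)) (f (polar r t)))).
Qed.

(** The cut at [PI] lies inside the overlap of the two sectors. *)
Definition glue (v v' : R -> R -> Cplx) (r t : R) : Cplx :=
  if Rlt_dec t PI then v r t else v' r t.

(** Near every argument a single branch describes the glued function; at the cut itself the
    agreement on the overlap lets the first one serve. *)
Lemma glue_local a' b t : a' < PI < b ->
  (t < b /\ exists d, 0 < d /\ forall v v' : R -> R -> Cplx,
     (forall r t, 0 < r -> a' < t < b -> v r t = v' r t) ->
     forall r x, 0 < r -> Rabs (x - t) < d -> glue v v' r x = v r x) \/
  (a' < t /\ exists d, 0 < d /\ forall (v v' : R -> R -> Cplx) r x,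
     Rabs (x - t) < d -> glue v v' r x = v' r x).
Proof.
intros Hab. destruct (Rle_lt_dec t PI) as [Hle|Hlt].
- left. split. lra. exists (Rmin (PI - a') (b - PI)). split. apply Rmin_pos; lra.
  intros v v' E r x Hr Hx. unfold glue. destruct (Rlt_dec x PI); auto.
  symmetry. apply E; auto. generalize (Rmin_r (PI - a') (b - PI)).
  apply Rabs_lt_between in Hx. lra.
- right. split. lra. exists (t - PI). split. lra. intros v v' r x Hx.
  apply Rabs_lt_between in Hx. unfold glue. destruct (Rlt_dec x PI); auto. lra.
Qed.

Lemma polsol_glue q L M a b a' b' v u v' u' : polsol q L M a b v u -> polsol q L M a' b' v' u' ->
  a' < PI < b ->
  (forall r t, 0 < r -> a' < t < b -> v r t = v' r t) ->
  (forall r t, 0 < r -> a' < t < b -> u r t = u' r t) ->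
  polsol q L M a b' (glue v v') (glue u u').
Proof.
intros Hs Hs' Hab Ev Eu r t Hr Ht.
assert (Lr : locally r (fun s => 0 < s)) by (apply (open_gt 0); auto).
assert (Trans : forall d w wu f fu, 0 < d ->
  (forall s x, 0 < s -> Rabs (x - t) < d -> f s x = w s x) ->
  (forall s x, 0 < s -> Rabs (x - t) < d -> fu s x = wu s x) ->
  (CD (fun x => w r x) t (Cmul (RtoC q) (wu r t)) /\
   CD (fun x => wu r x) t (Cmul Ci (theta_u q L M (polar r t) (w r t) (wu r t)))) /\
  (CD (fun s => w s t) r (Cmul (RtoC (/ r)) (Cmul (0, - q) (wu r t))) /\
   CD (fun s => wu s t) r (Cmul (RtoC (/ r)) (theta_u q L M (polar r t) (w r t) (wu r t)))) ->
  (CD (fun x => f r x) t (Cmul (RtoC q) (fu r t)) /\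
   CD (fun x => fu r x) t (Cmul Ci (theta_u q L M (polar r t) (f r t) (fu r t)))) /\
  (CD (fun s => f s t) r (Cmul (RtoC (/ r)) (Cmul (0, - q) (fu r t))) /\
   CD (fun s => fu s t) r (Cmul (RtoC (/ r)) (theta_u q L M (polar r t) (f r t) (fu r t))))).
{ intros d w wu f fu Hd Gf Gu [[A1 A2] [A3 A4]].
  assert (D0 : Rabs (t - t) < d) by (rewrite Rminus_diag, Rabs_R0; auto).
  rewrite (Gf r t), (Gu r t) by auto.
  assert (Lt : locally t (fun x => Rabs (x - t) < d)).
  { exists (mkposreal d Hd). intros x Hx. exact Hx. }
  split; split.
  - apply CD_ext_loc with (2 := A1). apply filter_imp with (2 := Lt). intros; symmetry; auto.
  - apply CD_ext_loc with (2 := A2). apply filter_imp with (2 := Lt). intros; symmetry; auto.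
  - apply CD_ext_loc with (2 := A3). apply filter_imp with (2 := Lr). intros; symmetry; auto.
  - apply CD_ext_loc with (2 := A4). apply filter_imp with (2 := Lr). intros; symmetry; auto. }
destruct (glue_local a' b t Hab) as [[Htb [d [Hd G]]]|[Hta [d [Hd G]]]].
- apply (Trans d v u); auto. apply (Hs r t Hr). lra.
- apply (Trans d v' u'); auto. apply (Hs' r t Hr). lra.
Qed.

Lemma jcont_glue a b a' b' u u' : jcont a b u -> jcont a' b' u' -> a' < PI < b ->
  (forall r t, 0 < r -> a' < t < b -> u r t = u' r t) -> jcont a b' (glue u u').
Proof.
intros J J' Hab Eu r t Hr Ht.
destruct (glue_local a' b t Hab) as [[Htb [d [Hd G]]]|[Hta [d [Hd G]]]].
- destruct (J r t Hr ltac:(lra)) as [J1 J2].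
  assert (Hm : 0 < Rmin d r) by (apply Rmin_pos; auto).
  split; eapply continuity_2d_pt_ext_loc; [|exact J1| |exact J2];
   exists (mkposreal _ Hm); simpl; intros s x Hs Hx;
   generalize (Rmin_l d r) (Rmin_r d r); intros;
   apply Rabs_lt_between in Hs; rewrite G; auto; lra.
- destruct (J' r t Hr ltac:(lra)) as [J1 J2].
  split; eapply continuity_2d_pt_ext_loc; [|exact J1| |exact J2];
   exists (mkposreal _ Hd); simpl; intros s x Hs Hx; rewrite G; auto.
Qed.

(* [vp, up] live on the sector with arguments in [(a, b)]; [vm, um] on its complex conjugate, where
   arguments are taken in [(2 PI - b, 2 PI - a)]. *)
Lemma entire_of_single_valued q L M a b vp up vm um :
  q <> 0 -> M <> 0 -> a < 0 -> PI < b ->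
  polsol q L M a b (fun r t => vp (polar r t)) (fun r t => up (polar r t)) ->
  polsol q L M (2 * PI - b) (2 * PI - a) (fun r t => vm (polar r t)) (fun r t => um (polar r t)) ->
  jcont a b (fun r t => up (polar r t)) ->
  jcont (2 * PI - b) (2 * PI - a) (fun r t => um (polar r t)) ->
  (forall r t, 0 < r -> 2 * PI - b < t < b ->
     vp (polar r t) = vm (polar r t) /\ up (polar r t) = um (polar r t)) ->
  (forall r, 0 < r ->
     vp (polar r 0) = vm (polar r 0) /\ up (polar r 0) = um (polar r 0)) ->
  Clim vp (sector a b) C0 C1 -> Clim vm (sector (- b) (- a)) C0 C1 ->
  entire (lsol L M (q ^ 2)).
Proof.
intros Hq HM Ha Hb Sp Sm Jp Jm E0 E1 Lp Lm. generalize PI_RGT_0; intros HP.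
set (v := glue (fun r t => vp (polar r t)) (fun r t => vm (polar r t))).
set (u := glue (fun r t => up (polar r t)) (fun r t => um (polar r t))).
assert (P2 : forall r, polar r (2 * PI) = polar r 0).
{ intros r. rewrite <- (polar_2PI r 0). f_equal. ring. }
apply (entire_of_polsol q L M a (2 * PI - a) v u); auto; try lra.
- apply polsol_glue with b (2 * PI - b); auto. lra.
  intros r t Hr Ht; apply (E0 r t Hr Ht). intros r t Hr Ht; apply (E0 r t Hr Ht).
- apply jcont_glue with b (2 * PI - b); auto. lra.
  intros r t Hr Ht; apply (E0 r t Hr Ht).
(* The ends need no gluing: the Fourier argument only asks for equal values at the arguments 0 and
   [2 PI]. *)
- intros r Hr. unfold v, glue. destruct (Rlt_dec 0 PI); [|lra]. destruct (Rlt_dec (2 * PI) PI); [lra|].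
  rewrite P2. apply (E1 r Hr).
- intros r Hr. unfold u, glue. destruct (Rlt_dec 0 PI); [|lra]. destruct (Rlt_dec (2 * PI) PI); [lra|].
  rewrite P2. apply (E1 r Hr).
- intros eps He.
  destruct (Clim_polar _ _ _ a b Lp (polar_incl_self a b) eps He) as [d1 [D1 D1']].
  destruct (Clim_polar _ _ _ _ _ Lm (polar_incl_2PI (- b) (- a)) eps He) as [d2 [D2 D2']].
  exists (Rmin d1 d2). split. apply Rmin_pos; auto.
  intros r t Hr Ht. generalize (Rmin_l d1 d2) (Rmin_r d1 d2). intros.
  unfold v, glue. destruct (Rlt_dec t PI). apply D1'; lra. apply D2'; lra.
Qed.

(** * The Stokes relations column by column *)

Lemma Cmul_integral z w : Cmul z w = C0 -> z = C0 \/ w = C0.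
Proof.
intros E.
destruct (Req_dec (Cnorm z) 0) as [Hz|Hz].
  left. exact (Complex.Cmod_eq_0 z Hz).
right. apply (Complex.Cmod_eq_0 w). change (Cnorm w = 0).
apply Rmult_eq_reg_l with (Cnorm z); auto. rewrite <- Cnorm_mul, E, Cnorm_0. ring.
Qed.

Lemma Fbr_shape l mu r theta : exists x, x <> C0 /\ Fbr l mu r theta = Mdiag x C1.
Proof.
unfold Fbr. eexists. split; [|reflexivity].
assert (He : forall w, Cexp w <> C0).
{ intros w. apply (polar_neq_0 (exp (fst w)) (snd w)). apply exp_pos. }
intros E. apply Cmul_integral in E. destruct E as [E|E]; [|exact (He _ E)].
apply Cmul_integral in E. destruct E as [E|E]; [|exact (He _ E)].
injection E. unfold Rpower. generalize (exp_pos (- l * ln r)). lra.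
Qed.

(** Around the negative half axis the first column continues across, while the second jumps by [c0]
    times a nonzero multiple of the first. *)
Lemma stokes_0 l mu a b Hp Hm c0 c1 r theta :
  stokes_relations l mu a b Hp Hm c0 c1 -> 0 < r -> 2 * PI - b < theta < b ->
  let z := polar r theta in
  exists x, x <> C0 /\ e11 (Hm z) = e11 (Hp z) /\ e21 (Hm z) = e21 (Hp z) /\
    e12 (Hm z) = Cadd (e12 (Hp z)) (Cmul c0 (Cmul x (e11 (Hp z)))) /\
    e22 (Hm z) = Cadd (e22 (Hp z)) (Cmul c0 (Cmul x (e21 (Hp z)))).
Proof.
intros [H _] Hr Ht z. specialize (H r theta Hr Ht). cbv zeta in H. fold z in H.
destruct (Fbr_shape l mu r theta) as [x [Hx E]]. rewrite E in H. exists x. split; auto.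
destruct (Hm z) as [m11 m12 m21 m22], (Hp z) as [p11 p12 p21 p22].
assert (H1 := f_equal e11 H). assert (H2 := f_equal e12 H).
assert (H3 := f_equal e21 H). assert (H4 := f_equal e22 H).
cbn [Mmul Mdiag Cmat0 e11 e12 e21 e22] in *.
assert (Cx : forall s t, Cmul s x = Cmul t x -> s = t).
{ intros s t Hst. transitivity (Cmul (Cmul s x) (Cinv x)). field; auto. rewrite Hst. field; auto. }
repeat split.
- apply Cx. transitivity (Cadd (Cmul m11 x) (Cmul m12 C0)). ring. rewrite H1. ring.
- apply Cx. transitivity (Cadd (Cmul m21 x) (Cmul m22 C0)). ring. rewrite H3. ring.
- transitivity (Cadd (Cmul m11 C0) (Cmul m12 C1)). ring. rewrite H2. ring.
- transitivity (Cadd (Cmul m21 C0) (Cmul m22 C1)). ring. rewrite H4. ring.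
Qed.

(** Around the positive half axis the columns exchange roles: the first one jumps by a multiple of
    the second. *)
Lemma stokes_1 l mu a b Hp Hm c0 c1 r theta :
  stokes_relations l mu a b Hp Hm c0 c1 -> 0 < r -> 2 * PI + a < theta < 2 * PI - a ->
  let z := polar r theta in
  exists x, x <> C0 /\ e12 (Hp z) = e12 (Hm z) /\ e22 (Hp z) = e22 (Hm z) /\
    Cmul x (e11 (Hp z)) = Cadd (Cmul x (e11 (Hm z))) (Cmul c1 (e12 (Hm z))) /\
    Cmul x (e21 (Hp z)) = Cadd (Cmul x (e21 (Hm z))) (Cmul c1 (e22 (Hm z))).
Proof.
intros [_ H] Hr Ht z. specialize (H r theta Hr Ht). cbv zeta in H. fold z in H.
destruct (Fbr_shape l mu r theta) as [x [Hx E]]. rewrite E in H. exists x. split; auto.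
destruct (Hm z) as [m11 m12 m21 m22], (Hp z) as [p11 p12 p21 p22].
assert (H1 := f_equal e11 H). assert (H2 := f_equal e12 H).
assert (H3 := f_equal e21 H). assert (H4 := f_equal e22 H).
cbn [Mmul Mdiag Cmat1 e11 e12 e21 e22] in *.
repeat split.
- transitivity (Cadd (Cmul p11 C0) (Cmul p12 C1)). ring. rewrite H2. ring.
- transitivity (Cadd (Cmul p21 C0) (Cmul p22 C1)). ring. rewrite H4. ring.
- transitivity (Cadd (Cmul p11 x) (Cmul p12 C0)). ring. rewrite H1. ring.
- transitivity (Cadd (Cmul p21 x) (Cmul p22 C0)). ring. rewrite H3. ring.
Qed.

Lemma stokes_0_trivial_entire omega l mu a b Hp Hm c1 :
  0 < omega -> 0 < mu -> a < 0 -> PI < b ->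
  is_H omega l mu a b Hp -> is_H omega l mu (- b) (- a) Hm ->
  stokes_relations l mu a b Hp Hm C0 c1 -> entire (lsol l mu ((1 / (2 * omega)) ^ 2)).
Proof.
intros Ho Hmu Ha Hb [_ [[_ [_ [_ [_ [_ [_ [_ Lp]]]]]]] Tp]] [_ [[_ [_ [_ [_ [_ [_ [_ Lm]]]]]]] Tm]] St.
assert (Hq : 1 / (2 * omega) <> 0).
{ apply Rgt_not_eq. apply Rdiv_lt_0_compat; lra. }
assert (I2 := polar_incl_2PI (- b) (- a)).
change (2 * PI + - b) with (2 * PI - b) in I2. change (2 * PI + - a) with (2 * PI - a) in I2.
assert (P2 : forall r, polar r 0 = polar r (2 * PI)).
{ intros r. rewrite <- (polar_2PI r 0). f_equal. ring. }
apply (entire_of_single_valued _ l mu a b (fun z => e22 (Hp z)) (fun z => e12 (Hp z))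
  (fun z => e22 (Hm z)) (fun z => e12 (Hm z))); auto.
- lra.
- apply polsol_col2 with (2 := Tp); auto. apply polar_incl_self.
- apply polsol_col2 with (2 := Tm); auto.
- destruct Tp as [H' [[_ [D _]] _]].
  exact (jcont_of_Cderiv _ _ _ _ _ D (polar_incl_self a b)).
- destruct Tm as [H' [[_ [D _]] _]].
  exact (jcont_of_Cderiv _ _ _ _ _ D I2).
- intros r t Hr Ht. destruct (stokes_0 _ _ _ _ _ _ _ _ r t St Hr Ht) as [x [_ [_ [_ [E1 E2]]]]].
  rewrite E1, E2. split; ring.
- intros r Hr. rewrite P2.
  destruct (stokes_1 _ _ _ _ _ _ _ _ r (2 * PI) St Hr ltac:(lra)) as [x [_ [E1 [E2 _]]]]. auto.
Qed.

Lemma stokes_1_trivial_entire omega l mu a b Hp Hm c0 :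
  0 < omega -> 0 < mu -> a < 0 -> PI < b ->
  is_H omega l mu a b Hp -> is_H omega l mu (- b) (- a) Hm ->
  stokes_relations l mu a b Hp Hm c0 C0 -> entire (lsol (- l) (- mu) ((1 / (2 * omega)) ^ 2)).
Proof.
intros Ho Hmu Ha Hb [_ [[_ [_ [_ [_ [Lp _]]]]] Tp]] [_ [[_ [_ [_ [_ [Lm _]]]]] Tm]] St.
assert (Hq : 1 / (2 * omega) <> 0).
{ apply Rgt_not_eq. apply Rdiv_lt_0_compat; lra. }
assert (I2 := polar_incl_2PI (- b) (- a)).
change (2 * PI + - b) with (2 * PI - b) in I2. change (2 * PI + - a) with (2 * PI - a) in I2.
assert (P2 : forall r, polar r 0 = polar r (2 * PI)).
{ intros r. rewrite <- (polar_2PI r 0). f_equal. ring. }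
apply (entire_of_single_valued _ (- l) (- mu) a b (fun z => e11 (Hp z)) (fun z => e21 (Hp z))
  (fun z => e11 (Hm z)) (fun z => e21 (Hm z))); auto.
- lra.
- apply polsol_col1 with (2 := Tp); auto. apply polar_incl_self.
- apply polsol_col1 with (2 := Tm); auto.
- destruct Tp as [H' [[_ [_ [D _]]] _]].
  exact (jcont_of_Cderiv _ _ _ _ _ D (polar_incl_self a b)).
- destruct Tm as [H' [[_ [_ [D _]]] _]].
  exact (jcont_of_Cderiv _ _ _ _ _ D I2).
- intros r t Hr Ht. destruct (stokes_0 _ _ _ _ _ _ _ _ r t St Hr Ht) as [x [_ [E1 [E2 _]]]]. auto.
- intros r Hr. rewrite P2.
  destruct (stokes_1 _ _ _ _ _ _ _ _ r (2 * PI) St Hr ltac:(lra)) as [x [Hx [_ [_ [E1 E2]]]]].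
  assert (Cx : forall s t, Cmul x s = Cmul x t -> s = t).
  { intros s t Hst. transitivity (Cmul (Cmul x s) (Cinv x)). field; auto. rewrite Hst. field; auto. }
  split; apply Cx. rewrite E1; ring. rewrite E2; ring.
Qed.

Lemma lsol_C1 L M kap : RtoC (lsol L M kap 0%nat) = C1.
Proof. unfold lsol. rewrite heun_sol_0. reflexivity. Qed.

(** The half axis at [phi0] is the one where [M z > 0]: the positive one for the second column of
    [H], the negative one for the first. *)
Lemma entire_solution_unique q L M a b v u phi0 : q <> 0 -> M <> 0 ->
  entire (lsol L M (q ^ 2)) -> polsol q L M a b v u ->
  a < phi0 < b -> sin phi0 = 0 -> 0 < M * cos phi0 ->
  lim0 (fun r => v r phi0) C1 -> lim0 (fun r => u r phi0) C0 ->
  exists r0, 0 < r0 /\ forall r phi, 0 < r < r0 -> a < phi < b ->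
    v r phi = cser (lsol L M (q ^ 2)) r phi /\
    u r phi = Cmul (0, / q) (cser (nmul (lsol L M (q ^ 2))) r phi).
Proof.
intros Hq HM He Hs Hphi Hsin Hcos Lv Lu.
apply (polsol_unique q L M a b v u _ _ phi0 C1 C0); auto.
- apply polsol_of_entire; auto.
- rewrite <- (lsol_C1 L M (q ^ 2)). apply cser_lim0; auto.
- intros eps Heps.
  destruct (cser_lim0 _ phi0 (entire_nmul _ He) (eps * Rabs q)) as [d [Hd H]].
  { apply Rmult_lt_0_compat; auto. apply Rabs_pos_lt; auto. }
  exists d; split; auto. intros r Hr. specialize (H r Hr).
  assert (E0 : RtoC (nmul (lsol L M (q ^ 2)) 0) = C0) by (unfold nmul; Cring).
  rewrite E0 in H.
  replace (Csub (Cmul (0, / q) (cser (nmul (lsol L M (q ^ 2))) r phi0)) C0) with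
   (Cmul (Cmul Ci (RtoC (/ q))) (Csub (cser (nmul (lsol L M (q ^ 2))) r phi0) C0))
   by (apply Cplx_ext; simpl; ring).
  rewrite !Cnorm_mul, Cnorm_R, Rabs_inv.
  replace (Cnorm Ci) with 1.
  2:{ unfold Cnorm; simpl. replace (0 * (0 * 1) + 1 * (1 * 1)) with 1 by ring. rewrite sqrt_1; auto. }
  assert (Hp := Rabs_pos_lt q Hq).
  apply Rmult_lt_reg_r with (Rabs q); auto.
  replace (1 * / Rabs q * Cnorm (Csub (cser (nmul (lsol L M (q ^ 2))) r phi0) C0) * Rabs q)
   with (Cnorm (Csub (cser (nmul (lsol L M (q ^ 2))) r phi0) C0)); auto.
  field. lra.
Qed.

(** Argument 0 lies in both sectors, so near 0 both second columns are given by the same series,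
    also at argument [PI]. There they differ by [c0] times a nonzero multiple of the first column,
    which cannot vanish since [Mdet (Hp z) <> C0]. *)
Lemma entire_stokes_0_trivial omega l mu a b Hp Hm c0 c1 :
  0 < omega -> 0 < mu -> a < 0 -> PI < b ->
  is_H omega l mu a b Hp -> is_H omega l mu (- b) (- a) Hm ->
  stokes_relations l mu a b Hp Hm c0 c1 -> entire (lsol l mu ((1 / (2 * omega)) ^ 2)) -> c0 = C0.
Proof.
intros Ho Hmu Ha Hb [Dp [[_ [_ [_ [_ [_ [Lp1 [_ Lp2]]]]]]] Tp]]
  [_ [[_ [_ [_ [_ [_ [Lm1 [_ Lm2]]]]]]] Tm]] St He.
generalize PI_RGT_0; intros HP.
assert (Hq : 1 / (2 * omega) <> 0).
{ apply Rgt_not_eq. apply Rdiv_lt_0_compat; lra. }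
assert (Hc : 0 < mu * cos 0) by (rewrite cos_0; lra).
destruct (entire_solution_unique (1 / (2 * omega)) l mu a b (fun r t => e22 (Hp (polar r t)))
  (fun r t => e12 (Hp (polar r t))) 0) as [r1 [R1 E1]]; auto using sin_0; try lra.
{ apply polsol_col2 with (2 := Tp); auto. apply polar_incl_self. }
{ apply Clim_lim0 with (1 := Lp2) (2 := polar_incl_self a b). lra. }
{ apply Clim_lim0 with (1 := Lp1) (2 := polar_incl_self a b). lra. }
destruct (entire_solution_unique (1 / (2 * omega)) l mu (- b) (- a) (fun r t => e22 (Hm (polar r t)))
  (fun r t => e12 (Hm (polar r t))) 0) as [r2 [R2 E2]]; auto using sin_0; try lra.
{ apply polsol_col2 with (2 := Tm); auto. apply polar_incl_self. }
{ apply Clim_lim0 with (1 := Lm2) (2 := polar_incl_self (- b) (- a)). lra. }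
{ apply Clim_lim0 with (1 := Lm1) (2 := polar_incl_self (- b) (- a)). lra. }
set (r := Rmin r1 r2 / 2).
assert (Hr : 0 < r /\ r < r1 /\ r < r2).
{ assert (0 < Rmin r1 r2) by (apply Rmin_pos; auto).
  generalize (Rmin_l r1 r2) (Rmin_r r1 r2). unfold r. lra. }
destruct (E1 r PI ltac:(lra) ltac:(lra)) as [A1 A2].
destruct (E2 r (- PI) ltac:(lra) ltac:(lra)) as [B1 B2].
(* The lower sector meets the negative half axis at argument [- PI]; the series has the same value
   at [PI]. *)
rewrite <- (polar_2PI r (- PI)), <- (cser_periodic _ r (- PI)) in B1.
rewrite <- (polar_2PI r (- PI)), <- (cser_periodic _ r (- PI)) in B2.
replace (- PI + 2 * PI) with PI in B1, B2 by ring.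
destruct (stokes_0 _ _ _ _ _ _ _ _ r PI St ltac:(lra) ltac:(lra)) as [x [Hx [_ [_ [S1 S2]]]]].
rewrite A2, B2 in S1. rewrite A1, B1 in S2.
set (z := polar r PI) in *.
assert (Hz : sector a b z) by (apply polar_incl_self; lra).
assert (Z : forall s w, s = Cadd s (Cmul c0 (Cmul x w)) -> c0 = C0 \/ w = C0).
{ intros s w E. assert (E' : Cmul c0 (Cmul x w) = C0).
  { transitivity (Csub (Cadd s (Cmul c0 (Cmul x w))) s). ring. rewrite <- E. ring. }
  apply Cmul_integral in E'. destruct E' as [|E']; auto.
  apply Cmul_integral in E'. tauto. }
destruct (Z _ _ S1) as [|Z1]; auto. destruct (Z _ _ S2) as [|Z2]; auto.
exfalso. apply (Dp z Hz). unfold Mdet. rewrite Z1, Z2. ring.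
Qed.

(** Now [M = - mu], so uniqueness holds from the negative half axis, which has argument [PI] in one
    sector and [- PI] in the other. The jump is tested on the positive half axis against the second
    column of [Hm]. *)
Lemma entire_stokes_1_trivial omega l mu a b Hp Hm c0 c1 :
  0 < omega -> 0 < mu -> a < 0 -> PI < b ->
  is_H omega l mu a b Hp -> is_H omega l mu (- b) (- a) Hm ->
  stokes_relations l mu a b Hp Hm c0 c1 ->
  entire (lsol (- l) (- mu) ((1 / (2 * omega)) ^ 2)) -> c1 = C0.
Proof.
intros Ho Hmu Ha Hb [_ [[_ [_ [_ [_ [Lp1 [_ [Lp2 _]]]]]]] Tp]]
  [Dm [[_ [_ [_ [_ [Lm1 [_ [Lm2 _]]]]]]] Tm]] St He.
generalize PI_RGT_0; intros HP.
assert (Hq : 1 / (2 * omega) <> 0).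
{ apply Rgt_not_eq. apply Rdiv_lt_0_compat; lra. }
destruct (entire_solution_unique (1 / (2 * omega)) (- l) (- mu) a b (fun r t => e11 (Hp (polar r t)))
  (fun r t => e21 (Hp (polar r t))) PI) as [r1 [R1 E1]]; auto using sin_PI; try lra.
{ apply polsol_col1 with (2 := Tp); auto. apply polar_incl_self. }
{ rewrite cos_PI; lra. }
{ apply Clim_lim0 with (1 := Lp1) (2 := polar_incl_self a b). lra. }
{ apply Clim_lim0 with (1 := Lp2) (2 := polar_incl_self a b). lra. }
destruct (entire_solution_unique (1 / (2 * omega)) (- l) (- mu) (- b) (- a) (fun r t => e11 (Hm (polar r t)))
  (fun r t => e21 (Hm (polar r t))) (- PI)) as [r2 [R2 E2]]; auto; try lra.
{ apply polsol_col1 with (2 := Tm); auto. apply polar_incl_self. }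
{ rewrite sin_neg, sin_PI; ring. }
{ rewrite cos_neg, cos_PI; lra. }
{ apply Clim_lim0 with (1 := Lm1) (2 := polar_incl_self (- b) (- a)). lra. }
{ apply Clim_lim0 with (1 := Lm2) (2 := polar_incl_self (- b) (- a)). lra. }
set (r := Rmin r1 r2 / 2).
assert (Hr : 0 < r /\ r < r1 /\ r < r2).
{ assert (0 < Rmin r1 r2) by (apply Rmin_pos; auto).
  generalize (Rmin_l r1 r2) (Rmin_r r1 r2). unfold r. lra. }
destruct (E1 r 0 ltac:(lra) ltac:(lra)) as [A1 A2].
destruct (E2 r 0 ltac:(lra) ltac:(lra)) as [B1 B2].
assert (P2 : polar r (2 * PI) = polar r 0).
{ rewrite <- (polar_2PI r 0). f_equal. ring. }
destruct (stokes_1 _ _ _ _ _ _ _ _ r (2 * PI) St ltac:(lra) ltac:(lra)) as [x [Hx [_ [_ [S1 S2]]]]].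
rewrite P2 in S1, S2. rewrite A1, B1 in S1. rewrite A2, B2 in S2.
set (z := polar r 0) in *.
assert (Hz : sector (- b) (- a) z) by (apply polar_incl_self; lra).
assert (Z : forall s w, s = Cadd s (Cmul c1 w) -> c1 = C0 \/ w = C0).
{ intros s w E. apply Cmul_integral.
  transitivity (Csub (Cadd s (Cmul c1 w)) s). ring. rewrite <- E. ring. }
destruct (Z _ _ S1) as [|Z1]; auto. destruct (Z _ _ S2) as [|Z2]; auto.
exfalso. apply (Dm z Hz). unfold Mdet. rewrite Z1, Z2. ring.
Qed.

Theorem mainTheorem5 (omega l mu : R) (a b : R) (Hp Hm : Cplx -> M2) (c0 c1 : Cplx) :
  0 < omega -> 0 <= l -> 0 < mu ->
  - PI / 2 < a < 0 -> PI < b < 3 * PI / 2 ->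
  is_H omega l mu a b Hp ->
  is_H omega l mu (- b) (- a) Hm ->
  stokes_relations l mu a b Hp Hm c0 c1 ->
  ((exists p : list Cplx,
      poly_solution l mu (1 / (4 * omega ^ 2) - mu ^ 2) p)
   <-> ((exists n : nat, l = INR n) /\ c1 = C0 /\ c0 <> C0)).
Proof.
intros Ho _ Hmu [_ Ha] [Hb _] HHp HHm St.
set (q := 1 / (2 * omega)).
assert (Hq : q <> 0).
{ apply Rgt_not_eq. apply Rdiv_lt_0_compat; lra. }
assert (Hq2 : q ^ 2 <> 0) by (apply pow_nonzero; auto).
replace (1 / (4 * omega ^ 2)) with (q ^ 2) by (unfold q; field; lra).
assert (Hmu' : mu <> 0) by lra.
rewrite poly_solution_iff by auto. split.
- intros [n [Hl Hn]].
  split; [exists n; auto|split].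
  + apply (entire_stokes_1_trivial omega l mu a b Hp Hm c0 c1); auto. fold q.
    apply entire_esol; auto. apply entire_finite with n; auto.
  + intros E. subst c0. rewrite Hl in Hn.
    apply (esol_polynomial_not_entire n mu (q ^ 2)); auto.
    rewrite <- Hl. apply (stokes_0_trivial_entire omega l mu a b Hp Hm c1); auto.
- intros [[n Hl] [E1 E0]]. subst c1. exists n. split; auto. rewrite Hl.
  apply esol_polynomial; auto; rewrite <- Hl.
  + apply (stokes_1_trivial_entire omega l mu a b Hp Hm c0); auto.
  + intros He. apply E0. apply (entire_stokes_0_trivial omega l mu a b Hp Hm c0 C0); auto.
Qed.
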